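(* Let $X$ and $\Gamma$ be two nondegenerate rational normal scrolls of dimensions $m$ and $n$, respectively, in $\mathbb{P}^r$, with $m\le n$ and such that $X\cap\Gamma$ is a zero-dimensional scheme. Then $$\operatorname{length}(X\cap\Gamma)\le nr+m-\binom{n}{2}+1.$$
   Context: The base field $k$ is algebraically closed. A rational normal scroll of dimension $n\geq 1$ in $\mathbb{P}^r$ is a variety $S(a_1,\dots,a_n)$ with integers $a_i\ge0$, not all zero, $\sum_i a_i=r-n+1$: the image of $\mathbb{P}\big(\bigoplus_{i=1}^n\mathcal{O}_{\mathbb{P}^1}(a_i)\big)$ under the complete linear system of the tautological line bundle $\mathcal{O}(1)$. For $n=1$ it is a rational normal curve. Nondegenerate means not contained in a hyperplane. $X\cap\Gamma$ is the scheme-theoretic intersection. *)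

(* Defs.v *)
From HB Require Import structures.
From mathcomp Require Import all_boot all_order all_algebra.
From mathcomp Require Import boolp classical_sets.
From mathcomp Require Import mpoly.

Set Implicit Arguments.
Unset Strict Implicit.
Unset Printing Implicit Defensive.

Import Order.TTheory GRing.Theory Num.Theory.

Local Open Scope classical_set_scope.
Local Open Scope ring_scope.

(* Both the Krull dimension of a scheme and the length of a module are suprema
   of lengths of strict chains J 0 < J 1 < ... < J l of members of C. *)
Definition strict_chain (T : Type) (C : set (set T)) (l : nat) : Prop :=
  exists J : nat -> set T,
    (forall i, (i <= l)%N -> C (J i)) /\
    (forall i, (i < l)%N -> J i `<` J i.+1).

Section ProjectiveSpace.
Variables (k : closedFieldType) (r : nat).

Notation S := {mpoly k[r.+1]}.

(* A subvariety X of P^r is given by the set of all nonzero coordinate vectors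
   of its points. *)

Definition nondegenerate_in_Pr (X : set 'rV[k]_r.+1) : Prop :=
  forall u : 'cV[k]_r.+1, u != 0 -> exists2 v, X v & v *m u != 0.

(* P(O(a_1) + ... + O(a_n)) is the projective bundle of one-dimensional
   quotients: over the point (s : t) of P^1 its points are the (x_1 : ... : x_n),
   and the tautological O(1) has the basis of global sections
   x_i s^(a_i - j) t^j, for i <= n and j <= a_i. *)
Definition monomial_sections (n : nat) (a : 'I_n -> nat) (s t : k)
    (x : 'I_n -> k) : 'rV[k]_(\sum_(i < n) (a i).+1) :=
  \mxrow_(i < n) \row_(j < (a i).+1) (x i * s ^+ (a i - j) * t ^+ j).

(* The columns of A are the sections of O(1) used as coordinates on P^r. *)
Definition scroll_image (n : nat) (a : 'I_n -> nat)
    (A : 'M[k]_(\sum_(i < n) (a i).+1, r.+1)) : set 'rV[k]_r.+1 :=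
  [set v | exists (s t : k) (x : 'I_n -> k),
    [/\ (s, t) != (0, 0), exists i, x i != 0
      & v = monomial_sections a s t x *m A]].

(* row_free and row_full say that the columns of A are a basis of H^0(O(1)),
   i.e., that the linear system is complete. *)
Definition rational_normal_scroll (n : nat) (X : set 'rV[k]_r.+1) : Prop :=
  (0 < n)%N /\
  exists a : 'I_n -> nat,
    [/\ exists i, a i != 0%N,
        (\sum_(i < n) a i + n = r + 1)%N
      & exists A : 'M[k]_(\sum_(i < n) (a i).+1, r.+1),
          [/\ row_free A, row_full A & X = scroll_image A]].

(* The homogeneous ideal generated by the forms vanishing on X. *)
Definition vanishing_ideal (X : set 'rV[k]_r.+1) : set S :=
  [set f | forall (d : nat) (v : 'rV[k]_r.+1), X v ->
     (pihomog mdeg d f).@[v 0] = 0].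

(* The sum of the two ideals defines the scheme-theoretic intersection. *)
Definition intersection_ideal (X Y : set 'rV[k]_r.+1) : set S :=
  [set f + g | f in vanishing_ideal X & g in vanishing_ideal Y].

(* From here on, a homogeneous ideal I stands for the closed subscheme
   Proj (S / I) of P^r. *)

(* The points of Proj (S / I); idealr_closed includes that 1 is not in P. *)
Definition proj_point (I : set S) : set (set S) :=
  [set P : set S |
    [/\ idealr_closed (mem P), prime_idealr_closed (mem P),
        (forall (d : nat) (f : S), P f -> P (pihomog mdeg d f)),
        (exists i : 'I_r.+1, ~ P 'X_i)
      & I `<=` P]].

(* Dimension at most 0; the empty scheme is allowed. *)
Definition zero_dimensional (I : set S) : Prop :=
  forall l, strict_chain (proj_point I) l -> l = 0%N.

(* The local ring of P^r at P, inside the fraction field of S. *)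
Definition local_ring (P : set S) : set {fraction S} :=
  [set z | exists (d : nat) (f g : S),
    [/\ f \is d.-homog, g \is d.-homog, ~ P g & z = tofrac f / tofrac g]].

(* The stalk at P of the ideal sheaf of Proj (S / I). *)
Definition local_ideal (I P : set S) : set {fraction S} :=
  [set z | exists (d : nat) (f g : S),
    [/\ f \is d.-homog, g \is d.-homog, I f, ~ P g
      & z = tofrac f / tofrac g]].

(* The ideals of local_ring P containing local_ideal I P; they correspond to
   the ideals of the local ring local_ring P / local_ideal I P of
   Proj (S / I) at P. *)
Definition ideal_over (I P : set S) : set (set {fraction S}) :=
  [set J | [/\ local_ideal I P `<=` J, J `<=` local_ring P
    & forall a u v, local_ring P a -> J u -> J v -> J (a * u + v)]].

Definition has_local_length (I P : set S) (l : nat) : Prop :=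
  strict_chain (ideal_over I P) l /\
  forall l', strict_chain (ideal_over I P) l' -> (l' <= l)%N.

(* Proj (S / I) has finitely many points P_0, ..., P_(N-1), and the lengths of
   its local rings at these points add up to l. *)
Definition has_length (I : set S) (l : nat) : Prop :=
  exists (N : nat) (P : 'I_N -> set S) (e : 'I_N -> nat),
    [/\ injective P, range P = proj_point I,
        (forall i, has_local_length I (P i) (e i))
      & l = (\sum_(i < N) e i)%N].

End ProjectiveSpace.

(* Main.v *)
Require Import Defs.
From HB Require Import structures.
From mathcomp Require Import all_boot all_order all_algebra.
From mathcomp Require Import boolp classical_sets.
From mathcomp Require Import mpoly ring zify.

Set Implicit Arguments.
Unset Strict Implicit.
Unset Printing Implicit Defensive.

Import Order.TTheory GRing.Theory Num.Theory.

Local Open Scope classical_set_scope.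
Local Open Scope ring_scope.

(* Write R for the coordinate ring of X, J for the ideal of R generated by the
   2 x 2 minors of the 2 x D matrix of linear forms defining Gamma, and let h
   be a linear form without zeros on X and Gamma.  The bound follows from
   R_3 = J_3 + h R_2: then multiplication by h is surjective on R / J in
   degrees >= 2, so that the length is at most dim (R / J)_2.

   To prove it, let (x_v, y_v) be the columns of the matrix and put
   f_v = x_v + y_v.  Since R is Cohen-Macaulay of regularity 1, the Koszul
   complex of h and the f_v is exact in degree 3, and therefore
   f_v b |-> x_v b is a well defined endomorphism of R_3 / (J_3 + h R_2).  If
   this space is not zero, an eigenvalue gives (al, be) <> 0 such that h and
   the al x_v + be y_v do not generate R in degree 3.  But these forms have no
   common zero on X, and then they generate R even in degree 2: this is proved
   by the same eigenvalue argument, applied to the polynomial ring, the matrix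
   of X and degree 2.

   Finally dim R_2 is known, which suffices if m < n.  If m = n one needs in
   addition dim J_2 >= D - 1, which follows from
   dim (U W) >= dim U + dim W - 1 for spaces U, W of polynomials. *)

(** * Pencils of linear maps *)

(** The form [h] is not given. It comes from zero-dimensionality by a Zorn argument: a homogeneous
    ideal that is maximal among those without such a form is prime and would start a chain of two
    points. Finiteness of the set of points and of the local lengths is not given either; both
    follow from one bound on the sum of lengths of chains at distinct points.

    Gamma enters through its minors and through the fact that a point lies on Gamma as soon as some
    member of the pencil of columns vanishes there; hence the role of al x_v + be y_v. The sums f_v
    are suitable because x_v f_w - x_w f_v is the minor x_v y_w - x_w y_v: the Koszul relations
    between the x_v and the f_v hold modulo J.

    Koszul exactness is obtained by counting: normal forms with respect to linear parameters span,
    and there are as many of them as the Hilbert function prescribes.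

    The constants fit exactly. For n = m + 1 the bound equals dim R_2, and n r - C(n, 2) does not
    decrease as long as n <= r; for n = m the bound equals dim R_2 - (D - 1). *)

Section LinearAlgebra.
Variable k : fieldType.

Definition submodule (E : lmodType k) (P : E -> Prop) : Prop :=
  P 0 /\ forall a u v, P u -> P v -> P (a *: u + v).

Variable E : vectType k.

(** Otherwise every subspace inside [P] could be enlarged by a line, which would give subspaces of
    unbounded dimension. *)
Lemma submodule_vspace (P : E -> Prop) :
  submodule P -> exists V : {vspace E}, forall x, (x \in V) <-> P x.
Proof.
move=> [P0 PL]; apply: contrapT => noV.
have big n : exists2 V : {vspace E}, (forall x, x \in V -> P x)
    & (n <= \dim V)%N.
  elim: n => [|n [V VP ltn]].
    by exists 0%VS => // x; rewrite memv0 => /eqP ->.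
  have [x Px xV] : exists2 x, P x & x \notin V.
    apply: contrapT => nx; apply: noV; exists V => x; split; first exact: VP.
    by move=> Px; apply: contrapT => /negP xV; apply: nx; exists x.
  exists (<[x]> + V)%VS => [y /memv_addP[_ /vlineP[a ->] [v vV ->]]|].
    exact: PL (VP _ vV).
  apply: leq_ltn_trans ltn _; have sVxV := dimv_leqif_sup (addvSr <[x]> V).
  by rewrite ltn_neqAle sVxV.1 sVxV.2 subv_add negb_and -memvE xV.
have [V _] := big (\dim {: E}).+1.
by rewrite leqNgt ltnS dimvS ?subvf.
Qed.

(** Stands in for the quotient [E / V]: [q] is the projection to a complement of [V], written in a
    basis. *)
Lemma quotient_coordinates (V : {vspace E}) :
  exists q : E -> 'rV[k]_(\dim {:E} - \dim V), linear q /\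
    (forall e, q e = 0 <-> e \in V) /\ (forall y, exists e, q e = y).
Proof.
rewrite -dimv_compl; set W := (V^C)%VS.
have capWV : (W :&: V = 0)%VS by rewrite capvC capv_compl.
have capVW : (V :&: W = 0)%VS by rewrite capv_compl.
pose f e : 'rV[k]_(\dim W) :=
  \row_i coord (vbasis W) i (daddv_pi W V e).
have f_linear : linear f.
  by move=> a u v; apply/rowP => i; rewrite !mxE !linearP.
exists f; split=> //; split=> [e|y].
  have eE : daddv_pi W V e + daddv_pi V W e = e.
    by apply: daddv_pi_add => //; rewrite addvC addv_complf memvf.
  split=> [/rowP qe0|eV].
    rewrite -eE (coord_vbasis (memv_pi W V e)) big1 ?add0r ?memv_pi //.
    by move=> i _; have := qe0 i; rewrite !mxE => ->; rewrite scale0r.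
  suff W0 : daddv_pi W V e = 0.
    by apply/rowP => i; rewrite !mxE W0 linear0.
  apply/(addIr (daddv_pi V W e)); rewrite eE add0r.
  by rewrite [in RHS](daddv_pi_id capVW eV).
exists (\sum_i y 0 i *: (vbasis W)`_i); apply/rowP => i; rewrite mxE.
rewrite daddv_pi_id // ?coord_sum_free ?(basis_free (vbasisP W)) //.
apply: memv_suml => j _; apply/memvZ/vbasis_mem/mem_nth.
by rewrite size_tuple.
Qed.

End LinearAlgebra.

Section LinearFunctions.
Variables (k : fieldType) (E F : lmodType k) (q : E -> F).
Hypothesis q_linear : linear q.

Lemma linear_D x y : q (x + y) = q x + q y.
Proof. by rewrite -[x]scale1r q_linear !scale1r. Qed.

Lemma linear_0 : q 0 = 0.
Proof. by apply/(addIr (q 0)); rewrite -linear_D !add0r. Qed.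

Lemma linear_Z a x : q (a *: x) = a *: q x.
Proof. by rewrite -[a *: x]addr0 q_linear linear_0 addr0. Qed.

Lemma linear_B x y : q (x - y) = q x - q y.
Proof. by rewrite linear_D -scaleN1r linear_Z scaleN1r. Qed.

Lemma linear_sumZ (I : finType) (a : I -> k) (x : I -> E) :
  q (\sum_i a i *: x i) = \sum_i a i *: q (x i).
Proof.
elim/big_rec2: _ => [|i y z _ <-]; first exact: linear_0.
by rewrite linear_D linear_Z.
Qed.

End LinearFunctions.

Section Pencils.
Variables (k : closedFieldType) (E : vectType k) (K : E -> Prop).
Variable L : E -> E -> Prop.
Hypotheses (subK : submodule K) (L0 : L 0 0).
Hypothesis LP : forall a u v u' v',
  L u v -> L u' v' -> L (a *: u + u') (a *: v + v').

Lemma pencil_sum (I : finType) (a : I -> k) (u v : I -> E) :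
  (forall i, L (u i) (v i)) -> L (\sum_i a i *: u i) (\sum_i a i *: v i).
Proof.
move=> Luv; elim/big_ind2: _ => // [x x' y y' Lx Ly|i _].
  by rewrite -[x]scale1r -[x']scale1r; apply: LP.
by rewrite -[_ *: u i]addr0 -[_ *: v i]addr0; apply: LP.
Qed.

(* If K <> E then [u |-> v] induces an endomorphism of E / K, and an eigenvalue
   of it gives a member of the pencil which is not surjective modulo K. *)
Lemma pencil_surjective :
  (forall u v, L u v -> K u -> K v) ->
  (forall al be : k, (al, be) != (0, 0) ->
     forall e, exists u v, L u v /\ K (e - (al *: u + be *: v))) ->
  forall e, K e.
Proof.
move=> LK surj.
have [V VK] := submodule_vspace subK.
have [q [qlin [qK q_surj]]] := quotient_coordinates V.
have qKE e : q e = 0 <-> K e by rewrite qK VK.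
move: (_ - _)%N => d in q qlin qK q_surj qKE *.
have qB x y : q (x - y) = q x - q y by exact: linear_B qlin x y.
have qS := linear_sumZ qlin.
have qD := linear_D qlin.
have qZ := linear_Z qlin.
case: (posnP d) => [d0|dgt0] e.
  by apply/qKE/rowP => -[i lti]; exfalso; move: lti; rewrite d0.
exfalso.
have /choice[uv uvP] (i : 'I_d) :
    exists uv : E * E, L uv.1 uv.2 /\ q uv.1 = delta_mx 0 i.
  have [w qw] := q_surj (delta_mx 0 i).
  have [|u [v [Luv]]] := surj 1 0 _ w.
    by rewrite xpair_eqE oner_eq0.
  rewrite scale1r scale0r addr0 -qKE qB => /subr0_eq qwu.
  by exists (u, v); split=> //=; rewrite -qwu.
(* Row [i] of [T] is the image of the unit vector [i] under the induced endomorphism of [E / K]. *)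
pose T := \matrix_(i < d) q (uv i).2.
have [rho] : exists rho, root (char_poly T^T) rho.
  by apply/closed_rootP; rewrite size_char_poly eqSS -lt0n.
rewrite -eigenvalue_root_char => /eigenvalueP[w wT w0].
(* So [y |-> y *m w^T] is a functional on [E / K] which the endomorphism multiplies by [rho]. *)
have TcE : T *m w^T = rho *: w^T by rewrite -[T]trmxK -trmx_mul wT linearZ.
have qL u v : L u v -> q v *m w^T = rho *: (q u *m w^T).
  move=> Luv.
  have E1 : q u = \sum_i q u 0 i *: q (uv i).1.
    by rewrite {1}[q u]row_sum_delta; apply: eq_bigr => i _; case: (uvP i) => _ ->.
  have : K (- (\sum_i q u 0 i *: (uv i).2) + v).
    rewrite -scaleN1r.
    apply: (LK (- (\sum_i q u 0 i *: (uv i).1) + u)).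
      rewrite -scaleN1r; apply: LP => //; apply: pencil_sum => i.
      by case: (uvP i).
    by apply/qKE; rewrite addrC qB qS -E1 subrr.
  move/qKE; rewrite addrC qB => /subr0_eq ->.
  rewrite scalemxAr -TcE mulmxA; congr (_ *m _).
  rewrite mulmx_sum_row qS; apply: eq_bigr => i _.
  by rewrite rowK.
have q0 (y : 'rV_d) : y *m w^T = 0.
  have [x <-] := q_surj y.
  (* The member [- rho *: u + v] of the pencil has values in the kernel of this functional, yet it
     is surjective modulo [K]. *)
  have [|u [v [Luv]]] := surj (- rho) 1 _ x.
    by rewrite xpair_eqE oner_eq0 andbF.
  move/qKE; rewrite qB scale1r => /subr0_eq ->.
  by rewrite qD qZ mulmxDl (qL _ _ Luv) -scalemxAl scaleNr addNr.
case/eqP: w0; apply/trmx_inj/row_matrixP => i.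
by rewrite rowE q0 trmx0 row0.
Qed.

(** For chosen pairs whose first components lift the unit vectors of [E / K], the matrix of
    [u + tau *: v] is [1 + tau T]; its determinant is a polynomial in [tau] with value 1 at 0. *)
Lemma pencil_surjective_generic :
  (forall e, exists u v, L u v /\ K (e - u)) ->
  exists2 p : {poly k}, p != 0 & forall tau, p.[tau] != 0 ->
    forall e, exists u v, L u v /\ K (e - (u + tau *: v)).
Proof.
move=> surj.
have [V VK] := submodule_vspace subK.
have [q [qlin [qK q_surj]]] := quotient_coordinates V.
have qKE e : q e = 0 <-> K e by rewrite qK VK.
move: (_ - _)%N => d in q qlin qK q_surj qKE *.
have qB x y : q (x - y) = q x - q y by exact: linear_B qlin x y.
have qS := linear_sumZ qlin.
have qD := linear_D qlin.
have qZ := linear_Z qlin.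
have /choice[uv uvP] (i : 'I_d) :
    exists uv : E * E, L uv.1 uv.2 /\ q uv.1 = delta_mx 0 i.
  have [w qw] := q_surj (delta_mx 0 i).
  have [u [v [Luv]]] := surj w.
  rewrite -qKE qB => /subr0_eq qwu.
  by exists (u, v); split=> //=; rewrite -qwu.
pose T := \matrix_(i < d) q (uv i).2.
pose p : {poly k} := \det (1%:M + 'X *: map_mx polyC T).
have pE tau : p.[tau] = \det (1%:M + tau *: T).
  rewrite -/(horner_eval tau p) -det_map_mx; congr (\det _).
  apply/matrixP => i j; rewrite !mxE /= /horner_eval !hornerE.
  by case: (i == j); rewrite hornerE.
exists p.
  apply/eqP => p0; have := pE 0.
  by rewrite p0 horner0 scale0r addr0 det1 => /esym/eqP; rewrite oner_eq0.
move=> tau; rewrite pE -unitfE => unitT e.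
pose a := q e *m invmx (1%:M + tau *: T).
exists (\sum_i a 0 i *: (uv i).1), (\sum_i a 0 i *: (uv i).2).
split; first by apply: pencil_sum => i; case: (uvP i).
apply/qKE; rewrite qB qD qZ !qS.
have -> : q e = a *m (1%:M + tau *: T) by rewrite mulmxKV.
rewrite mulmxDr mulmx1 -scalemxAr {1}[a]row_sum_delta mulmx_sum_row.
apply/eqP; rewrite subr_eq0; apply/eqP; congr (_ + _ *: _).
  by apply: eq_bigr => i _; case: (uvP i) => _ ->.
by apply: eq_bigr => i _; rewrite rowK.
Qed.

End Pencils.

(** * Homogeneous ideals *)

Section HomogeneousIdeals.
Variables (k : fieldType) (n : nat).
Notation S := {mpoly k[n]}.

Definition ideal (K : set S) : Prop :=
  K 0 /\ forall a u v, K u -> K v -> K (a * u + v).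

Definition homog_ideal (K : set S) : Prop :=
  ideal K /\ forall d f, K f -> K (pihomog mdeg d f).

Definition contains_degree (K : set S) (d : nat) : Prop :=
  forall f, f \is d.-homog -> K f.

Definition adjoin (I : finType) (K : set S) (g : I -> S) : set S :=
  [set f | exists b : I -> S, K (f - \sum_i g i * b i)].

Definition adjoin1 (K : set S) (g : S) : set S := adjoin K (fun _ : 'I_1 => g).

Section Ideal.
Variable K : set S.
Hypothesis idK : ideal K.

Lemma ideal0 : K 0. Proof. by case: idK. Qed.

Lemma idealMl a u : K u -> K (a * u).
Proof. by case: idK => K0 KP Ku; rewrite -[_ * _]addr0; apply: KP. Qed.

Lemma idealMr a u : K u -> K (u * a).
Proof. by rewrite mulrC; apply: idealMl. Qed.

Lemma idealD u v : K u -> K v -> K (u + v).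
Proof. by case: idK => K0 KP Ku Kv; rewrite -[u]mul1r; apply: KP. Qed.

Lemma idealN u : K u -> K (- u).
Proof. by rewrite -mulN1r; apply: idealMl. Qed.

Lemma idealB u v : K u -> K v -> K (u - v).
Proof. by move=> Ku /idealN; apply: idealD. Qed.

Lemma idealZ a u : K u -> K (a *: u).
Proof. by rewrite -mul_mpolyC; apply: idealMl. Qed.

Lemma ideal_sum (T : Type) (s : seq T) (P : pred T) (F : T -> S) :
  (forall i, P i -> K (F i)) -> K (\sum_(i <- s | P i) F i).
Proof. by move=> KF; elim/big_ind: _ => //; [exact: ideal0|exact: idealD]. Qed.

Lemma ideal_eqmod u v : K (u - v) -> K v -> K u.
Proof. by move=> uv Kv; rewrite -(subrK v u); apply: idealD. Qed.

Lemma ideal_trans v u w : K (u - v) -> K (v - w) -> K (u - w).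
Proof. by move=> uv vw; rewrite -(subrKA v); apply: idealD. Qed.

Lemma ideal_submodule : submodule (K : S -> Prop).
Proof.
split; first exact: ideal0.
by move=> a u v Ku Kv; apply: idealD => //; apply: idealZ.
Qed.

Lemma ideal_adjoin (I : finType) (g : I -> S) : ideal (adjoin K g).
Proof.
split=> [|a u v [b Kb] [c Kc]].
  exists (fun=> 0); rewrite big1 ?subr0; first exact: ideal0.
  by move=> i _; rewrite mulr0.
exists (fun i => a * b i + c i).
have -> : a * u + v - \sum_i g i * (a * b i + c i) =
  a * (u - \sum_i g i * b i) + (v - \sum_i g i * c i).
  rewrite mulrBr mulr_sumr addrACA -opprD -big_split; congr (_ - _).
  by apply: eq_bigr => i _; rewrite mulrDr mulrCA.
by apply: idealD => //; apply: idealMl.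
Qed.

Lemma sub_adjoin (I : finType) (g : I -> S) : K `<=` adjoin K g.
Proof.
by move=> f Kf; exists (fun=> 0); rewrite big1 ?subr0 // => i _; rewrite mulr0.
Qed.

Lemma adjoin_mem (I : finType) (g : I -> S) i : adjoin K g (g i).
Proof.
exists (fun j => (j == i)%:R); rewrite (bigD1 i) //= eqxx mulr1 big1 ?addr0.
  by rewrite subrr; apply: ideal0.
by move=> j /negPf ->; rewrite mulr0.
Qed.

Lemma adjoin1P g f : adjoin1 K g f <-> exists b, K (f - g * b).
Proof.
split=> [[b]|[b Kb]]; first by rewrite big_ord1; exists (b ord0).
by exists (fun=> b); rewrite big_ord1.
Qed.

Lemma contains_degree_mon d :
  (forall m, mdeg m = d -> K 'X_[m]) -> contains_degree K d.
Proof.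
move=> KX f /dhomogP fd; rewrite [f]mpolyE big_seq; apply: ideal_sum => m.
by move=> /fd/KX; apply: idealZ.
Qed.

Lemma contains_degreeS d : contains_degree K d -> contains_degree K d.+1.
Proof.
move=> Kd; apply: contains_degree_mon => m dm.
have [i mi] : exists i, m i != 0%N.
  apply: contrapT => noi; have : mdeg m = 0%N.
    by rewrite mdegE big1 // => i _; apply: contrapT => /eqP mi; apply: noi; exists i.
  by rewrite dm.
have lem : (U_(i) <= m)%MM by rewrite lep1mP.
rewrite -(submK lem) mpolyXD; apply/idealMr/Kd.
by rewrite dhomogX /= -eqSS -addn1 -(mdeg1 i) -mdegD submK // dm.
Qed.

End Ideal.

Lemma ideal_sub_adjoin (I : finType) (K K' : set S) (g : I -> S) :
  ideal K' -> K `<=` K' -> (forall i, K' (g i)) -> adjoin K g `<=` K'.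
Proof.
move=> idK' KK' K'g f [b /KK' K'f]; apply: ideal_eqmod K'f _ => //.
by apply: ideal_sum => // i _; apply: idealMr.
Qed.

Lemma mnm_split d e (m : 'X_{1..n}) : mdeg m = (d + e)%N ->
  exists m1 m2, [/\ mdeg m1 = d, mdeg m2 = e & m = (m1 + m2)%MM].
Proof.
elim: d => [|d IHd] in m * => dm.
  by exists 0%MM, m; split; rewrite ?mdeg0 ?add0m.
have [i mi] : exists i, m i != 0%N.
  apply: contrapT => noi; have : mdeg m = 0%N.
    by rewrite mdegE big1 // => i _; apply: contrapT => /eqP mi; apply: noi; exists i.
  by rewrite dm.
have lem : (U_(i) <= m)%MM by rewrite lep1mP.
have [|m1 [m2 [d1 d2 E]]] := IHd (m - U_(i))%MM.
  by apply/eqP; rewrite -eqSS -addn1 -(mdeg1 i) -mdegD submK // dm.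
exists (m1 + U_(i))%MM, m2; split=> //; first by rewrite mdegD d1 mdeg1 addn1.
by rewrite -addmA [(U_(i) + _)%MM]addmC addmA -E submK.
Qed.

Lemma contains_degreeM (K1 K2 K : set S) d e : ideal K ->
  (forall f g, K1 f -> K2 g -> K (f * g)) ->
  contains_degree K1 d -> contains_degree K2 e -> contains_degree K (d + e).
Proof.
move=> idK K12 K1d K2e; apply: contains_degree_mon => // m.
move=> /mnm_split[m1 [m2 [d1 d2 ->]]]; rewrite mpolyXD.
by apply: K12; [apply: K1d|apply: K2e]; rewrite dhomogX /= ?d1 ?d2.
Qed.

Lemma pihomogMl d e (g q : S) : g \is e.-homog ->
  pihomog mdeg d (g * q) = if (e <= d)%N then g * pihomog mdeg (d - e) q else 0.
Proof.
move=> ge; have [N [leq_N ltdN]] : exists N, (msize q <= N)%N /\ (d < N)%N.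
  by exists (maxn (msize q) d.+1); rewrite leq_maxl leq_maxr.
rewrite {1}(pihomog_partitionE leq_N) mulr_sumr linear_sum /=.
under eq_bigr => i _.
  rewrite (_ : pihomog _ _ _ = if (e + i == d)%N then g * pihomog mdeg i q else 0).
    over.
  have hgq : g * pihomog mdeg i q \is (e + i).-homog.
    by apply: dhomogM => //; apply: pihomogP.
  case: eqVneq => [<-|ne]; first by rewrite pihomog_dE.
  exact: (pihomog_ne0 ne hgq).
case: leqP => [led|ltd]; last first.
  by rewrite big1 // => i _; rewrite gtn_eqF // ltn_addr.
have ltN : (d - e < N)%N by rewrite (leq_ltn_trans (leq_subr _ _)).
rewrite (bigD1 (Ordinal ltN)) //= subnKC // eqxx big1 ?addr0 // => i ni.
case: eqP => // eid; case/eqP: ni; apply/val_inj => /=.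
by rewrite -eid addKn.
Qed.

Lemma pihomog_combination (I : finType) (e : I -> nat) d (g b : I -> S) :
  (forall i, g i \is (e i).-homog) ->
  pihomog mdeg d (\sum_i g i * b i) =
  \sum_i g i * (if (e i <= d)%N then pihomog mdeg (d - e i) (b i) else 0).
Proof.
move=> ge; rewrite linear_sum; apply: eq_bigr => i _ /=.
by rewrite (pihomogMl _ _ (ge i)); case: ifP => // _; rewrite mulr0.
Qed.

Lemma pihomogM d (p q : S) :
  pihomog mdeg d (p * q) =
  \sum_(i < d.+1) pihomog mdeg i p * pihomog mdeg (d - i) q.
Proof.
have [N [lep_N ltdN]] : exists N, (msize p <= N)%N /\ (d < N)%N.
  by exists (maxn (msize p) d.+1); rewrite leq_maxl leq_maxr.
rewrite {1}(pihomog_partitionE lep_N) mulr_suml linear_sum /=.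
under eq_bigr => i _ do rewrite (pihomogMl _ _ (pihomogP _ _ _)).
rewrite -big_mkcond /= -(big_mkord (fun i => (i <= d)%N)
  (fun i => pihomog mdeg i p * pihomog mdeg (d - i) q)).
rewrite big_nat_cond -(big_mkord xpredT
  (fun i => pihomog mdeg i p * pihomog mdeg (d - i) q)).
rewrite [RHS](big_nat_widen _ _ _ _ _ ltdN).
rewrite big_nat_cond [RHS]big_nat_cond; apply: eq_bigl => i.
by rewrite ltnS andbA andbb.
Qed.

Section HomogIdeal.
Variable K : set S.
Hypothesis hK : homog_ideal K.

Let idK := hK.1.

Lemma homog_idealP f : (forall d, K (pihomog mdeg d f)) -> K f.
Proof.
by move=> Kf; rewrite (pihomog_partitionE (leqnn (msize f))); apply: ideal_sum.
Qed.

Lemma homog_adjoin (I : finType) (g : I -> S) (e : I -> nat) :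
  (forall i, g i \is (e i).-homog) -> homog_ideal (adjoin K g).
Proof.
move=> ge; split=> [|d f [b Kf]]; first exact: ideal_adjoin.
exists (fun i => if (e i <= d)%N then pihomog mdeg (d - e i) (b i) else 0).
by have := hK.2 d _ Kf; rewrite pihomogB (pihomog_combination _ _ ge).
Qed.

Lemma adjoin_dhomog (I : finType) (g : I -> S) e d f :
  (forall i, g i \is e.-homog) -> f \is (e + d).-homog -> adjoin K g f ->
  exists2 b : I -> S, forall i, b i \is d.-homog & K (f - \sum_i g i * b i).
Proof.
move=> ge fd [b Kf]; exists (fun i => pihomog mdeg d (b i)).
  by move=> i; apply: pihomogP.
have := hK.2 (e + d)%N _ Kf; rewrite pihomogB (pihomog_combination _ _ ge).
by rewrite leq_addr addKn /= (pihomog_dE fd).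
Qed.

Lemma adjoin1_dhomog (g : S) e d f :
  g \is e.-homog -> f \is (e + d).-homog -> adjoin1 K g f ->
  exists2 b : S, b \is d.-homog & K (f - g * b).
Proof.
move=> ge fd /(adjoin_dhomog (fun=> ge) fd)[b bd].
by rewrite big_ord1; exists (b ord0).
Qed.

(** Take the lowest components of [f] and [g] outside [K], of degrees [i] and [j]. In degree [i + j]
    of [f * g] all other products have a factor in [K]. *)
Lemma homog_prime :
  (forall d e f g, f \is d.-homog -> g \is e.-homog -> K (f * g) ->
     K f \/ K g) ->
  forall f g, K (f * g) -> K f \/ K g.
Proof.
have least f : ~ K f -> exists2 d, ~ K (pihomog mdeg d f)
    & forall i, (i < d)%N -> K (pihomog mdeg i f).
  move=> nKf; have exd : exists d, ~~ `[< K (pihomog mdeg d f) >].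
    apply: contrapT => nd; apply/nKf/homog_idealP => d.
    by apply: contrapT => nKd; apply: nd; exists d; apply/asboolPn.
  case: (ex_minnP exd) => d /asboolPn nKd mind; exists d => // i ltid.
  apply: contrapT => nKi; have := mind i; rewrite leqNgt ltid.
  by move/(_ (introT (asboolPn _) nKi)).
move=> hprime f g Kfg; apply: contrapT => /not_orP[/least[i nKi Ki] /least[j nKj Kj]].
suff Kij : K (pihomog mdeg i f * pihomog mdeg j g).
  by case: (hprime i j _ _ (pihomogP _ _ _) (pihomogP _ _ _) Kij).
have := hK.2 (i + j)%N _ Kfg; rewrite pihomogM.
have lti : (i < (i + j).+1)%N by rewrite ltnS leq_addr.
rewrite (bigD1 (Ordinal lti)) //= addKn => Ksum.
rewrite -[X in K X](addrK (\sum_(l < (i + j).+1 | l != Ordinal lti)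
   pihomog mdeg l f * pihomog mdeg (i + j - l) g)).
apply: idealB => //; apply: ideal_sum => // l; rewrite -val_eqE /= neq_ltn.
case/orP => [/Ki|ltil]; first exact: idealMr.
apply: idealMl => //; apply: Kj; rewrite ltn_subLR; first by rewrite ltn_add2r.
by rewrite -ltnS.
Qed.

End HomogIdeal.
End HomogeneousIdeals.

(** * A hyperplane missing a zero-dimensional scheme *)

Lemma proper_of_mem (T : Type) (A B : set T) (x : T) :
  A `<=` B -> B x -> ~ A x -> A `<` B.
Proof. by move=> AB Bx nAx; split=> // BA; apply/nAx/BA. Qed.

Section MaximalIdeals.
Variables (k : fieldType) (n : nat) (Lam : set {mpoly k[n]}).
Notation S := {mpoly k[n]}.

(* The hyperplane l = 0 does not meet Proj (S / K). *)
Definition finite_section (K : set S) (l : S) : Prop :=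
  exists d, contains_degree (adjoin1 K l) d.

(** Used for two choices of [Lam]: all linear forms, and [[set 0]]. In the second case it says that
    [K] contains all forms of some degree, so that Proj (S / K) is empty. *)
Definition has_finite_section (K : set S) : Prop :=
  exists2 l, Lam l & finite_section K l.

Lemma maximal_without_section (I : set S) :
  homog_ideal I -> ~ has_finite_section I ->
  exists K, [/\ homog_ideal K, I `<=` K, ~ has_finite_section K
    & forall K', homog_ideal K' -> K `<` K' -> has_finite_section K'].
Proof.
move=> hI nsI.
pose P (K : set S) :=
  K = set0 \/ [/\ homog_ideal K, I `<=` K & ~ has_finite_section K].
have [F FP Ftot|A [PA Amax]] := @Zorn_bigcup S P.
  have [allE|] := pselect (forall X, F X -> X = set0).
    by left; apply/seteqP; split=> // f [X /allE ->].
  move=> /existsNP[X0 /not_implyP[FX0 X0n]].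
  have FX X f : F X -> X f ->
      [/\ homog_ideal X, I `<=` X & ~ has_finite_section X].
    by move=> FX Xf; case: (FP _ FX) => // X00; rewrite X00 in Xf.
  have [hX0 IX0 nsX0] : [/\ homog_ideal X0, I `<=` X0 & ~ has_finite_section X0].
    by case: (FP _ FX0).
  have fin (s : seq S) : (forall x, x \in s -> (\bigcup_(X in F) X) x) ->
      exists X, [/\ F X, homog_ideal X, ~ has_finite_section X
        & forall x, x \in s -> X x].
    elim: s => [|x s IHs] sU; first by exists X0.
    have [|X [FXX hX nX Xs]] := IHs.
      by move=> y ys; apply: sU; rewrite inE ys orbT.
    have [|Y FY Yx] := sU x; first by rewrite inE eqxx.
    have [hY _ nY] := FX _ _ FY Yx.
    case: (Ftot _ _ FXX FY) => [XY|YX].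
      exists Y; split=> // y; rewrite inE => /orP[/eqP ->//|/Xs]; exact: XY.
    by exists X; split=> // y; rewrite inE => /orP[/eqP ->|/Xs//]; apply: YX.
  have two x y : (\bigcup_(X in F) X) x -> (\bigcup_(X in F) X) y ->
      exists X, [/\ F X, homog_ideal X, X x & X y].
    move=> Ux Uy; have [|X [FXX hX _ Xs]] := fin [:: x; y].
      by move=> z; rewrite !inE => /orP[] /eqP ->.
    by exists X; split=> //; apply: Xs; rewrite !inE eqxx ?orbT.
  right; have idU : ideal (\bigcup_(X in F) X).
    split; first by exists X0 => //; apply: ideal0 hX0.1.
    move=> a u v /two Uu /Uu[X [FXX hX Xu Xv]]; exists X => //.
    by apply: (idealD hX.1) => //; apply: (idealMl hX.1).
  split=> [|f If|[l Ll [d Ud]]].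
  - split=> // d f [X FXX Xf]; exists X => //.
    by have [[_ hX] _ _] := FX _ _ FXX Xf; apply: hX.
  - by exists X0 => //; apply: IX0.
  (* A section of the union is witnessed by finitely many elements, one for each monomial of degree
     [d], and these lie in a single ideal of the chain. *)
  - have /choice[b Ub] (m : 'X_{1..n < d.+1}) :
        exists b, mdeg m == d -> (\bigcup_(X in F) X) ('X_[m] - l * b).
      case: eqVneq => [dm|_]; last by exists 0.
      have /Ud/adjoin1P[b Ub] : ('X_[m] : S) \is d.-homog by rewrite dhomogX /= dm.
      by exists b.
    have [|X [FXX hX nX Xs]] :=
      fin [seq 'X_[m] - l * b m | m : 'X_{1..n < d.+1} <- enum {: 'X_{1..n < d.+1}} & mdeg m == d].
      by move=> x /mapP[m]; rewrite mem_filter => /andP[dm _ ->]; apply: Ub.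
    apply: nX; exists l => //; exists d; apply: contains_degree_mon.
      exact/ideal_adjoin/hX.1.
    move=> m dm; have ltm : (mdeg m < d.+1)%N by rewrite dm.
    apply/adjoin1P; exists (b (BMultinom ltm)); apply: Xs.
    apply/mapP; exists (BMultinom ltm) => //.
    by rewrite mem_filter mem_enum /= dm eqxx.
case: PA => [A0|[hA IA nA]].
  case: (Amax I); last by right; split.
  by apply: (@proper_of_mem _ _ _ 0); rewrite ?A0 //; apply: ideal0 hI.1.
exists A; split=> // K' hK' AK'; apply: contrapT => nK'; apply: (Amax _ AK').
by right; split=> //; apply: subset_trans IA (properW AK').
Qed.

Hypothesis directed : forall K1 K2, homog_ideal K1 -> homog_ideal K2 ->
  has_finite_section K1 -> has_finite_section K2 ->
  exists l, [/\ Lam l, finite_section K1 l & finite_section K2 l].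

(** If [f] and [g] are outside [K], then [K + (f)] and [K + (g)] have a common section [l]. The
    product of [K + (f, l)] and [K + (g, l)] lies in [K + (l)] and contains all forms of some
    degree, so [l] would be a section of [K]. *)
Lemma maximal_without_section_prime (K : set S) :
  homog_ideal K -> ~ has_finite_section K ->
  (forall K', homog_ideal K' -> K `<` K' -> has_finite_section K') ->
  forall f g, K (f * g) -> K f \/ K g.
Proof.
move=> hK nK Kmax; apply: homog_prime => // d e f g fd ge Kfg.
apply: contrapT => /not_orP[nKf nKg].
have hadj h i : h \is i.-homog -> homog_ideal (adjoin1 K h).
  by move=> hi; apply: (@homog_adjoin _ _ _ hK _ _ (fun=> i)).
have sec h i : h \is i.-homog -> ~ K h -> has_finite_section (adjoin1 K h).
  move=> hi nKh; apply: Kmax; first exact: hadj hi.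
  apply: (@proper_of_mem _ K (adjoin1 K h) h _ _ nKh).
    exact: @sub_adjoin _ _ _ _ _.
  exact: (@adjoin_mem _ _ _ hK.1 _ (fun=> h) ord0).
have [l [Ll [d1 Kd1] [d2 Kd2]]] :=
  directed (hadj _ _ fd) (hadj _ _ ge) (sec _ _ fd nKf) (sec _ _ ge nKg).
apply: nK; exists l => //; exists (d1 + d2)%N.
have idKl := ideal_adjoin hK.1 (fun _ : 'I_1 => l).
apply: contains_degreeM Kd1 Kd2 => // u v /adjoin1P[b /adjoin1P[c Ku]].
move=> /adjoin1P[b' /adjoin1P[c' Kv]]; apply/adjoin1P.
exists (b * v + (u - l * b) * b').
have -> : u * v - l * (b * v + (u - l * b) * b') =
    (u - l * b) * (v - l * b') by ring.
have -> : (u - l * b) * (v - l * b') =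
  (u - l * b - f * c) * (v - l * b') + f * c * (v - l * b' - g * c') + f * g * (c * c').
  by ring.
apply: (idealD hK.1); last exact: idealMr hK.1 _ _ Kfg.
by apply: (idealD hK.1); [apply: (idealMr hK.1)|apply: (idealMl hK.1)].
Qed.

End MaximalIdeals.

Section ZeroDimensional.
Variables (k : closedFieldType) (r : nat).
Notation S := {mpoly k[r.+1]}.

Definition linear_forms : set S := [set l | l \is 1.-homog].

(** In one fixed degree, being a section means that multiplication by [l] is surjective modulo [K],
    which is an open condition on [l]. *)
Lemma finite_section_generic (K : set S) (l l' : S) :
  homog_ideal K -> l \is 1.-homog -> l' \is 1.-homog -> finite_section K l ->
  exists2 p : {poly k}, p != 0 &
    forall tau, p.[tau] != 0 -> finite_section K (l + tau *: l').
Proof.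
move=> hK l1 l'1 [d0 Kd0].
have [d Kd] : exists d, contains_degree (adjoin1 K l) (1 + d)%N.
  by exists d0; apply: contains_degreeS => //; apply: ideal_adjoin hK.1 _ _.
pose E := dhomog r.+1 k (1 + d).
pose L (u v : E) := exists b : S, [/\ b \is d.-homog, val u = l * b & val v = l' * b].
have subK : submodule (fun e : E => K (val e)).
  by have [K0 KP] := ideal_submodule hK.1; split=> // a u v; apply: KP.
have L0 : L 0 0 by exists 0; rewrite !mulr0; split=> //; apply: rpred0.
have LP a u v u' v' : L u v -> L u' v' -> L (a *: u + u') (a *: v + v').
  move=> [b [bd ub vb]] [b' [b'd ub' vb']]; exists (a *: b + b').
  rewrite !mulrDr -!scalerAr -ub -vb -ub' -vb'; split=> //.
  by apply: rpredD => //; apply: rpredZ.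
have [|p p0 pP] := pencil_surjective_generic subK L0 LP.
  move=> e; have [b bd Kb] := adjoin1_dhomog hK l1 (valP e) (Kd _ (valP e)).
  exists (DHomog (dhomogM l1 bd)), (DHomog (dhomogM l'1 bd)).
  by split; first by exists b.
exists p => // tau /pP surj; exists (1 + d)%N => f fd.
have [u [v [[b [_ ub vb]] Kb]]] := surj (DHomog fd).
apply/adjoin1P; exists b.
by rewrite mulrDl -scalerAl -ub -vb.
Qed.

(** On the line through [l1] and [l2] all but finitely many forms are sections of [K1]; read from
    [l2], with parameter [1 - tau], the same holds for [K2]. *)
Lemma linear_forms_directed (K1 K2 : set S) :
  homog_ideal K1 -> homog_ideal K2 ->
  has_finite_section linear_forms K1 -> has_finite_section linear_forms K2 ->
  exists l, [/\ linear_forms l, finite_section K1 l & finite_section K2 l].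
Proof.
move=> hK1 hK2 [l1 l1h s1] [l2 l2h s2].
have [p1 p10 P1] := finite_section_generic hK1 l1h (rpredB l2h l1h) s1.
have [p2 p20 P2] := finite_section_generic hK2 l2h (rpredB l1h l2h) s2.
have : p1 * (p2 \Po (1 - 'X)) != 0.
  rewrite mulf_neq0 // comp_poly2_eq0 //.
  by rewrite -size_polyN opprB -polyC1 size_XsubC.
case/closed_nonrootP => tau.
rewrite /root hornerM mulf_eq0 horner_comp !hornerE => /norP[/P1 s1' /P2 s2'].
exists (l1 + tau *: (l2 - l1)); split=> //.
  by apply: rpredD => //; apply: rpredZ; apply: rpredB.
congr (finite_section K2 _): s2'; rewrite scalerBl scale1r !scalerBr.
by rewrite addrA addrC; ring.
Qed.

(** Otherwise a maximal ideal [K] without section is a point. Some ['X_i] is outside [K], and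
    [K + ('X_i)] contains no full degree, since ['X_i] is not a section of [K]. So it lies in a
    second point [K2], found by the same maximality argument with [[set 0]] as the allowed forms,
    and [K], [K2] form a chain of length 1. *)
Lemma zero_dimensional_section (I : set S) :
  homog_ideal I -> zero_dimensional I -> has_finite_section linear_forms I.
Proof.
move=> hI dim0; apply: contrapT => nI.
have [K [hK IK nK Kmax]] := maximal_without_section hI nI.
have Kprime := maximal_without_section_prime linear_forms_directed hK nK Kmax.
have lin0 : linear_forms 0 by apply: rpred0.
have point_of (J : set S) : homog_ideal J -> I `<=` J ->
    (forall f g, J (f * g) -> J f \/ J g) -> ~ finite_section J 0 ->
    proj_point I J.
  move=> hJ IJ Jp nJ; split=> //.
  - split; rewrite ?inE; first exact: ideal0 hJ.1.
      apply/negP; rewrite inE => J1; apply: nJ; exists 0%N => f _.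
      apply: sub_adjoin; rewrite -[f]mulr1; exact: idealMl hJ.1 _ _ J1.
    move=> a u v; rewrite !inE => Ju Jv.
    by apply: (idealD hJ.1) => //; apply: (idealMl hJ.1).
  - move=> u v; rewrite !inE => /Jp[]/mem_set ->; by rewrite ?orbT.
  - by case: hJ.
  - apply: contrapT => noi; apply: nJ; exists 1%N; apply: contains_degree_mon.
      exact: ideal_adjoin hJ.1 _ _.
    move=> m /eqP; rewrite mdeg_eq1 => /existsP[i /eqP ->].
    by apply: sub_adjoin; apply: contrapT => nJi; apply: noi; exists i.
have nK0 : ~ finite_section K 0 by move=> sK; apply: nK; exists 0.
have pK := point_of K hK IK Kprime nK0.
have [_ _ _ [i nKi] _] := pK.
have Xi1 : ('X_i : S) \is 1.-homog by rewrite dhomogX /= mdeg1.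
pose K1 := adjoin1 K 'X_i.
have hK1 : homog_ideal K1 by apply: (@homog_adjoin _ _ _ hK _ _ (fun=> 1%N)).
have nK1 : ~ has_finite_section [set 0] K1.
  move=> [_ -> [d K1d]]; apply: nK; exists 'X_i => //; exists d => f /K1d.
  by move=> /adjoin1P[b]; rewrite mul0r subr0.
have [K2 [hK2 K12 nK2 K2max]] := maximal_without_section hK1 nK1.
have K2prime : forall f g, K2 (f * g) -> K2 f \/ K2 g.
  apply: maximal_without_section_prime hK2 nK2 K2max => J J' _ _ [_ -> s1] [_ -> s2].
  by exists 0.
have sKK1 : K `<=` K1 := @sub_adjoin _ _ _ _ _.
have pK2 : proj_point I K2.
  apply: point_of => // [f /IK/sKK1/K12//|s0].
  by apply: nK2; exists 0.
have : strict_chain (proj_point I) 1.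
  exists (fun j => if j == 0%N then K else K2); split=> [[|[]]|[]] //= _.
  apply: (proper_of_mem (subset_trans sKK1 K12) _ nKi); apply: K12.
  exact: (@adjoin_mem _ _ _ hK.1 _ (fun=> 'X_i) ord0).
by move/dim0.
Qed.

End ZeroDimensional.

(** * Length of a zero-dimensional scheme *)

Section Codimension.
Variables (k : fieldType) (n : nat).
Notation S := {mpoly k[n]}.

Definition independent_mod (K : set S) (T : finType) (z : T -> S) : Prop :=
  forall c : T -> k, K (\sum_i c i *: z i) -> forall i, c i = 0.

(** The inequality dim (S / K)_d <= N, without forming the quotient space. *)
Definition codim_le (K : set S) (d N : nat) : Prop :=
  forall (T : finType) (z : T -> S), (forall i, z i \is d.-homog) ->
    independent_mod K z -> (#|T| <= N)%N.

End Codimension.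

Lemma fraction_combination (F : fieldType) (f1 g1 f2 g2 f3 g3 : F) :
  g1 != 0 -> g2 != 0 -> g3 != 0 ->
  f1 / g1 * (f2 / g2) + f3 / g3 = (f1 * f2 * g3 + g1 * g2 * f3) / (g1 * g2 * g3).
Proof. by move=> g10 g20 g30; field; apply/and3P; split. Qed.

Lemma fraction_correction (F : fieldType) (h f z he : F) : h != 0 -> he != 0 ->
  z / h ^+ 2 = f / he - (h ^+ 2 * f - he * z) / (he * h ^+ 2).
Proof. by move=> h0 he0; field; rewrite h0. Qed.

Lemma fraction_unit (F : fieldType) (f g F' he : F) : g != 0 -> F' != 0 -> he != 0 ->
  (f * F' / he = g * F' / he * (f / g)) * (f / g = he / (g * F') * (f * F' / he)).
Proof. by move=> g0 F0 he0; split; field; rewrite ?g0 ?F0 ?he0. Qed.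

Section Length.
Variables (k : closedFieldType) (r : nat).
Notation S := {mpoly k[r.+1]}.
Local Notation "x %:F" := (tofrac x).

Lemma proj_pointP (I P : set S) : proj_point I P ->
  [/\ homog_ideal P, ~ P 1, forall u v, P (u * v) -> P u \/ P v,
      exists i : 'I_r.+1, ~ P 'X_i & I `<=` P].
Proof.
move=> [[P0 P1 PD] Pp Ph PX IP]; split=> //.
- split=> //; split; first by move: P0; rewrite inE.
  by move=> a u v Pu Pv; have := PD a u v; rewrite !inE; apply.
- by move/negP: P1; rewrite inE.
- by move=> u v /mem_set/Pp/orP[] /set_mem; [left|right].
Qed.

Variables (I : set S) (h : S) (N : nat).
Hypotheses (hI : homog_ideal I) (h1 : h \is 1.-homog).
Hypothesis S3 : contains_degree (adjoin1 I h) 3.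
Hypothesis codimI : codim_le I 2 N.

Let idI := hI.1.

Lemma homog_hX e : h ^+ e \is e.-homog.
Proof. by have := dhomogMn e h1; rewrite mul1n. Qed.

(** Says that [f / h ^+ E] equals [z / h ^+ 2] modulo [I]: all functions on Proj (S / I) come from
    degree 2. Above degree 2 a factor [h] is split off by [S3]; below, [f] is multiplied by a power
    of [h]. *)
Lemma reduce_degree E f : f \is E.-homog ->
  exists2 z, z \is 2.-homog & I (h ^+ 2 * f - h ^+ E * z).
Proof.
case: E => [|[|E]] fE.
- exists (h ^+ 2 * f); first by rewrite -[2%N]addn0; apply: dhomogM (homog_hX 2) fE.
  by rewrite mul1r subrr; apply: ideal0.
- exists (h * f); first exact: dhomogM h1 fE.
  by rewrite expr1 mulrA -expr2 subrr; apply: ideal0.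
elim: E => [|E IHE] in f fE *.
  by exists f => //; rewrite subrr; apply: ideal0.
have SE : contains_degree (adjoin1 I h) E.+3.
  elim: (E) => [//|E' IHE']; apply: contains_degreeS IHE'.
  exact: ideal_adjoin idI _ _.
have [b bE Ib] := @adjoin1_dhomog _ _ _ hI h 1 E.+2 f h1 fE (SE _ fE).
have [z z2 Iz] := IHE _ bE; exists z => //.
have -> : h ^+ 2 * f - h ^+ E.+3 * z =
  h ^+ 2 * (f - h * b) + h * (h ^+ 2 * b - h ^+ E.+2 * z).
  by rewrite (exprS _ E.+2); move: (h ^+ E.+2) => H; ring.
by apply: (idealD idI); apply: (idealMl idI).
Qed.

Section Point.
Variable P : set S.
Hypothesis pP : proj_point I P.

Let hP : homog_ideal P. Proof. by case: (proj_pointP pP). Qed.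
Let P1 : ~ P 1. Proof. by case: (proj_pointP pP). Qed.
Let Pp : forall u v, P (u * v) -> P u \/ P v.
Proof. by case: (proj_pointP pP). Qed.
Let IP : I `<=` P. Proof. by case: (proj_pointP pP). Qed.

Lemma point_X u e : P (u ^+ e) -> P u.
Proof. by elim: e => [//|e IHe]; rewrite exprS => /Pp[]. Qed.

Lemma point_section : ~ P h.
Proof.
move=> Ph; have [_ _ _ [i nPi] _] := proj_pointP pP; apply: nPi.
apply: (@point_X _ 3); have := S3 (dhomogMn 3 (_ : ('X_i : S) \is 1.-homog)).
rewrite dhomogX /= mdeg1 => /(_ isT) /adjoin1P[b /IP Pb].
by apply: (ideal_eqmod hP.1 Pb); apply: (idealMr hP.1).
Qed.

Lemma point_hX e : ~ P (h ^+ e).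
Proof. by move/point_X/point_section. Qed.

Lemma point_nM u v : ~ P u -> ~ P v -> ~ P (u * v).
Proof. by move=> nu nv /Pp[]. Qed.

Lemma point_frac u : ~ P u -> u%:F != 0.
Proof.
move=> nPu; rewrite tofrac_eq0; apply: contra_notN nPu => /eqP ->.
exact: ideal0 hP.1.
Qed.

Lemma local_ring_mem d (f g : S) : f \is d.-homog -> g \is d.-homog -> ~ P g ->
  local_ring P (f%:F / g%:F).
Proof. by move=> fd gd nPg; exists d, f, g. Qed.

Lemma local_ideal_mem d (f g q : S) e : f \is d.-homog -> g \is d.-homog ->
  ~ P g -> q \is e.-homog -> ~ P q -> I (f * q) -> local_ideal I P (f%:F / g%:F).
Proof.
move=> fd gd nPg qe nPq Ifq; exists (d + e)%N, (f * q), (g * q); split=> //.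
- exact: dhomogM.
- exact: dhomogM.
- exact: point_nM.
by rewrite !rmorphM /= -mulf_div divff ?mulr1 // point_frac.
Qed.

Lemma local_ring_closed a u v : local_ring P a -> local_ring P u ->
  local_ring P v -> local_ring P (a * u + v).
Proof.
move=> [d1 [f1 [g1 [fd1 gd1 n1 ->]]]] [d2 [f2 [g2 [fd2 gd2 n2 ->]]]].
move=> [d3 [f3 [g3 [fd3 gd3 n3 ->]]]].
exists (d1 + d2 + d3)%N, (f1 * f2 * g3 + g1 * g2 * f3), (g1 * g2 * g3).
split; rewrite ?rpredD ?dhomogM //; first by do 2 apply: point_nM => //.
by rewrite !rmorphD !rmorphM /=; apply: fraction_combination; apply: point_frac.
Qed.

Lemma local_ideal_closed a u v : local_ring P a -> local_ideal I P u ->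
  local_ideal I P v -> local_ideal I P (a * u + v).
Proof.
move=> [d1 [f1 [g1 [fd1 gd1 n1 ->]]]] [d2 [f2 [g2 [fd2 gd2 I2 n2 ->]]]].
move=> [d3 [f3 [g3 [fd3 gd3 I3 n3 ->]]]].
exists (d1 + d2 + d3)%N, (f1 * f2 * g3 + g1 * g2 * f3), (g1 * g2 * g3).
split; rewrite ?rpredD ?dhomogM //; last first.
- by rewrite !rmorphD !rmorphM /=; apply: fraction_combination; apply: point_frac.
- by do 2 apply: point_nM => //.
apply: (idealD idI); last exact: idealMl.
by apply: (idealMr idI); apply: idealMl.
Qed.

Lemma local_ideal_sub : local_ideal I P `<=` local_ring P.
Proof. by move=> _ [d [f [g [fd gd _ nPg ->]]]]; exists d, f, g. Qed.

Lemma local_ring1 : local_ring P 1.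
Proof. by exists 0%N, 1, 1; rewrite !dhomog1 tofrac1 divr1; split. Qed.

Lemma local_ringC (c : k) : local_ring P (c%:MP)%:F.
Proof.
exists 0%N, c%:MP, 1; rewrite dhomog1 tofrac1 divr1; split=> //.
by rewrite -[c%:MP]mulr1 mul_mpolyC; apply/rpredZ/dhomog1.
Qed.

Lemma local_chain1 : strict_chain (ideal_over I P) 1.
Proof.
exists (fun j => if j == 0%N then local_ideal I P else local_ring P).
split=> [[|[]]|[]] //= _; split=> //.
- exact: local_ideal_sub.
- by move=> a u v; apply: local_ideal_closed.
- exact: local_ideal_sub.
- by move=> a u v; apply: local_ring_closed.
- exact: local_ideal_sub.
move=> /(_ _ local_ring1)[d [f [g [fd gd If nPg]]]].
move/(congr1 (fun x => x * g%:F)); rewrite mul1r divfK ?point_frac //.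
move/eqP; rewrite tofrac_eq => /eqP gf; apply: nPg; rewrite gf; exact: IP.
Qed.

Section IdealOver.
Variable J : set {fraction S}.
Hypothesis oJ : ideal_over I P J.

Lemma ideal_over0 : J 0.
Proof.
case: oJ => IJ _ _; apply: IJ; exists 0%N, 0, 1.
by rewrite rpred0 dhomog1 tofrac0 mul0r; split=> //; apply: ideal0.
Qed.

Lemma ideal_overMl a u : local_ring P a -> J u -> J (a * u).
Proof.
by case: oJ => _ _ JP Pa Ju; rewrite -[_ * _]addr0; apply: JP ideal_over0.
Qed.

Lemma ideal_overD u v : J u -> J v -> J (u + v).
Proof.
by case: oJ => _ _ JP Ju Jv; rewrite -[u]mul1r; apply: JP => //; apply: local_ring1.
Qed.

Lemma ideal_overN u : J u -> J (- u).
Proof.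
rewrite -mulN1r; apply: ideal_overMl; rewrite -tofrac1 -tofracN -mpolyCN.
exact: local_ringC.
Qed.

Lemma ideal_overB u v : J u -> J v -> J (u - v).
Proof. by move=> Ju /ideal_overN; apply: ideal_overD. Qed.

Lemma ideal_over_sum (T : finType) (p : pred T) (F : T -> {fraction S}) :
  (forall i, p i -> J (F i)) -> J (\sum_(i | p i) F i).
Proof. by move=> JF; elim/big_ind: _ => //; [exact: ideal_over0|exact: ideal_overD]. Qed.

End IdealOver.
End Point.

(* g / h ^+ e is integral over k modulo I: g ^+ a * q is a homogenized
   polynomial relation, and a is its order at 0. *)
Lemma nilpotent_at_points e g : g \is e.-homog -> exists a d q,
  [/\ q \is d.-homog, I (g ^+ a * q) & forall Q, proj_point I Q -> Q g -> ~ Q q].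
Proof.
move=> ge.
(* Each [g ^+ j / h ^+ (e * j)] is represented by some [z j / h ^+ 2], and [N + 1] forms of degree 2
   are dependent modulo [I]. *)
have /choice[z zP] (j : 'I_N.+1) : exists z,
    z \is 2.-homog /\ I (h ^+ 2 * g ^+ j - h ^+ (e * j) * z).
  by have [z z2 Iz] := reduce_degree (dhomogMn j ge); exists z.
have [c Ic [j0 cj0]] : exists2 c : 'I_N.+1 -> k, I (\sum_j c j *: z j)
    & exists j, c j != 0.
  apply: contrapT => noc.
  suff : (#|'I_N.+1| <= N)%N by rewrite card_ord ltnn.
  apply: (codimI (z := z)) => [j|c Ic j]; first by case: (zP j).
  by apply: contrapT => /eqP cj; apply: noc; exists c => //; exists j.
have [a ca mina] := @arg_minnP _ j0 (fun j => c j != 0) val cj0.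
(* This is the relation divided by [g ^+ a]: its term of index [a] is a non-zero multiple of a power
   of [h], which lies in no point, and all other terms contain [g]. *)
pose q := \sum_(j < N.+1 | c j != 0) c j *: (h ^+ (e * (N - j) + 2) * g ^+ (j - a)).
have leN (j : 'I_N.+1) : (j <= N)%N by rewrite -ltnS.
exists a, (e * (N - a) + 2)%N, q; split.
- rewrite rpred_sum // => j cj; apply: rpredZ.
  have -> : (e * (N - a) + 2 = e * (N - j) + 2 + e * (j - a))%N.
    by rewrite addnAC -mulnDr addnBA ?mina // subnK.
  exact: dhomogM (homog_hX _) (dhomogMn _ ge).
- have -> : g ^+ a * q = h ^+ (e * N) * (\sum_j c j *: z j) +
    \sum_j c j *: (h ^+ (e * (N - j)) * (h ^+ 2 * g ^+ j - h ^+ (e * j) * z j)).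
    rewrite /q mulr_sumr big_mkcond /= mulr_sumr -big_split /=.
    apply: eq_bigr => j _; case: eqVneq => [->|cj] /=; first by rewrite !scale0r mulr0 addr0.
    rewrite -!scalerAr -scalerDr; congr (_ *: _).
    have -> : h ^+ (e * N) = h ^+ (e * (N - j)) * h ^+ (e * j).
      by rewrite -exprD -mulnDr subnK.
    have -> : g ^+ j = g ^+ a * g ^+ (j - a) by rewrite -exprD subnKC ?mina.
    rewrite exprD; move: (h ^+ (_ * _)) (h ^+ (_ * j)) (g ^+ a) (g ^+ _) => u v w t.
    by ring.
  apply: (idealD idI); first exact: idealMl.
  apply: ideal_sum => // j _; apply: (idealZ idI); apply: (idealMl idI).
  by case: (zP j).
move=> Q pQ Qg; have [hQ Q1 _ _ IQ] := proj_pointP pQ.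
rewrite /q (bigD1 a) //= subnn expr0 mulr1 => Qq.
apply: (point_hX pQ (e := (e * (N - a) + 2)%N)).
rewrite -[X in Q X](scalerK ca); apply: (idealZ hQ.1).
apply: (ideal_eqmod hQ.1 (v := - \sum_(j < N.+1 | (c j != 0) && (j != a))
   c j *: (h ^+ (e * (N - j) + 2) * g ^+ (j - a)))); first by rewrite opprK.
apply: (idealN hQ.1); apply: (ideal_sum hQ.1) => j /andP[cj ja].
apply: (idealZ hQ.1); apply: (idealMl hQ.1).
have : (0 < j - a)%N by rewrite subn_gt0 ltn_neqAle mina // eq_sym ja.
by case: (j - a)%N => // b _; rewrite exprS; apply: (idealMr hQ.1).
Qed.

(** A form [g] in [Q] but not in [P] has a relation [g ^+ a * q] in [I] with [q] outside [Q], and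
    [F = g ^+ a] will do. If there is none, take [g] in [P] but not in [Q]: its [q] lies in [Q] but
    not in [P] and takes the place of [g]. *)
Lemma separate_points P Q : proj_point I P -> proj_point I Q -> P <> Q ->
  exists D F d q, [/\ F \is D.-homog, q \is d.-homog, ~ P F, ~ Q q & I (F * q)].
Proof.
move=> pP pQ PQ.
have [hP P1 Pp _ IP] := proj_pointP pP; have [hQ Q1 Qp _ IQ] := proj_pointP pQ.
have main e g : g \is e.-homog -> Q g -> ~ P g ->
  exists D F d q, [/\ F \is D.-homog, q \is d.-homog, ~ P F, ~ Q q & I (F * q)].
  move=> ge Qg nPg; have [a [d [q [qd Igq nq]]]] := nilpotent_at_points ge.
  exists (e * a)%N, (g ^+ a), d, q; split=> //; first exact: dhomogMn.
    by move/(point_X pP).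
  exact: nq.
have diff (A B : set S) : homog_ideal A -> homog_ideal B -> ~ (A `<=` B) ->
    exists e g, [/\ g \is e.-homog, A g & ~ B g].
  move=> hA hB /existsNP[f /not_implyP[Af nBf]]; apply: contrapT => noeg.
  apply/nBf/(homog_idealP hB) => d; apply: contrapT => nBd; apply: noeg.
  by exists d, (pihomog mdeg d f); split=> //; [exact: pihomogP|exact: hA.2].
have [QP|/(diff _ _ hQ hP)[e [g [ge Qg nPg]]]] := pselect (Q `<=` P); last exact: main ge Qg nPg.
have nPQ : ~ (P `<=` Q) by move=> PQ'; apply: PQ; apply/seteqP.
have [e [g [ge Pg nQg]]] := diff _ _ hP hQ nPQ.
have [a [d [q [qd Igq nq]]]] := nilpotent_at_points ge.
apply: (main d q) => //; last exact: nq.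
by case: (Qp _ _ (IQ _ Igq)) => // /(point_X pQ).
Qed.

Lemma separate_family M (P : 'I_M -> set S) (i : 'I_M) :
  injective P -> (forall j, proj_point I (P j)) ->
  exists D F, [/\ F \is D.-homog, ~ P i F & forall j, j != i ->
    exists d q, [/\ q \is d.-homog, ~ P j q & I (F * q)]].
Proof.
move=> injP pP.
suff : forall s : seq 'I_M, exists D F, [/\ F \is D.-homog, ~ P i F &
    forall j, j \in s -> j != i ->
    exists d q, [/\ q \is d.-homog, ~ P j q & I (F * q)]].
  move=> /(_ (enum 'I_M))[D [F [FD nF Fq]]]; exists D, F; split=> // j.
  by apply: Fq; rewrite mem_enum.
have [_ P1 _ _ _] := proj_pointP (pP i).
elim=> [|j s [D [F [FD nF Fq]]]]; first by exists 0%N, 1; rewrite dhomog1.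
case: (eqVneq j i) => [ji|ji].
  exists D, F; split=> // l; rewrite inE => /orP[/eqP ->|]; last exact: Fq.
  by rewrite ji eqxx.
have [|D' [F' [d [q [F'D qd nF' nq IFq]]]]] := separate_points (pP i) (pP j).
  by move/injP => ij; rewrite ij eqxx in ji.
exists (D' + D)%N, (F' * F); split; [exact: dhomogM|exact: point_nM (pP i) _ _ _ _|].
move=> l; rewrite inE => /orP[/eqP -> _|ls li].
  by exists d, q; split=> //; rewrite mulrAC; apply: (idealMr idI).
have [d' [q' [q'd nq' IFq']]] := Fq _ ls li.
by exists d', q'; split=> //; rewrite -mulrA; apply: (idealMl idI).
Qed.

Definition value2 (z : S) : {fraction S} := z%:F / (h ^+ 2)%:F.

Lemma value2_local_ideal P z : proj_point I P -> z \is 2.-homog -> I z ->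
  local_ideal I P (value2 z).
Proof.
move=> pP z2 Iz; exists 2%N, z, (h ^+ 2); split=> //; first exact: homog_hX.
exact: point_hX.
Qed.

(** The form [F] of [separate_family] is a unit at [P i] and vanishes in the local rings of Proj (S
    / I) at the other points. The product of [zeta] and [F] is then represented in degree 2 by
    [reduce_degree]. *)
Lemma value2_lift M (P : 'I_M -> set S) (i : 'I_M) zeta :
  injective P -> (forall j, proj_point I (P j)) -> local_ring (P i) zeta ->
  exists z, [/\ z \is 2.-homog,
    forall J, ideal_over I (P i) J -> J (value2 z) <-> J zeta
    & forall j, j != i -> local_ideal I (P j) (value2 z)].
Proof.
move=> injP pP [e [f [g [fe ge nPg zetaE]]]].
have [D [F [FD nF Fq]]] := separate_family i injP pP.
have [z z2 Iz] := reduce_degree (dhomogM fe FD).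
have hn Q : proj_point I Q -> (h ^+ (e + D + 2))%:F != 0.
  by move=> pQ; apply: (point_frac pQ); apply: (point_hX pQ).
have hn1 Q : proj_point I Q -> h%:F != 0.
  by move=> pQ; apply: (point_frac pQ); apply: (point_section pQ).
have hom : h ^+ 2 * (f * F) - h ^+ (e + D) * z \is (e + D + 2).-homog.
  apply: rpredB; last exact: dhomogM (homog_hX _) z2.
  by rewrite addnC; apply: dhomogM (homog_hX _) (dhomogM fe FD).
have zE Q : proj_point I Q -> value2 z = (f * F)%:F / (h ^+ (e + D))%:F -
    (h ^+ 2 * (f * F) - h ^+ (e + D) * z)%:F / (h ^+ (e + D + 2))%:F.
  move=> /hn1 h0; rewrite /value2 (exprD h (e + D) 2).
  move: (f * F) (e + D)%N => G E.
  rewrite tofracB !tofracM !tofracXn.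
  exact: (fraction_correction G%:F z%:F h0 (expf_neq0 E h0)).
have err Q : proj_point I Q -> local_ideal I Q
    ((h ^+ 2 * (f * F) - h ^+ (e + D) * z)%:F / (h ^+ (e + D + 2))%:F).
  move=> pQ; exists (e + D + 2)%N; do 2 eexists.
  split; [exact: hom|exact: homog_hX| | |by []] => //.
  exact: point_hX.
exists z; split=> // [J oJ|j ji].
  have [IJ _ _] := oJ.
  have -> : J (value2 z) <-> J ((f * F)%:F / (h ^+ (e + D))%:F).
    rewrite (zE _ (pP i)); split=> JB; last first.
      by apply: (ideal_overB (pP i) oJ) => //; apply/IJ/err.
    by rewrite -[X in J X](subrK
      ((h ^+ 2 * (f * F) - h ^+ (e + D) * z)%:F / (h ^+ (e + D + 2))%:F));
      apply: (ideal_overD (pP i) oJ) => //; apply/IJ/err.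
  have g0 := point_frac (pP i) nPg; have F0 := point_frac (pP i) nF.
  have h0 := hn1 _ (pP i).
  have hX0 m : h%:F ^+ m != 0 by rewrite expf_neq0.
  have E1 : (f * F)%:F / (h ^+ (e + D))%:F = (g * F)%:F / (h ^+ (e + D))%:F * zeta.
    by rewrite zetaE !(rmorphM, rmorphXn) /= (fraction_unit f%:F g0 F0 (hX0 _)).1.
  have E2 : zeta = (h ^+ (e + D))%:F / (g * F)%:F * ((f * F)%:F / (h ^+ (e + D))%:F).
    by rewrite zetaE !(rmorphM, rmorphXn) /= -(fraction_unit f%:F g0 F0 (hX0 _)).2.
  have gF := dhomogM ge FD; have hH := homog_hX (e + D)%N.
  split=> [|Jz]; [rewrite E2|rewrite E1]; first apply: (ideal_overMl (pP i) oJ).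
    by apply: (local_ring_mem hH gF); apply: point_nM (pP i) _ _ _ _.
  apply: (ideal_overMl (pP i) oJ) => //.
  by apply: (local_ring_mem gF hH); apply: point_hX.
have [d [q [qd nq IFq]]] := Fq _ ji.
rewrite (zE _ (pP j)) -mulN1r addrC.
apply: (local_ideal_closed (pP j)); last 1 first.
- apply: (local_ideal_mem (pP j) (dhomogM fe FD) (homog_hX _) _ qd nq).
    exact: point_hX.
  by rewrite -mulrA; apply: (idealMl idI).
- by rewrite -tofrac1 -tofracN -mpolyCN; apply: local_ringC.
exact: err.
Qed.

(** Each step of each chain gives a form of degree 2 whose value lies in the larger ideal, not in
    the smaller one, and is zero at all other points. By triangularity these forms are independent
    modulo [I]. *)
Lemma sum_chain_lengths M (P : 'I_M -> set S) (e : 'I_M -> nat) :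
  injective P -> (forall j, proj_point I (P j)) ->
  (forall i, strict_chain (ideal_over I (P i)) (e i)) ->
  (\sum_i e i <= N)%N.
Proof.
move=> injP pP /choice[J JP].
pose T := {i : 'I_M & 'I_(e i)}.
have /choice[z zP] (t : T) : exists z, [/\ z \is 2.-homog,
    J (tag t) (tagged t).+1 (value2 z), ~ J (tag t) (tagged t) (value2 z)
    & forall j, j != tag t -> local_ideal I (P j) (value2 z)].
  case: t => i l /=; have [oJ sJ] := JP i.
  have [_ /existsNP[zeta /not_implyP[Jz nJz]]] := sJ _ (ltn_ord l).
  have oJ1 := oJ _ (ltn_ord l); have oJ0 := oJ _ (ltnW (ltn_ord l)).
  have [|z [z2 zJ zI]] := value2_lift injP pP (_ : local_ring (P i) zeta).
    by case: oJ1 => _ + _; apply.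
  by exists z; split=> //; [apply/(zJ _ oJ1)|move/(zJ _ oJ0)].
suff : (#|{: T}| <= N)%N.
  by rewrite card_tagged sumnE big_map big_enum; under eq_bigr do rewrite card_ord.
apply: (codimI (z := z)) => [t|c Ic]; first by case: (zP t).
have [//|/existsNP[[i j0] /= cj0]] := pselect (forall t, c t = 0).
exfalso.
(* For the last [l] with non-zero coefficient at the point [i], the relation puts the value of
   [z t0] into [J i l]: later coefficients vanish, earlier values lie in [J i l], and forms from
   other points are zero here. *)
have [l cl maxl] :=
  @arg_maxnP _ j0 (fun l => c (Tagged (fun i => 'I_(e i)) l) != 0) val (introN eqP cj0).
have [oJ sJ] := JP i; have oJl := oJ _ (ltnW (ltn_ord l)).
have mono a b : (a <= b)%N -> (b <= e i)%N -> J i a `<=` J i b.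
  elim: b => [|b IHb]; first by rewrite leqn0 => /eqP -> _.
  rewrite leq_eqVlt ltnS => /orP[/eqP -> _ //|ab be].
  by apply: subset_trans (IHb ab (ltnW be)) _; case: (sJ _ be).
pose t0 : T := Tagged (fun i => 'I_(e i)) l.
have [_ _ + _] := zP t0; apply => /=.
have value2Z a u : value2 (a *: u) = (a%:MP)%:F * value2 u.
  by rewrite /value2 -mul_mpolyC rmorphM mulrA.
have -> : value2 (z t0) = ((c t0)^-1%:MP)%:F * value2 (c t0 *: z t0).
  by rewrite -value2Z scalerA mulVf ?scale1r.
apply: (ideal_overMl (pP i) oJl); first exact: local_ringC.
have -> : value2 (c t0 *: z t0) =
    value2 (\sum_t c t *: z t) - \sum_(t | t != t0) value2 (c t *: z t).
  have value2D a b : value2 (a + b) = value2 a + value2 b.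
    by rewrite /value2 tofracD mulrDl.
  have value20 : value2 0 = 0 by rewrite /value2 tofrac0 mul0r.
  by rewrite (bigD1 t0) //= value2D (big_morph value2 value2D value20) addrK.
apply: (ideal_overB (pP i) oJl).
  case: oJl => IJ _ _; apply/IJ/value2_local_ideal => //.
  by apply: rpred_sum => t _; apply: rpredZ; case: (zP t).
apply: (ideal_over_sum (pP i) oJl) => -[i' j'] tt0.
have [_ zJ _ zI] := zP (Tagged (fun i => 'I_(e i)) j').
have [ii'|ii'] := eqVneq i i'; last first.
  rewrite value2Z; apply: (ideal_overMl (pP i) oJl); first exact: local_ringC.
  by case: oJl => IJ _ _; apply/IJ/zI.
subst i'.
rewrite value2Z; case: (ltngtP j' l) => [ltj|ltj|/val_inj jl]; last by rewrite jl eqxx in tt0.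
  apply: (ideal_overMl (pP i) oJl); first exact: local_ringC.
  by apply: (mono j'.+1) => //; apply: ltnW.
case: (eqVneq (c (Tagged (fun i => 'I_(e i)) j')) 0) => [->|/maxl/=].
  by rewrite mpolyC0 tofrac0 mul0r; apply: ideal_over0 oJl.
by rewrite leqNgt ltj.
Qed.

Lemma local_length_exists P : proj_point I P -> exists e, has_local_length I P e.
Proof.
move=> pP; pose chain e := `[< strict_chain (ideal_over I P) e >].
have chain_le e : chain e -> (e <= N)%N.
  move/asboolP => ce.
  have := @sum_chain_lengths 1 (fun=> P) (fun=> e) _ (fun=> pP) (fun=> ce).
  by rewrite big_ord1; apply=> i j _; rewrite !ord1.
have exc : exists e, chain e by exists 1%N; apply/asboolP/local_chain1.
case: (ex_maxnP exc chain_le) => e /asboolP ce maxe; exists e; split=> // l cl.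
exact/maxe/asboolP.
Qed.

(** Chains of length 1 at distinct points show that there are at most [N] points, so a largest
    injective family of points exhausts them. *)
Lemma length_exists : exists2 l, has_length I l & (l <= N)%N.
Proof.
pose family M := `[< exists P : 'I_M -> set S,
  injective P /\ (forall j, proj_point I (P j)) >].
have family_le M : family M -> (M <= N)%N.
  move=> /asboolP[P [injP pP]].
  have := @sum_chain_lengths M P (fun=> 1%N) injP pP (fun i => local_chain1 (pP i)).
  by rewrite sum1_card card_ord.
have exf : exists M, family M.
  by exists 0%N; apply/asboolP; exists (fun=> set0); split=> -[].
case: (ex_maxnP exf family_le) => M /asboolP[P [injP pP]] maxM.
have /choice[e eP] i := local_length_exists (pP i).
exists (\sum_i e i)%N; last by apply: sum_chain_lengths injP pP _ => i; case: (eP i).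
exists M, P, e; split=> //; apply/seteqP; split=> [_ [i _ <-] //|Q pQ].
apply: contrapT => nQ.
suff /maxM : family M.+1 by rewrite ltnn.
apply/asboolP; exists (fun i => if unlift ord_max i is Some j then P j else Q).
split=> [i j|i]; last by case: unliftP => [j _|_].
case: unliftP => [i' ->|->]; case: unliftP => [j' ->|->] //.
- by move/injP ->.
- by move=> PQ; case: nQ; exists i'.
- by move=> QP; case: nQ; exists j'.
Qed.

End Length.

(** * Multivariate polynomials *)

Section Relations.
Variable k : fieldType.

Lemma exists_relation (T : finType) N (M : T -> 'I_N -> k) : (N < #|T|)%N ->
  exists2 c : T -> k, (exists t, c t != 0) & forall j, \sum_t c t * M t j = 0.
Proof.
move=> ltN; pose A := \matrix_(i < #|T|, j < N) M (enum_val i) j.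
have kerA : kermx A != 0.
  apply: contraL ltN => /eqP kA; rewrite -leqNgt.
  have := mxrank_ker A; rewrite kA mxrank0 => /esym/eqP; rewrite subn_eq0.
  by move/leq_trans; apply; apply: rank_leq_col.
have [i ri] : exists i, row i (kermx A) != 0.
  by apply/existsP; rewrite -negb_forall; apply: contra kerA => /forallP r0;
     apply/eqP/row_matrixP => i; rewrite row0; apply/eqP.
pose u := row i (kermx A).
have uA : u *m A = 0 by rewrite -row_mul mulmx_ker row0.
exists (fun t => u 0 (enum_rank t)).
  have /existsP[j uj] : [exists j, u 0 j != 0].
    rewrite -negb_forall; apply: contra ri => /forallP u0.
    by apply/eqP/rowP => j; rewrite [RHS]mxE; apply/eqP.
  by exists (enum_val j); rewrite enum_valK.
move=> j; have /rowP/(_ j) := uA; rewrite mxE [RHS]mxE => E; rewrite -[RHS]E.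
rewrite [RHS](reindex (@enum_rank T)) /=; last exact/onW_bij/enum_rank_bij.
by apply: eq_bigr => t _; rewrite [A _ _]mxE enum_rankK.
Qed.

End Relations.

Lemma digits_inj n B (f g : 'I_n -> nat) :
  (forall i, f i < B)%N -> (forall i, g i < B)%N ->
  (\sum_i f i * B ^ i = \sum_i g i * B ^ i)%N -> f =1 g.
Proof.
elim: n => [|n IHn] in f g *; first by move=> _ _ _ [].
move=> fB gB; rewrite !big_ord_recl !expn0 !muln1.
have shift (h : 'I_n.+1 -> nat) :
    (\sum_(i < n) h (lift ord0 i) * B ^ lift ord0 i =
     (\sum_(i < n) h (lift ord0 i) * B ^ i) * B)%N.
  by rewrite big_distrl /=; apply: eq_bigr => i _; rewrite expnSr mulnA.
rewrite !shift => E.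
have B0 : (0 < B)%N by apply: leq_ltn_trans (fB ord0).
have E0 : f ord0 = g ord0.
  by have := congr1 (modn^~ B) E; rewrite /= ![(_ + _ * _)%N]addnC !modnMDl !modn_small.
have E1 : (\sum_(i < n) f (lift ord0 i) * B ^ i =
           \sum_(i < n) g (lift ord0 i) * B ^ i)%N.
  by move: E; rewrite E0 => /addnI/eqP; rewrite eqn_pmul2r // => /eqP.
have E2 := IHn _ _ (fun i => fB (lift ord0 i)) (fun i => gB (lift ord0 i)) E1.
by move=> i; case: (unliftP ord0 i) => [j ->|->].
Qed.

(* Kronecker's substitution of 'X^(B ^ i) for the variables. *)
Lemma mpoly_nonroot (k : closedFieldType) n (p : {mpoly k[n]}) :
  p != 0 -> exists v, p.@[v] != 0.
Proof.
move=> p0; pose B := (msize p).+1.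
pose code (u : 'X_{1..n}) := (\sum_i u i * B ^ i)%N.
have uB u i : u \in msupp p -> (u i < B)%N.
  move/msize_mdeg_lt => lt_u; apply: leq_trans (leqW lt_u).
  by rewrite ltnS mdegE (bigD1 i) //= leq_addr.
have code_inj : {in msupp p &, injective code}.
  move=> u v up vp /digits_inj E; apply/mnmP => i; apply: E => j; exact: uB.
pose q : {poly k} := \sum_(u <- msupp p) p@_u *: 'X^(code u).
have : q != 0.
  apply: contra_neq p0 => q0; apply/mpolyP => u; rewrite mcoeff0.
  have [up|/memN_msupp_eq0//] := boolP (u \in msupp p).
  have := congr1 (coefp (code u)) q0; rewrite /q /= coef0 coef_sum.
  rewrite (bigD1_seq u) //= coefZ coefXn eqxx mulr1 big_seq_cond big1 ?addr0 //.
  move=> v /andP[vp vu]; rewrite coefZ coefXn; case: eqP => [/code_inj E|_].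
    by rewrite E ?eqxx in vu.
  by rewrite mulr0.
case/closed_nonrootP => z; rewrite /root => qz.
exists (fun i => z ^+ (B ^ i)); move: qz; rewrite mevalE /q horner_sum.
congr (_ != 0); apply: eq_bigr => u _.
rewrite hornerZ hornerXn -prodrXr; congr (_ * _).
by apply: eq_bigr => i _; rewrite -exprM mulnC.
Qed.

Section HomogInd.
Variables (k : fieldType) (n : nat) (R : nat -> {mpoly k[n]} -> Prop).
Hypotheses (R0 : R 0 1) (RX : forall d i f, R d f -> R d.+1 ('X_i * f)).
Hypothesis RL : forall d, submodule (R d).

Lemma homog_ind d f : f \is d.-homog -> R d f.
Proof.
have RXm (u : 'X_{1..n}) : R (mdeg u) 'X_[u].
  elim: {u}(mdeg u) {-2}u (erefl (mdeg u)) => [|e IHe] u ue.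
    by move/eqP: ue; rewrite mdeg_eq0 => /eqP ->; rewrite mdeg0 mpolyX0.
  have [u1 [u2 [d1 d2 ->]]] := @mnm_split n 1 e u ue.
  move/eqP: d1; rewrite mdeg_eq1 => /existsP[i /eqP ->].
  by rewrite mpolyXD mdegD mdeg1 d2 add1n -d2; apply/RX/IHe.
move=> /dhomogP fd; rewrite [f]mpolyE big_seq.
have [R_0 R_L] := RL d.
elim/big_ind: _ => // [x y Rx Ry|u /fd <-].
  by rewrite -[x]scale1r; apply: R_L.
by rewrite -[_ *: _]addr0; case: (RL (mdeg u)) => R_0' R_L'; apply: R_L'.
Qed.

End HomogInd.

(** * Echelon forms and products of spaces of polynomials *)

Section Echelon.
Variables (k : fieldType) (n : nat).
Notation Q := {mpoly k[n]}.

Definition independent (T : finType) (A : T -> Q) : Prop :=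
  forall c : T -> k, \sum_t c t *: A t = 0 -> forall t, c t = 0.

Lemma independent_neq0 (T : finType) (A : T -> Q) t : independent A -> A t != 0.
Proof.
move=> indA; apply/eqP => At0; have /indA/(_ t)/eqP : \sum_s (s == t)%:R *: A s = 0.
  by rewrite (bigD1 t) //= At0 scaler0 big1 ?addr0 // => s /negPf ->; rewrite scale0r.
by rewrite eqxx oner_eq0.
Qed.

Lemma increasing_mlead_independent a (A : 'I_a -> Q) :
  (forall i, A i != 0) ->
  (forall i j : 'I_a, (i < j)%N -> (mlead (A i) < mlead (A j))%O) ->
  independent A.
Proof.
move=> A0 Alt c cA; apply: contrapT => /existsNP[i0 /eqP ci0].
have [i ci maxi] := @arg_maxnP _ i0 (fun i => c i != 0) val ci0.
have := congr1 (mcoeff (mlead (A i))) cA.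
rewrite mcoeff0 raddf_sum (bigD1 i) //= mcoeffZ big1 ?addr0 => [/eqP|j ji].
  by rewrite mulf_eq0 (negPf ci) mleadc_eq0 (negPf (A0 i)).
rewrite mcoeffZ; have [->|cj] := eqVneq (c j) 0; first by rewrite mul0r.
have leji : (j <= i)%N := maxi _ cj.
rewrite mcoeff_gt_mlead ?mulr0 // Alt // ltn_neqAle leji andbT.
by apply: contra ji => /eqP/val_inj ->.
Qed.

(** Gaussian elimination for the monomial order: the member with the largest leading monomial comes
    last, and multiples of it are subtracted from the others to remove that monomial. *)
Lemma echelon a (A : 'I_a -> Q) : independent A ->
  exists C : 'I_a -> 'I_a -> k, let A' i := \sum_j C i j *: A j in
    (forall i, A' i != 0) /\
    (forall i j : 'I_a, (i < j)%N -> (mlead (A' i) < mlead (A' j))%O).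
Proof.
elim: a => [|a IHa] in A *; first by move=> _; exists (fun _ _ => 0); split=> -[].
move=> indA.
have [j0 _ maxj0] := @Order.TotalTheory.arg_maxP _ _ 'I_a.+1 ord0 xpredT (fun j => mlead (A j)) isT.
pose mu := mlead (A j0); pose b j := (A j)@_mu / (A j0)@_mu.
have le_mu j : (mlead (A j) <= mu)%O := maxj0 j isT.
have A0 : (A j0)@_mu != 0 by rewrite mleadc_eq0 (independent_neq0 _ indA).
pose A1 j := A (lift j0 j) - b (lift j0 j) *: A j0.
have sumA1 (c : 'I_a -> k) : \sum_j c j *: A1 j = \sum_j
    (if unlift j0 j is Some j' then c j' else - \sum_j c j * b (lift j0 j)) *: A j.
  rewrite [RHS](bigD1_ord j0) //= unlift_none scaleNr scaler_suml addrC -sumrB.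
  by apply: eq_bigr => j _; rewrite liftK scalerBr scalerA.
have indA1 : independent A1.
  move=> c; rewrite sumA1 => /indA c0 j; have := c0 (lift j0 j).
  by rewrite liftK.
have [C [C0 Clt]] := IHa _ indA1.
have coefA1 j : (A1 j)@_mu = 0.
  by rewrite mcoeffB mcoeffZ divfK // subrr.
have ltA1 (c : 'I_a -> k) : \sum_j c j *: A1 j != 0 ->
    (mlead (\sum_j c j *: A1 j) < mu)%O.
  move=> nz; rewrite lt_neqAle; apply/andP; split.
    apply: contra_neq nz => E; apply/eqP; rewrite -mleadc_eq0 E raddf_sum big1 //.
    by move=> j _; rewrite /= mcoeffZ coefA1 mulr0.
  apply: le_trans (mlead_sum_le _ _ _) _; apply: joins_le => j _.
  apply: le_trans (mleadZ_le _ _) _; apply: le_trans (mleadB_le _ _) _.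
  by rewrite leUx le_mu; apply: le_trans (mleadZ_le _ _) _.
exists (fun i j => if unlift ord_max i is Some i' then
    if unlift j0 j is Some j' then C i' j' else - \sum_j C i' j * b (lift j0 j)
  else (j == j0)%:R).
have E1 i : \sum_j (if unlift j0 j is Some j' then C i j' else
    - \sum_j C i j * b (lift j0 j)) *: A j = \sum_j C i j *: A1 j by rewrite sumA1.
have E2 : \sum_j (j == j0)%:R *: A j = A j0.
  by rewrite (bigD1 j0) //= eqxx scale1r big1 ?addr0 // => j /negPf ->; rewrite scale0r.
split=> [i|i j].
  by case: (unliftP ord_max i) => [i' _|_]; rewrite ?E1 ?E2 ?independent_neq0.
case: (unliftP ord_max i) => [i' ->|->]; last by rewrite ltnNge -ltnS ltn_ord.
case: (unliftP ord_max j) => [j' ->|_ _]; rewrite ?E1 ?E2; last exact: ltA1.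
by rewrite !lift_max; apply: Clt.
Qed.

(* The products along a staircase have increasing leading monomials. *)
Lemma staircase_independent a b (A : 'I_a.+1 -> Q) (B : 'I_b.+1 -> Q) :
  (forall i, A i != 0) -> (forall j, B j != 0) ->
  (forall i j : 'I_a.+1, (i < j)%N -> (mlead (A i) < mlead (A j))%O) ->
  (forall i j : 'I_b.+1, (i < j)%N -> (mlead (B i) < mlead (B j))%O) ->
  independent (fun s : 'I_(a + b).+1 => A (inord (s - b)) * B (inord (minn s b))).
Proof.
move=> A0 B0 Alt Blt; apply: increasing_mlead_independent => [s|s t lt_st].
  by rewrite mulf_neq0.
rewrite !mleadM //.
have Ale (i j : 'I_a.+1) : (i <= j)%N -> (mlead (A i) <= mlead (A j))%O.
  by rewrite leq_eqVlt => /orP[/eqP/val_inj -> //|/Alt/ltW].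
have sb (u : 'I_(a + b).+1) : (u - b < a.+1)%N by have := ltn_ord u; lia.
have mb (u : nat) : (minn u b < b.+1)%N by lia.
have lt_s := ltn_ord s; have lt_t := ltn_ord t.
(* Up to [b] the path runs through [B] with the first [A] fixed, afterwards through [A] with the
   last [B] fixed. *)
have [ltsb|lebs] := ltnP s b.
  apply: (@le_lt_trans _ _ (mlead (A (inord (t - b))) + mlead (B (inord s)))%MM).
    by apply: lem_add => //; apply: Ale; rewrite !inordK //; lia.
  by rewrite ltmc_add2r; apply: Blt; rewrite !inordK //; lia.
have -> : minn t b = b by lia.
by rewrite ltmc_add2l; apply: Alt; rewrite !inordK //; lia.
Qed.

End Echelon.

(** * Counting monomials *)

Section Monomials.

Definition mons n d : seq 'X_{1..n} :=
  [seq s2m t | t : d.-tuple 'I_n <- enum (basis n d)].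

Lemma mem_mons n d (u : 'X_{1..n}) : (u \in mons n d) = (mdeg u == d).
Proof. by rewrite basis_cover. Qed.

Lemma size_mons n d : size (mons n.+1 d) = 'C(d + n, d).
Proof. exact: size_basis. Qed.

Lemma uniq_mons n d : uniq (mons n d).
Proof. exact: uniq_basis. Qed.

(** Removing one factor ['X_i] is a bijection from the monomials of degree [d.+1] divisible by it to
    those of degree [d]; the claim then reduces to Pascal's rule. *)
Lemma sum_mons n d (i : 'I_n.+1) :
  (\sum_(u <- mons n.+1 d) u i = 'C(d + n, n.+1))%N.
Proof.
elim: d => [|d IHd].
  rewrite bin_small // big_seq big1 // => u.
  by rewrite mem_mons mdeg_eq0 => /eqP ->; rewrite mnm0E.
have perm : perm_eq [seq u : 'X_{1..n.+1} <- mons n.+1 d.+1 | u i != 0%N]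
    [seq (u + U_(i))%MM | u : 'X_{1..n.+1} <- mons n.+1 d].
  apply: uniq_perm; first exact/filter_uniq/uniq_mons.
    by rewrite map_inj_uniq ?uniq_mons //; apply: addIm.
  move=> u; rewrite mem_filter mem_mons; apply/andP/mapP => [[ui /eqP du]|[v vd ->]].
    have le_iu : (U_(i) <= u)%MM by rewrite lep1mP.
    exists (u - U_(i))%MM; last by rewrite submK.
    by rewrite mem_mons -eqSS -addn1 -(mdeg1 i) -mdegD submK // du.
  rewrite mem_mons in vd; rewrite mnmDE mnmE eqxx addn1 mdegD mdeg1 addn1 eqSS.
  by split.
transitivity (\sum_(u <- mons n.+1 d.+1 | u i != 0) u i)%N.
  by rewrite [RHS]big_mkcond; apply: eq_bigr => u _; case: eqP.
rewrite -big_filter (perm_big _ perm) big_map.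
under eq_bigr do rewrite mnmDE mnmE eqxx.
rewrite big_split IHd sum1_size size_mons addSn binS; congr (_ + _)%N.
by rewrite -[in RHS]bin_sub ?leq_addl // addnK.
Qed.

Lemma sum_weights n d (a : 'I_n.+1 -> nat) :
  (\sum_(u <- mons n.+1 d) (\sum_i a i * u i).+1 =
   'C(d + n, d) + (\sum_i a i) * 'C(d + n, n.+1))%N.
Proof.
under eq_bigr do rewrite -add1n.
rewrite big_split sum1_size size_mons exchange_big big_distrl /=; congr (_ + _)%N.
by apply: eq_bigr => i _; rewrite -big_distrr /= sum_mons.
Qed.

End Monomials.

(** * Scrolls as determinantal varieties *)

Lemma mulmx_col (R : comNzRingType) p q s (M : 'M[R]_(p, q)) (N : 'M[R]_(q, s)) j :
  M *m col j N = col j (M *m N).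
Proof. by rewrite !colE mulmxA. Qed.

Lemma col_combination (R : comNzRingType) p q (M : 'M[R]_(p, q)) a b j l i :
  (a *: col j M + b *: col l M) i 0 = a * M i j + b * M i l.
Proof. by rewrite !mxE. Qed.

Section LinearForms.
Variables (k : closedFieldType) (r : nat).
Notation S := {mpoly k[r.+1]}.

Definition lin (c : 'cV[k]_r.+1) : S := \sum_l c l 0 *: 'X_l.

Lemma lin_homog c : lin c \is 1.-homog.
Proof. by apply: rpred_sum => l _; apply: rpredZ; rewrite dhomogX /= mdeg1. Qed.

Lemma lin_eval c (v : 'rV[k]_r.+1) : (lin c).@[v 0] = (v *m c) 0 0.
Proof.
rewrite /lin (raddf_sum (meval (v 0))) !mxE; apply: eq_bigr => l _.
by rewrite /= mevalZ mevalXU mulrC.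
Qed.

Lemma lin_linear : linear lin.
Proof.
move=> a c c'; rewrite /lin scaler_sumr -big_split /=; apply: eq_bigr => l _.
by rewrite !mxE scalerDl scalerA.
Qed.

Lemma lin_sum (I : finType) (a : I -> k) (c : I -> 'cV_r.+1) :
  lin (\sum_i a i *: c i) = \sum_i a i *: lin (c i).
Proof. exact: (linear_sumZ lin_linear). Qed.

Lemma linP f : f \is 1.-homog -> exists c, f = lin c.
Proof.
move=> f1; exists (\col_l f@_(U_(l))); apply/mpolyP => u.
rewrite /lin (raddf_sum (mcoeff u)) /=.
under eq_bigr do rewrite mcoeffZ mcoeffX mxE.
have [/eqP|u1] := eqVneq (mdeg u) 1%N.
  rewrite mdeg_eq1 => /existsP[i /eqP ->].
  rewrite (bigD1 i) //= eqxx mulr1 big1 ?addr0 // => l li.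
  by rewrite eq_mnm1 (negPf li) mulr0.
rewrite (dhomog_nemf_coeff f1 u1) big1 // => l _.
by case: eqP => [E|_]; [rewrite -E mdeg1 in u1|rewrite mulr0].
Qed.

Lemma vanishing_ideal_homog (X : set 'rV[k]_r.+1) :
  homog_ideal (vanishing_ideal X).
Proof.
split; first split=> [d v _|a u v Iu Iv d x Xx].
- by rewrite pihomog0 meval0.
- rewrite pihomogD mevalD Iv // addr0 pihomogM (raddf_sum (meval (x 0))).
  by rewrite big1 // => i _; rewrite /= mevalM Iu ?mulr0.
move=> d f If e v Xv; have [->|ne] := eqVneq e d.
  by rewrite pihomog_id If.
by rewrite (pihomog_ne0 _ (pihomogP mdeg d f)) ?meval0 // eq_sym.
Qed.

Lemma vanishing_idealP (X : set 'rV[k]_r.+1) d f : f \is d.-homog ->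
  vanishing_ideal X f <-> forall v, X v -> f.@[v 0] = 0.
Proof.
move=> fd; split=> [If v Xv|fX e v Xv]; first by rewrite -(pihomog_dE fd) If.
have [->|ne] := eqVneq e d; first by rewrite pihomog_dE // fX.
by rewrite (pihomog_ne0 _ fd) ?meval0 // eq_sym.
Qed.

End LinearForms.

Section Scroll.
Variables (k : closedFieldType) (r m : nat) (a : 'I_m.+1 -> nat).
Notation S := {mpoly k[r.+1]}.
Notation Q := {mpoly k[m.+2]}.
Variables (A : 'M[k]_(\sum_(i < m.+1) (a i).+1, r.+1)).
Variables (B : 'M[k]_(r.+1, \sum_(i < m.+1) (a i).+1)).
Hypotheses (AB : A *m B = 1%:M) (BA : B *m A = 1%:M).
Hypothesis a_neq0 : exists i, a i != 0%N.

Local Notation X := (scroll_image A).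

Lemma monomial_sectionsE s t x i (j : 'I_(a i).+1) :
  monomial_sections a s t x 0 (tagnat.Rank i j) =
  x i * s ^+ (a i - j) * t ^+ j :> k.
Proof.
have := mxrowK (fun i => \row_(j < (a i).+1) (x i * s ^+ (a i - j) * t ^+ j)) i.
by move/matrixP/(_ 0 j); rewrite !mxE.
Qed.

Lemma scroll_neq0 v : X v -> v != 0.
Proof.
move=> [s [t [x [st0 [i xi] vE]]]]; apply/eqP => v0.
have s0 : monomial_sections a s t x = 0.
  by rewrite -[LHS]mulmx1 -AB mulmxA -vE v0 mul0mx.
have coef (j : 'I_(a i).+1) : x i * s ^+ (a i - j) * t ^+ j = 0.
  by rewrite -monomial_sectionsE s0 mxE.
case/eqP: st0; have [s00|s_neq0] := eqVneq s 0; last first.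
  have /eqP := coef ord0; rewrite expr0 mulr1 mulf_eq0 (negPf xi) expf_eq0.
  by rewrite (negPf s_neq0) andbF.
have /eqP := coef ord_max; rewrite subnn expr0 mulr1 mulf_eq0 (negPf xi) expf_eq0.
by move=> /andP[_ /eqP ->]; rewrite s00.
Qed.

(** On the rational normal curve given by a block with [a i != 0] the linear form becomes a binary
    form of positive degree [a i], which has a zero. *)
Lemma linear_form_zero (c : 'cV[k]_r.+1) : exists2 v, X v & v *m c = 0.
Proof.
have [i ai] := a_neq0.
pose x j : k := (j == i)%:R.
pose e (j : 'I_(a i).+1) := (A *m c) (tagnat.Rank i j) 0.
have secE s t : (monomial_sections a s t x *m A *m c) 0 0 =
    \sum_(j < (a i).+1) s ^+ (a i - j) * t ^+ j * e j.
  rewrite -mulmxA mxE (reindex (@tagnat.rank _ (fun i => (a i).+1))) /=; last first.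
    exact/onW_bij/tagnat.rank_bij.
  transitivity (\sum_i' \sum_(j < (a i').+1) x i' * s ^+ (a i' - j) * t ^+ j *
      (A *m c) (tagnat.Rank i' j) 0).
    rewrite sig_big_dep /=; apply: eq_bigr => -[i' j] _.
    by rewrite tagnat.rankE monomial_sectionsE.
  rewrite (bigD1 i) //= [X in _ + X]big1 ?addr0 => [|i' /negPf ni].
    by apply: eq_bigr => j _; rewrite /x eqxx mul1r.
  by rewrite big1 // => j _; rewrite /x ni !mul0r.
suff [s [t [st0 rt]]] : exists s t, (s, t) != (0, 0) /\
    \sum_(j < (a i).+1) s ^+ (a i - j) * t ^+ j * e j = 0.
  exists (monomial_sections a s t x *m A).
    by exists s, t, x; split=> //; exists i; rewrite /x eqxx oner_eq0.
  by apply/matrixP => l l'; rewrite !ord1 secE rt mxE.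
have [e0|e_neq0] := eqVneq (e ord_max) 0.
  exists 0, 1; split; first by rewrite xpair_eqE oner_eq0 andbF.
  rewrite big_ord_recr /= e0 mulr0 addr0 big1 // => j _.
  by rewrite -(subnSK (ltn_ord j)) exprS !mul0r.
pose q : {poly k} := \poly_(j < (a i).+1) e (inord j).
have q_size : size q = (a i).+1.
  apply: size_poly_eq; congr (_ != 0): e_neq0; congr e.
  by apply/val_inj; rewrite /= inordK.
have [|t] := closed_rootP q _; first by rewrite q_size eqSS.
rewrite /root horner_poly => /eqP qt; exists 1, t.
split; first by rewrite xpair_eqE oner_eq0.
by rewrite -[RHS]qt; apply: eq_bigr => j _; rewrite expr1n mul1r mulrC inord_val.
Qed.

(* The scroll is the locus where the 2 x D matrix of linear forms with the
   columns (xcol u, ycol u) has rank at most 1. *)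
Definition column_index := {i : 'I_m.+1 & 'I_(a i)}.

Definition xcol (t : column_index) : 'cV[k]_r.+1 :=
  col (tagnat.Rank (tag t) (widen_ord (leqnSn _) (tagged t))) B.

Definition ycol (t : column_index) : 'cV[k]_r.+1 :=
  col (tagnat.Rank (tag t) (lift ord0 (tagged t))) B.

Lemma card_column_index : #|{: column_index}| = (\sum_i a i)%N.
Proof.
by rewrite card_tagged sumnE big_map big_enum; under eq_bigr do rewrite card_ord.
Qed.

Lemma scroll_xcol s t x u : monomial_sections a s t x *m A *m xcol u =
  (x (tag u) * s ^+ (a (tag u) - (tagged u).+1) * t ^+ (tagged u) * s)%:M.
Proof.
rewrite -mulmxA /xcol mulmx_col AB; apply/matrixP => i j; rewrite !ord1 {i j}.
rewrite mulmx_col mulmx1 mxE monomial_sectionsE /= [RHS]mxE mulr1n.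
have -> : (a (tag u) - tagged u = (a (tag u) - (tagged u).+1).+1)%N.
  by rewrite subnSK.
by rewrite exprSr; ring.
Qed.

Lemma scroll_ycol s t x u : monomial_sections a s t x *m A *m ycol u =
  (x (tag u) * s ^+ (a (tag u) - (tagged u).+1) * t ^+ (tagged u) * t)%:M.
Proof.
rewrite -mulmxA /ycol mulmx_col AB; apply/matrixP => i j; rewrite !ord1 {i j}.
rewrite mulmx_col mulmx1 mxE monomial_sectionsE [RHS]mxE mulr1n lift0.
by rewrite exprSr mulrA.
Qed.

Lemma scroll_minor u w :
  vanishing_ideal X (lin (xcol u) * lin (ycol w) - lin (xcol w) * lin (ycol u)).
Proof.
have hom c c' : lin c * lin c' \is [in k[r.+1], 2.-homog].
  by apply: (@dhomogM _ _ _ 1 _ 1); apply: lin_homog.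
apply/(vanishing_idealP _ (rpredB (hom _ _) (hom _ _))) => v [s [t [x [_ _ ->]]]].
rewrite mevalB !mevalM !lin_eval (scroll_xcol s t x u) (scroll_xcol s t x w).
rewrite (scroll_ycol s t x u) (scroll_ycol s t x w) ![_%:M _ _]mxE !mulr1n.
by ring.
Qed.

(** The relations form a recursion inside each block of coordinates of [v]. Its solutions are
    geometric progressions, those of the point [(s : t) = (- be : al)] of P^1. *)
Lemma scroll_of_columns (v : 'rV[k]_r.+1) (al be : k) : v != 0 ->
  (al, be) != (0, 0) ->
  (forall u, al *: (v *m xcol u) + be *: (v *m ycol u) = 0) -> X v.
Proof.
move=> v0 albe0 rk1.
pose w i (j : nat) := (v *m B) 0 (tagnat.Rank i (inord j : 'I_(a i).+1)).
have wE i (j : 'I_(a i).+1) : (v *m B) 0 (tagnat.Rank i j) = w i j.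
  by rewrite /w inord_val.
have rec i j : (j < a i)%N -> al * w i j = - be * w i j.+1.
  move=> ltj; have := rk1 (Tagged (fun i => 'I_(a i)) (Ordinal ltj)).
  rewrite /xcol /ycol !mulmx_col => /matrixP/(_ 0 0).
  rewrite col_combination !wE lift0 [RHS]mxE /= => /eqP.
  by rewrite addr_eq0 mulNr => /eqP.
have vE x s t : (forall i j, (j <= a i)%N -> w i j = x i * s ^+ (a i - j) * t ^+ j) ->
    v = monomial_sections a s t x *m A.
  move=> wx; rewrite -[LHS]mulmx1 -BA mulmxA; congr (_ *m A).
  apply/rowP => p; rewrite -[p]tagnat.sig2K wE monomial_sectionsE wx //.
  by rewrite -ltnS.
have xN0 x s t : v = monomial_sections a s t x *m A -> exists i, x i != 0.
  move=> E; apply: contrapT => nx; case/eqP: v0; rewrite E.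
  suff -> : monomial_sections a s t x = 0 by rewrite mul0mx.
  apply/rowP => p; rewrite -[p]tagnat.sig2K monomial_sectionsE mxE.
  have -> : x (tagnat.sig1 p) = 0 by apply: contrapT => /eqP xp; apply: nx; exists (tagnat.sig1 p).
  by rewrite !mul0r.
have build x s t : (s, t) != (0, 0) ->
    (forall i j, (j <= a i)%N -> w i j = x i * s ^+ (a i - j) * t ^+ j) -> X v.
  move=> st0 /vE E; exists s, t, x; split=> //; exact: xN0 E.
have [be0|be_neq0] := eqVneq be 0.
  have al_neq0 : al != 0 by move: albe0; rewrite be0 xpair_eqE eqxx andbT.
  apply: (build (fun i => w i (a i) / al ^+ a i) 0 al).
    by rewrite xpair_eqE negb_and al_neq0 orbT.
  move=> i j; rewrite leq_eqVlt => /orP[/eqP ->|ltj].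
    by rewrite subnn mulr1 divfK // expf_neq0.
  have /eqP := rec _ _ ltj; rewrite be0 oppr0 mul0r mulf_eq0 (negPf al_neq0) => /eqP ->.
  by rewrite -(subnSK ltj) exprS mul0r mulr0 mul0r.
have nbe0 : - be != 0 by rewrite oppr_eq0.
apply: (build (fun i => w i 0%N / (- be) ^+ a i) (- be) al).
  by rewrite xpair_eqE negb_and nbe0.
move=> i; elim=> [_|j IHj ltj]; first by rewrite subn0 mulr1 divfK // expf_neq0.
apply: (mulfI nbe0); rewrite -rec // IHj ?(ltnW ltj) // -(subnSK ltj) exprS exprS.
by ring.
Qed.

Lemma xcol_free (p : column_index -> k) :
  \sum_u p u *: xcol u = 0 -> forall u, p u = 0.
Proof.
move=> p0 u.
pose R0 := @tagnat.Rank _ (fun i => (a i).+1) (tag u) (widen_ord (leqnSn _) (tagged u)).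
have E w : (A *m (p w *: xcol w)) R0 0 = p w * (w == u)%:R.
  rewrite -scalemxAr /xcol mulmx_col AB !mxE; congr (_ * _%:R); congr nat_of_bool.
  apply/eqP/eqP => [/tagnat.rank_inj|->//].
  case: u w @R0 => [i j] [i' j'] /= E.
  have ii' : i = i' := congr1 tag E.
  subst i'; congr Tagged; apply/val_inj.
  by have := eq_from_Tagged E => /(congr1 val).
have : \sum_w p w * (w == u)%:R = 0.
  transitivity ((A *m \sum_w p w *: xcol w) R0 0); last by rewrite p0 mulmx0 mxE.
  by rewrite mulmx_sumr summxE; apply: eq_bigr => w _; rewrite E.
rewrite (bigD1 u) //= eqxx mulr1 big1 ?addr0 // => w /negPf ->.
by rewrite mulr0.
Qed.

End Scroll.

(** * Parametrization and Hilbert function of a scroll *)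

Section Parametrization.
Variables (k : closedFieldType) (r m : nat) (a : 'I_m.+1 -> nat).
Notation S := {mpoly k[r.+1]}.
Notation Q := {mpoly k[m.+2]}.
Variables (A : 'M[k]_(\sum_(i < m.+1) (a i).+1, r.+1)).
Variables (B : 'M[k]_(r.+1, \sum_(i < m.+1) (a i).+1)).
Hypotheses (AB : A *m B = 1%:M) (BA : B *m A = 1%:M).

Local Notation X := (scroll_image A).
Local Notation sig1 := (@tagnat.sig1 _ (fun i => (a i).+1)).
Local Notation sig2 := (@tagnat.sig2 _ (fun i => (a i).+1)).

Lemma monomial_sectionsE' s t x p : monomial_sections a s t x 0 p =
  x (sig1 p) * s ^+ (a (sig1 p) - sig2 p) * t ^+ (sig2 p) :> k.
Proof. by rewrite -{1}[p]tagnat.sig2K monomial_sectionsE. Qed.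

Definition monp p : 'X_{1..m.+2} :=
  (U_(lift ord0 (sig1 p)) + U_(ord0) *+ (sig2 p))%MM.

Definition coordinates : r.+1.-tuple Q :=
  [tuple \sum_p A p l *: 'X_[monp p] | l < r.+1].

(* Substitution of a generic point of the scroll, on the chart s = 1: the
   variable 0 stands for t and the variable i.+1 for x_i. *)
Definition theta (f : S) : Q := f \mPo coordinates.

Lemma theta_lin c : theta (lin c) = \sum_p (A *m c) p 0 *: 'X_[monp p].
Proof.
rewrite /theta /lin (raddf_sum (comp_mpoly coordinates)) /=.
under eq_bigr => l _.
  rewrite comp_mpolyZ comp_mpolyXU -tnth_nth tnth_mktuple scaler_sumr.
  over.
rewrite exchange_big; apply: eq_bigr => p _ /=.
by rewrite mxE scaler_suml; apply: eq_bigr => l _; rewrite scalerA mulrC.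
Qed.

Lemma theta_eval w f : (theta f).@[w] =
  f.@[(monomial_sections a 1 (w ord0) (fun i => w (lift ord0 i)) *m A) 0].
Proof.
rewrite /theta comp_mpoly_meval; apply: meval_eq => l.
rewrite tnth_mktuple (raddf_sum (meval w)) mxE; apply: eq_bigr => p _.
rewrite /= mevalZ mulrC monomial_sectionsE' expr1n mulr1; congr (_ * _).
rewrite mevalX big_ord_recl (bigD1 (sig1 p)) //= big1.
  rewrite !mnmDE !mulmnE !mnm1E !eqxx /=.
  by rewrite add0n mul1n mul0n addn0 expr1 mulr1 mulrC.
move=> i ni; rewrite mnmDE mulmnE !mnm1E /= mul0n addn0.
by rewrite (inj_eq lift_inj) eq_sym (negPf ni) expr0.
Qed.

Lemma theta_vanish d f : f \is d.-homog ->
  vanishing_ideal X f <-> theta f = 0.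
Proof.
move=> fd; rewrite (vanishing_idealP _ fd); split=> [fX|th0 v].
  (* The extra variable disposes of the [w] with all [x i = 0], which parametrize no point of the
     scroll. *)
  suff : theta f * 'X_(lift ord0 ord0) = 0.
    move/eqP; rewrite mulf_eq0 => /orP[/eqP //|/eqP X0].
    have := congr1 (meval (fun=> 1)) X0; rewrite mevalXU meval0 => /eqP.
    by rewrite oner_eq0.
  apply/eqP; apply: contraT => /mpoly_nonroot[w]; rewrite mevalM mevalXU theta_eval.
  have [->|w0] := eqVneq (w (lift ord0 ord0)) 0; first by rewrite mulr0 eqxx.
  rewrite fX ?mul0r ?eqxx //; exists 1, (w ord0), (fun i => w (lift ord0 i)).
  by split=> //; [rewrite xpair_eqE oner_eq0|exists ord0].
move=> [s [t [x [st0 _ ->]]]].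
have main s' : s' != 0 -> f.@[(monomial_sections a s' t x *m A) 0] = 0.
  move=> s0; pose w (i : 'I_m.+2) := if unlift ord0 i is Some i'
    then x i' * s' ^+ a i' else t / s'.
  have := theta_eval w f; rewrite th0 meval0 => ->; congr (f.@[(_ *m A) 0]).
  apply/rowP => p; rewrite !monomial_sectionsE' /w unlift_none liftK expr1n mulr1.
  have lej : (sig2 p <= a (sig1 p))%N by rewrite -ltnS.
  have E : s' ^+ a (sig1 p) = s' ^+ (a (sig1 p) - sig2 p) * s' ^+ (sig2 p).
    by rewrite -exprD subnK.
  by rewrite E expr_div_n; field; rewrite expf_neq0.
have [s0|] := eqVneq s 0; last exact: main.
(* The fibre [s = 0] is reached by continuity: [q] is the value of [f] as a polynomial in [s], and
   it vanishes for all [s != 0]. *)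
pose h l : {poly k} :=
  \sum_p (A p l * x (sig1 p) * t ^+ (sig2 p)) *: 'X^(a (sig1 p) - sig2 p).
pose q : {poly k} := \sum_(u <- msupp f) f@_u *: \prod_l h l ^+ u l.
have qE z : q.[z] = f.@[(monomial_sections a z t x *m A) 0].
  rewrite /q horner_sum mevalE; apply: eq_bigr => u _.
  rewrite hornerZ horner_prod; congr (_ * _); apply: eq_bigr => l _.
  rewrite horner_exp; congr (_ ^+ _); rewrite /h horner_sum mxE.
  apply: eq_bigr => p _; rewrite hornerZ hornerXn monomial_sectionsE'.
  by ring.
have q0 : q * 'X = 0.
  apply/eqP; apply: contraT => /closed_nonrootP[z]; rewrite /root hornerM hornerX qE.
  by have [->|/main ->] := eqVneq z 0; rewrite ?mulr0 ?mul0r eqxx.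
move/eqP: q0; rewrite mulf_eq0 polyX_eq0 orbF => /eqP q0.
by rewrite -qE q0 horner0.
Qed.

Definition weight (u : 'I_m.+1 -> nat) : nat := (\sum_i a i * u i)%N.

(** The monomials t^j x^u with u of degree [d] and j at most the weight of u. They correspond to
    H^0(O(d)) as the direct sum over u of H^0(P^1, O(weight u)). *)
Definition scroll_mon d : seq 'X_{1..m.+2} :=
  [seq [multinom if unlift ord0 i is Some i' then u i' else j | i < m.+2]
  | u : 'X_{1..m.+1} <- mons m.+1 d, j <- iota 0 (weight u).+1].

Lemma mem_scroll_mon d (mu : 'X_{1..m.+2}) : (mu \in scroll_mon d) =
  (\sum_i mu (lift ord0 i) == d)%N &&
  (mu ord0 <= weight (fun i => mu (lift ord0 i)))%N.
Proof.
apply/allpairsPdep/andP => [[u [j [ud jw ->]]]|[/eqP mud muw]].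
  rewrite mem_mons in ud; rewrite mem_iota add0n ltnS /= in jw.
  rewrite mnmE unlift_none -(eqP ud) mdegE; split.
    by apply/eqP/eq_bigr => i _; rewrite mnmE liftK.
  rewrite (leq_trans jw) // leq_eqVlt; apply/orP; left; apply/eqP.
  by apply: eq_bigr => i _; rewrite mnmE liftK.
exists [multinom mu (lift ord0 i) | i < m.+1], (mu ord0); split.
- by rewrite mem_mons mdegE -mud; apply/eqP/eq_bigr => i _; rewrite mnmE.
- rewrite mem_iota add0n ltnS /= (leq_trans muw) // leq_eqVlt; apply/orP; left.
  by apply/eqP/eq_bigr => i _; rewrite mnmE.
apply/mnmP => i; rewrite mnmE; case: unliftP => [j ->|-> //].
by rewrite mnmE.
Qed.

Lemma scroll_mon_uniq d : uniq (scroll_mon d).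
Proof.
apply: allpairs_uniq_dep => [|u _|]; [exact: uniq_mons|exact: iota_uniq|].
move=> [u j] [v l] _ _ /= /mnmP E.
have -> : u = v by apply/mnmP => i; have := E (lift ord0 i); rewrite !mnmE liftK.
by have := E ord0; rewrite !mnmE unlift_none => ->.
Qed.

Lemma size_scroll_mon d : size (scroll_mon d) =
  ('C(d + m, d) + (\sum_i a i) * 'C(d + m, m.+1))%N.
Proof.
rewrite size_allpairs_dep -sum_weights sumnE big_map; apply: eq_bigr => u _.
by rewrite size_iota.
Qed.

Lemma scroll_monD d e mu nu : mu \in scroll_mon d -> nu \in scroll_mon e ->
  (mu + nu)%MM \in scroll_mon (d + e).
Proof.
rewrite !mem_scroll_mon => /andP[/eqP <- w1] /andP[/eqP <- w2].
rewrite -big_split /=; apply/andP; split.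
  by apply/eqP/eq_bigr => i _; rewrite mnmDE.
rewrite mnmDE (leq_trans (leq_add w1 w2)) // /weight -big_split /=.
by rewrite leq_eqVlt; apply/orP; left; apply/eqP/eq_bigr => i _; rewrite mnmDE mulnDr.
Qed.

Lemma monpE p i : monp p (lift ord0 i) = (i == sig1 p).
Proof. by rewrite mnmDE mulmnE !mnm1E (inj_eq lift_inj) mul0n addn0 eq_sym. Qed.

Lemma monp0 p : monp p ord0 = sig2 p.
Proof. by rewrite mnmDE mulmnE !mnm1E eqxx mul1n. Qed.

Lemma monp_scroll_mon p : monp p \in scroll_mon 1.
Proof.
rewrite mem_scroll_mon monp0 /weight; under eq_bigr do rewrite monpE.
under [X in (_ <= X)%N]eq_bigr do rewrite monpE.
rewrite (bigD1 (sig1 p)) //= eqxx big1 ?addn0 => [|i /negPf -> //].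
rewrite (bigD1 (sig1 p)) //= eqxx muln1 big1 ?addn0 => [|i /negPf ->].
  by rewrite -ltnS ltn_ord.
by rewrite muln0.
Qed.

Lemma theta_support d f : f \is d.-homog ->
  {subset msupp (theta f) <= scroll_mon d}.
Proof.
move: d f; apply: homog_ind => [mu|d i f IHf mu|d].
- rewrite /theta comp_mpoly1 msupp1 inE => /eqP ->.
  rewrite mem_scroll_mon mnm0E andbT sum_nat_eq0.
  by apply/forallP => i; rewrite mnm0E.
- rewrite /theta rmorphM /= comp_mpolyXU -tnth_nth tnth_mktuple.
  move/msuppM_le/allpairsP => [[mu1 mu2] /= [mu1s mu2s ->]].
  apply: (@scroll_monD 1); last exact: IHf.
  move/msupp_sum_le: mu1s => /flatten_mapP[p _ /msuppZ_le].
  by rewrite msuppX inE => /eqP ->; apply: monp_scroll_mon.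
split=> [mu|c u v IHu IHv mu]; first by rewrite /theta comp_mpoly0 msupp0.
rewrite /theta comp_mpolyD comp_mpolyZ => /msuppD_le; rewrite mem_cat.
by move=> /orP[/msuppZ_le/IHu|/IHv].
Qed.

(** Projective normality. Choose [x_i] dividing [mu] and split off the coordinate x_i t^j with the
    largest possible [j]; the rest still satisfies the bound on the exponent of t. *)
Lemma theta_surjective d mu : mu \in scroll_mon d ->
  exists2 f, f \is d.-homog & theta f = 'X_[mu].
Proof.
elim: d => [|d IHd] in mu *.
  rewrite mem_scroll_mon => /andP[/eqP mu0 muw]; exists 1; first exact: dhomog1.
  rewrite /theta comp_mpoly1 -mpolyX0; congr 'X_[_]; apply/mnmP => i.
  have mui j : mu (lift ord0 j) = 0%N.
    by apply/eqP; rewrite -leqn0 -[X in (_ <= X)%N]mu0 (bigD1 j) //= leq_addr.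
  rewrite mnm0E; case: (unliftP ord0 i) => [j ->|->]; first by rewrite mui.
  apply/esym/eqP; rewrite -leqn0 (leq_trans muw) // /weight big1 // => j _.
  by rewrite mui muln0.
rewrite mem_scroll_mon => /andP[/eqP mud muw].
have [i mui] : exists i, mu (lift ord0 i) != 0%N.
  apply: contrapT => noi; move: mud; rewrite big1 // => i _.
  by apply: contrapT => /eqP mui; apply: noi; exists i.
pose j := minn (mu ord0) (a i).
have ltj : (j < (a i).+1)%N by rewrite ltnS geq_minr.
pose p := @tagnat.Rank _ (fun i => (a i).+1) i (Ordinal ltj).
have p1 : sig1 p = i by rewrite tagnat.Rank1K.
have p2 : sig2 p = j :> nat by rewrite tagnat.Rank2K; case: _ / (esym _).
have le_p : (monp p <= mu)%MM.
  apply/mnm_lepP => l; case: (unliftP ord0 l) => [l' ->|->].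
    by rewrite monpE p1; case: eqP => // ->; rewrite lt0n.
  by rewrite monp0 p2 geq_minl.
have [|f fd fE] := IHd (mu - monp p)%MM.
  rewrite mem_scroll_mon; apply/andP; split.
    rewrite -eqSS -mud -addn1; apply/eqP.
    transitivity (\sum_l (mu - monp p)%MM (lift ord0 l) + \sum_l (monp p) (lift ord0 l))%N.
      congr (_ + _)%N; rewrite (bigD1 i) //= monpE p1 eqxx big1 // => l /negPf nl.
      by rewrite monpE p1 nl.
    rewrite -big_split /=; apply: eq_bigr => l _.
    by rewrite -mnmDE submK.
  rewrite mnmBE monp0 p2 leq_subLR.
  have wE : (weight (fun l => mu (lift ord0 l)) =
      a i + weight (fun l => (mu - monp p)%MM (lift ord0 l)))%N.
    rewrite /weight [LHS](bigD1 i) //= [in RHS](bigD1 i) //= addnA; congr (_ + _)%N.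
      rewrite mnmBE monpE p1 eqxx mulnBr muln1 subnKC //.
      by rewrite -{1}[a i]muln1 leq_mul2l lt0n mui orbT.
    by apply: eq_bigr => l /negPf nl; rewrite mnmBE monpE p1 nl subn0.
  by rewrite wE in muw; rewrite /j; move: muw; set W := weight _; lia.
exists (lin (col p B) * f).
  by apply: (@dhomogM _ _ _ 1) => //; apply: lin_homog.
rewrite /theta rmorphM /= -/(theta _) -/(theta _) fE theta_lin.
rewrite (bigD1 p) //= [X in _ + X]big1 => [|l lp].
  by rewrite [X in X * _]addr0 mulmx_col AB !mxE eqxx scale1r -mpolyXD addmC submK.
by rewrite mulmx_col AB !mxE (negPf lp) scale0r.
Qed.

End Parametrization.

(* In degree d, for a scroll of dimension m + 1 and degree D. *)
Definition scroll_hilbert (m D d : nat) : nat :=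
  ('C(d + m, d) + D * 'C(d + m, m.+1))%N.

Section HilbertFunction.
Variables (k : closedFieldType) (r m : nat) (a : 'I_m.+1 -> nat).
Notation S := {mpoly k[r.+1]}.
Notation Q := {mpoly k[m.+2]}.
Variables (A : 'M[k]_(\sum_(i < m.+1) (a i).+1, r.+1)).
Variables (B : 'M[k]_(r.+1, \sum_(i < m.+1) (a i).+1)).
Hypotheses (AB : A *m B = 1%:M).

Local Notation X := (scroll_image A).
Local Notation N := (scroll_hilbert m (\sum_i a i)).

Lemma theta_sum (I : finType) (c : I -> k) (z : I -> S) :
  theta A (\sum_i c i *: z i) = \sum_i c i *: theta A (z i).
Proof.
by rewrite /theta raddf_sum; apply: eq_bigr => i _; rewrite /= comp_mpolyZ.
Qed.

Lemma sum_homog (I : finType) d (c : I -> k) (z : I -> S) :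
  (forall i, z i \is d.-homog) -> \sum_i c i *: z i \is d.-homog.
Proof. by move=> zd; apply: rpred_sum => i _; apply: rpredZ. Qed.

Lemma scroll_codim d : codim_le (vanishing_ideal X) d (N d).
Proof.
move=> T z zd indz; rewrite leqNgt; apply/negP => ltNT.
have [c [t ct] c0] := exists_relation
  (fun t j => (theta A (z t))@_(nth 0%MM (scroll_mon a d) (nat_of_ord j))) ltNT.
case/eqP: ct; apply: indz t.
apply/(theta_vanish A (sum_homog c zd))/mpolyP => mu; rewrite mcoeff0.
have [mus|] := boolP (mu \in scroll_mon a d); last first.
  move=> mus; apply: contraNeq mus; rewrite -mcoeff_msupp => mus.
  exact: theta_support (sum_homog c zd) _ mus.
have ltj : (index mu (scroll_mon a d) < N d)%N.
  by rewrite /scroll_hilbert -size_scroll_mon index_mem.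
have := c0 (Ordinal ltj); rewrite /= nth_index // => E.
rewrite theta_sum raddf_sum -[RHS]E; apply: eq_bigr => t _.
by rewrite /= mcoeffZ.
Qed.

(** Only members satisfying [p] are counted, so that the lemma also applies to a spanning family
    with one member left out. *)
Lemma scroll_span d (T : finType) (g : T -> S) (p : pred T) :
  (forall t, g t \is d.-homog) ->
  (forall f, f \is d.-homog -> exists c : T -> k,
     (forall t, ~~ p t -> c t = 0) /\
     vanishing_ideal X (f - \sum_t c t *: g t)) ->
  (N d <= #|p|)%N.
Proof.
move=> gd span; rewrite leqNgt; apply/negP => ltpN.
have /choice[w wP] (j : 'I_(N d)) : exists w, w \is d.-homog /\
    theta A w = 'X_[nth 0%MM (scroll_mon a d) j].
  have [|w wd wE] := @theta_surjective _ _ _ _ _ _ AB d (nth 0%MM (scroll_mon a d) j).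
    by apply: mem_nth; rewrite size_scroll_mon.
  by exists w.
have /choice[c cP] j := span _ (wP j).1.
rewrite -[N d]card_ord in ltpN.
have [u [j uj] u0] := exists_relation (fun j (t : 'I_#|p|) => c j (enum_val t)) ltpN.
case/eqP: uj; have uc t : \sum_j u j * c j t = 0.
  have [pt|npt] := boolP (p t).
    by have := u0 (enum_rank_in pt t); rewrite enum_rankK_in.
  by rewrite big1 // => l _; rewrite (cP l).1 ?mulr0.
have : vanishing_ideal X (\sum_j u j *: w j).
  have hX := vanishing_ideal_homog X.
  have -> : \sum_j u j *: w j = \sum_j u j *: (w j - \sum_t c j t *: g t).
    apply/eqP; rewrite -subr_eq0 -sumrB; apply/eqP.
    transitivity (\sum_j \sum_t (u j * c j t) *: g t).
      apply: eq_bigr => l _; rewrite -scalerBr subKr [LHS]scaler_sumr.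
      by apply: eq_bigr => t _; rewrite scalerA.
    by rewrite exchange_big big1 // => t _; rewrite -scaler_suml uc scale0r.
  by apply: (ideal_sum hX.1) => l _; apply: (idealZ hX.1); case: (cP l).
move/(theta_vanish A (sum_homog u (fun j => (wP j).1))).
rewrite theta_sum => /(congr1 (mcoeff (nth 0%MM (scroll_mon a d) j))).
rewrite mcoeff0 raddf_sum (bigD1 j) //= (wP j).2 mcoeffZ mcoeffX eqxx mulr1.
rewrite big1 ?addr0 // => l lj; rewrite (wP l).2 mcoeffZ mcoeffX.
by rewrite nth_uniq ?scroll_mon_uniq ?size_scroll_mon // (inj_eq val_inj) (negPf lj) mulr0.
Qed.

(** A relation with [u t0 != 0] would eliminate [g t0], and fewer than [N d] forms would span. *)
Lemma scroll_span_independent d (T : finType) (g : T -> S) :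
  #|T| = N d -> (forall t, g t \is d.-homog) ->
  (forall f, f \is d.-homog -> exists c : T -> k,
     vanishing_ideal X (f - \sum_t c t *: g t)) ->
  independent_mod (vanishing_ideal X) g.
Proof.
move=> cardT gd span u Xu t0; apply: contrapT => /eqP ut0.
have hX := vanishing_ideal_homog X.
have : (N d <= #|predC1 t0|)%N.
  apply: (@scroll_span d T g) => // f /span[c Xc].
  exists (fun t => c t - c t0 / u t0 * u t); split=> [t|].
    by rewrite negbK => /eqP ->; rewrite divfK ?subrr.
  have -> : f - \sum_t (c t - c t0 / u t0 * u t) *: g t =
      f - \sum_t c t *: g t + (c t0 / u t0) *: \sum_t u t *: g t.
    rewrite scaler_sumr -addrA -sumrN -sumrN -big_split; congr (_ + _).
    by apply: eq_bigr => t _; rewrite /= scalerA scalerBl opprB addrC.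
  by apply: (idealD hX.1) => //; apply: (idealZ hX.1).
have T0 : (0 < #|T|)%N by apply/card_gt0P; exists t0.
by rewrite cardC1 cardT; move: T0; rewrite cardT; case: (N d) => // l _; rewrite ltnn.
Qed.

End HilbertFunction.

(** * Koszul relations and minors of a pencil *)

Section KoszulPencil.
Variables (k : closedFieldType) (r : nat).
Notation S := {mpoly k[r.+1]}.

(* Exactness in degree d + 1 of the Koszul complex of lam on S / K0, tested
   against all pairs (J, xi) on which the Koszul relations vanish. *)
Definition koszul_exact (K0 : set S) (I : finType) (lam : I -> S) (d : nat) : Prop :=
  forall c : I -> S, (forall i, c i \is d.-homog) -> K0 (\sum_i lam i * c i) ->
  forall (J : set S) (xi : I -> S), ideal J -> K0 `<=` J ->
    (forall i j, J (xi i * lam j - xi j * lam i)) -> J (\sum_i xi i * c i).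

Variables (K0 : set S) (V T : finType) (x y : V -> S) (l : T -> S).
Hypotheses (hK0 : homog_ideal K0) (x1 : forall v, x v \is 1.-homog).
Hypotheses (y1 : forall v, y v \is 1.-homog) (l1 : forall j, l j \is 1.-homog).

Definition minor (vw : V * V) : S := x vw.1 * y vw.2 - x vw.2 * y vw.1.

Local Notation K1 := (adjoin K0 l).
Local Notation K2 := (adjoin (adjoin K0 l) minor).

Lemma minor_homog vw : minor vw \is 2.-homog.
Proof. by apply: rpredB; apply: (@dhomogM _ _ _ 1 _ 1). Qed.

Lemma homog_adjoin_minors : homog_ideal K2.
Proof.
apply: (@homog_adjoin _ _ _ _ _ _ (fun=> 2%N)); last exact: minor_homog.
exact: (@homog_adjoin _ _ _ hK0 _ _ (fun=> 1%N)).
Qed.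

Let hK1 : homog_ideal K1 := @homog_adjoin _ _ _ hK0 _ _ (fun=> 1%N) l1.
Let hK2 := homog_adjoin_minors.

Variables (d : nat) (I : finType) (lam : I -> S).
Variables (C : I -> V -> k) (C' : I -> T -> k).
Hypothesis lamE : forall i,
  lam i = \sum_v C i v *: (x v + y v) + \sum_j C' i j *: l j.
Hypothesis lam_gen : contains_degree (adjoin K0 lam) d.+1.
Hypothesis lam_koszul : koszul_exact K0 lam d.+1.

Let lam1 i : lam i \is 1.-homog.
Proof.
rewrite lamE; apply: rpredD; apply: rpred_sum => j _; apply: rpredZ.
  exact: rpredD (x1 j) (y1 j).
exact: l1.
Qed.

(** The map under study sends [g s * b] to [xx s * b]: it takes [x v + y v] to [x v] and [l j] to
    0. *)
Let g (s : V + T) : S := match s with inl v => x v + y v | inr j => l j end.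
Let xx (s : V + T) : S := match s with inl v => x v | inr j => 0 end.
Let CC i (s : V + T) : k := match s with inl v => C i v | inr j => C' i j end.

Let lamgE i : lam i = \sum_s CC i s *: g s.
Proof. by rewrite lamE big_sumType. Qed.

Let sub01 : K0 `<=` K1. Proof. exact: sub_adjoin. Qed.
Let sub12 : K1 `<=` K2. Proof. exact: sub_adjoin. Qed.

Let K2_l j a : K2 (a * l j).
Proof. by apply/(idealMl hK2.1)/sub12/adjoin_mem; exact: hK0.1. Qed.

Let K2_xg s s' : K2 (xx s * g s' - xx s' * g s).
Proof.
case: s s' => [v|j] [w|j'] /=; rewrite ?mul0r ?subr0 ?sub0r.
- have -> : x v * (x w + y w) - x w * (x v + y v) = minor (v, w).
    by rewrite /minor /=; ring.
  by apply: adjoin_mem; exact: hK1.1.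
- exact: K2_l.
- by apply/(idealN hK2.1)/K2_l.
- exact: ideal0 hK2.1.
Qed.

(** Exactness is known for [lam], not for the family [g]. Expanding each [b s] in the [lam i] turns
    a relation between the [g s] into one between the [lam i] with coefficients [c i]; [xi i] is the
    image of [lam i], and [K2_xg] gives the Koszul relations between [xi] and [lam]. *)
Let relation_lift (b : V + T -> S) : (forall s, b s \is d.+1.-homog) ->
  K0 (\sum_s g s * b s) -> K2 (\sum_s xx s * b s).
Proof.
move=> bd K0gb.
have /choice[e eP] s : exists e : I -> S, (forall i, e i \is d.-homog) /\
    K0 (b s - \sum_i lam i * e i).
  by have [e ed Ke] := adjoin_dhomog hK0 lam1 (bd s) (lam_gen (bd s)); exists e.
have g1 s : g s \is 1.-homog by case: s => [v|j] //=; rewrite rpredD.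
pose c i := \sum_s e s i * g s.
pose xi i := \sum_s CC i s *: xx s.
have cd i : c i \is d.+1.-homog.
  apply: rpred_sum => s _.
  by have := dhomogM ((eP s).1 i) (g1 s); rewrite addn1.
have K0lc : K0 (\sum_i lam i * c i).
  have -> : \sum_i lam i * c i =
      \sum_s g s * b s - \sum_s g s * (b s - \sum_i lam i * e s i).
    rewrite -sumrB; under [RHS]eq_bigr do rewrite -mulrBr subKr mulr_sumr.
    rewrite exchange_big; apply: eq_bigr => i _; rewrite mulr_sumr.
    by apply: eq_bigr => s _; ring.
  apply: (idealB hK0.1) => //; apply: (ideal_sum hK0.1) => s _.
  by apply: (idealMl hK0.1); case: (eP s).
have K2_xlam s i : K2 (xx s * lam i - xi i * g s).
  have -> : xx s * lam i - xi i * g s =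
      \sum_s' CC i s' *: (xx s * g s' - xx s' * g s).
    rewrite lamgE mulr_sumr /xi mulr_suml -sumrB; apply: eq_bigr => s' _.
    by rewrite scalerBr scalerAr scalerAl.
  by apply: (ideal_sum hK2.1) => s' _; apply/(idealZ hK2.1)/K2_xg.
have K2_xilam i j : K2 (xi i * lam j - xi j * lam i).
  have -> : xi i * lam j - xi j * lam i =
      \sum_s CC i s *: (xx s * lam j - xi j * g s).
    rewrite (lamgE i) mulr_sumr {1}/xi mulr_suml -sumrB; apply: eq_bigr => s' _.
    by rewrite -scalerAl -scalerAr scalerBr.
  by apply: (ideal_sum hK2.1) => s' _; apply: (idealZ hK2.1).
have sub02 : K0 `<=` K2 by apply: subset_trans sub01 sub12.
have K2xc := lam_koszul cd K0lc hK2.1 sub02 K2_xilam.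
have -> : \sum_s xx s * b s = \sum_i xi i * c i +
    (\sum_s xx s * (b s - \sum_i lam i * e s i) +
     \sum_s \sum_i e s i * (xx s * lam i - xi i * g s)).
  have -> : \sum_i xi i * c i = \sum_s \sum_i e s i * (xi i * g s).
    rewrite exchange_big; apply: eq_bigr => i _; rewrite mulr_sumr.
    by apply: eq_bigr => s _; ring.
  rewrite -!big_split; apply: eq_bigr => s _ /=.
  rewrite mulrBr mulr_sumr addrCA -addrA -[LHS]addr0; congr (_ + _).
  rewrite -big_split -sumrN -big_split big1 // => i _ /=.
  by ring.
apply: (idealD hK2.1) => //; apply: (idealD hK2.1).
  apply: (ideal_sum hK2.1) => s _; apply: (idealMl hK2.1); apply: sub02.
  by case: (eP s).
apply: (ideal_sum hK2.1) => s _; apply: (ideal_sum hK2.1) => i _.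
exact: idealMl hK2.1 _ _ (K2_xlam _ _).
Qed.

(** The map is well defined modulo [K2]. As [minor x y (v, w)] equals
    [x v * (x w + y w) - x w * (x v + y v)], a combination of minors can be absorbed into the
    coefficients, giving [bb]; since [q'] is antisymmetric, this does not change the image. *)
Let column_lift (b : V -> S) : (forall v, b v \is d.+1.-homog) ->
  K2 (\sum_v (x v + y v) * b v) -> K2 (\sum_v x v * b v).
Proof.
move=> bd.
have xy1 v : x v + y v \is 1.-homog by rewrite rpredD.
have ud : \sum_v (x v + y v) * b v \is (2 + d).-homog.
  by apply: rpred_sum => v _; apply: (@dhomogM _ _ _ 1 _ d.+1).
move=> /(adjoin_dhomog hK1 minor_homog ud)[q qd].
have u'd : \sum_v (x v + y v) * b v - \sum_vw minor vw * q vw \is (1 + d.+1).-homog.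
  apply: rpredB => //; apply: rpred_sum => vw _.
  exact: dhomogM (minor_homog vw) (qd vw).
move=> /(adjoin_dhomog hK0 l1 u'd)[b' b'd K0u].
pose q' v w := q (v, w) - q (w, v).
pose bb w := b w - \sum_v x v * q' v w.
pose bs s := match s with inl w => bb w | inr j => - b' j end.
have := @relation_lift bs; rewrite !big_sumType /= => lift_bs.
have swap (F : V -> V -> S) :
    \sum_w \sum_v F v w * q' v w = \sum_w \sum_v (F v w - F w v) * q (v, w).
  rewrite /q'; under eq_bigr do under eq_bigr do rewrite mulrBr.
  under [RHS]eq_bigr do under eq_bigr do rewrite mulrBl.
  under eq_bigr do rewrite sumrB; under [RHS]eq_bigr do rewrite sumrB.
  by rewrite !sumrB; congr (_ - _); rewrite exchange_big.
have {lift_bs} : K2 (\sum_w x w * bb w + \sum_j 0 * - b' j).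
  apply: lift_bs => [[w|j]|] /=.
  - apply: (rpredB (bd w)); apply: rpred_sum => v _.
    exact: (@dhomogM _ _ _ 1 _ d _ (x1 v) (rpredB (qd (v, w)) (qd (w, v)))).
  - exact: (rpredNr (b'd j)).
  congr (K0 _): K0u; congr (_ + _); last by rewrite -sumrN; apply: eq_bigr => j _; rewrite mulrN.
  rewrite /bb; under [RHS]eq_bigr do rewrite mulrBr mulr_sumr.
  rewrite sumrB; congr (_ - _).
  transitivity (\sum_w \sum_v (x w + y w) * x v * q' v w); last first.
    by apply: eq_bigr => w _; apply: eq_bigr => v _; rewrite mulrA.
  rewrite (swap (fun v w => (x w + y w) * x v)) exchange_big pair_big /=.
  by apply: eq_bigr => -[v w] _; rewrite /minor /=; ring.
rewrite [X in _ + X]big1 ?addr0 => [|j _]; last by rewrite mul0r.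
suff -> : \sum_w x w * bb w = \sum_v x v * b v by [].
transitivity (\sum_w x w * b w - \sum_w \sum_v x w * x v * q' v w).
  rewrite -sumrB; apply: eq_bigr => w _; rewrite mulrBr mulr_sumr.
  by congr (_ - _); apply: eq_bigr => v _; rewrite mulrA.
rewrite -[RHS]subr0; congr (_ - _).
rewrite (swap (fun v w => x w * x v)) big1 // => w _; rewrite big1 // => v _.
by rewrite [x v * x w]mulrC subrr mul0r.
Qed.

(* The endomorphism of S / K2 is (x v + y v) * b |-> x v * b. *)
Lemma koszul_pencil :
  (forall al be : k, (al, be) != (0, 0) ->
    contains_degree (adjoin K2 (fun v => al *: x v + be *: y v)) d.+2) ->
  contains_degree K2 d.+2.
Proof.
move=> pencil f fd.
pose E := dhomog r.+1 k d.+2.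
pose L (u w : E) := exists b : V -> S, [/\ forall v, b v \is d.+1.-homog,
  val u = \sum_v (x v + y v) * b v & val w = \sum_v x v * b v].
have subK : submodule (fun e : E => K2 (val e)).
  by have [K20 KP] := ideal_submodule hK2.1; split=> // a u v; apply: KP.
have L0 : L 0 0.
  by exists (fun=> 0); split=> [v||]; rewrite ?rpred0 // big1 // => v _; rewrite mulr0.
have LP a u v u' v' : L u v -> L u' v' -> L (a *: u + u') (a *: v + v').
  move=> [b [bd ub vb]] [b' [b'd ub' vb']]; exists (fun v => a *: b v + b' v).
  split=> [w||].
  - by rewrite rpredD // rpredZ.
  - have -> : val (a *: u + u') = a *: val u + val u' by [].
    rewrite ub ub' scaler_sumr -big_split; apply: eq_bigr => w _.
    by rewrite /= mulrDr scalerAr.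
  have -> : val (a *: v + v') = a *: val v + val v' by [].
  rewrite vb vb' scaler_sumr -big_split; apply: eq_bigr => w _.
  by rewrite /= mulrDr scalerAr.
apply: (@pencil_surjective _ _ _ L subK L0 LP _ _ (DHomog fd)).
  by move=> u v [b [bd ub vb]]; rewrite ub vb; apply: column_lift.
move=> al be albe0 e.
(* [al * (x v + y v) + be * x v] is the member [(al + be, al)] of the pencil of columns. *)
have ab0 : (al + be, al) != (0, 0).
  apply: contra_neq albe0 => -[E1 E2]; move: E1; rewrite E2 add0r => ->.
  by [].
have h1 v : (al + be) *: x v + al *: y v \is 1.-homog by rewrite rpredD ?rpredZ.
have [b bd Kb] := @adjoin_dhomog _ _ _ hK2 _ _ 1 d.+1 _ h1 (valP e) (pencil _ _ ab0 _ (valP e)).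
have ud : \sum_v (x v + y v) * b v \is d.+2.-homog.
  by apply: rpred_sum => v _; apply: (@dhomogM _ _ _ 1 _ d.+1); rewrite ?rpredD.
have wd : \sum_v x v * b v \is d.+2.-homog.
  by apply: rpred_sum => v _; apply: (@dhomogM _ _ _ 1 _ d.+1).
exists (DHomog ud), (DHomog wd); split; first by exists b.
have -> : val (e - (al *: DHomog ud + be *: DHomog wd)) =
  val e - (al *: (\sum_v (x v + y v) * b v) + be *: (\sum_v x v * b v)) by [].
congr (K2 (_ - _)): Kb; rewrite !scaler_sumr -big_split; apply: eq_bigr => v _ /=.
by rewrite -!mul_mpolyC mpolyCD; ring.
Qed.

End KoszulPencil.

(** * The Koszul complex of the variables *)

Section KoszulPolynomial.
Variables (k : closedFieldType) (r n : nat) (L : n.-tuple {mpoly k[r.+1]}).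
Notation S := {mpoly k[r.+1]}.
Notation R := {mpoly k[n]}.

Lemma variables_decomposition (s : seq 'I_n) (P : R) : uniq s ->
  (forall u, u \in msupp P -> exists2 i, i \in s & u i != 0%N) ->
  exists b : 'I_n -> R, P = \sum_(i <- s) 'X_i * b i.
Proof.
move=> us Ps; have /choice[f fP] (u : 'X_{1..n}) :
    exists f : option 'I_n, u \in msupp P ->
      if f is Some i then i \in s /\ u i != 0%N else False.
  have [uP|] := boolP (u \in msupp P); last by exists None.
  by have [i is_ ui] := Ps u uP; exists (Some i).
exists (fun i => \sum_(u <- msupp P | f u == Some i) P@_u *: 'X_[u - U_(i)]).
rewrite {1}[P]mpolyE; under [RHS]eq_bigr do rewrite big_mkcond mulr_sumr.
rewrite exchange_big /= big_seq [RHS]big_seq; apply: eq_bigr => u uP.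
have := fP u uP; case: (f u) => // i [is_ ui].
rewrite (bigD1_seq i) //= eqxx big1 ?addr0 => [|j ji]; last first.
  by case: eqP => [[ij]|_]; [rewrite ij eqxx in ji|rewrite mulr0].
rewrite -scalerAr -mpolyXD addmC submK //.
by rewrite lep1mP.
Qed.

(** The variables form a regular sequence: the coefficient of the first one lies in the ideal of the
    others, so Koszul relations remove it and the number of variables drops. *)
Lemma koszul_mpoly (P : 'I_n -> R) (J : set S) (xi : 'I_n -> S) :
  \sum_i 'X_i * P i = 0 -> ideal J ->
  (forall i j, J (xi i * tnth L j - xi j * tnth L i)) ->
  J (\sum_i xi i * (P i \mPo L)).
Proof.
move=> P0 idJ xiJ.
suff main : forall (s : seq 'I_n) (P' : 'I_n -> R), uniq s ->
    \sum_(i <- s) 'X_i * P' i = 0 -> J (\sum_(i <- s) xi i * (P' i \mPo L)).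
  have := main (enum 'I_n) P (enum_uniq _); rewrite !big_enum /=.
  exact.
elim=> [|i0 s IHs] {P0}P' /=; first by rewrite !big_nil => _ _; apply: ideal0.
move=> /andP[i0s us]; rewrite !big_cons => sum0.
have [b bE] : exists b : 'I_n -> R, P' i0 = \sum_(i <- s) 'X_i * b i.
  apply: variables_decomposition => // u uP.
  apply: contrapT => nos.
  have := congr1 (mcoeff (U_(i0) + u)%MM) sum0.
  rewrite mcoeffD mcoeff0 ['X_i0 * _]mulrC mcoeffMX.
  rewrite (raddf_sum (mcoeff _)) big_seq big1 ?addr0 => [|i is_].
    by move/eqP; rewrite mcoeff_eq0 uP.
  apply/eqP; rewrite /= mcoeff_eq0; apply/negP => /msuppM_le/allpairsP.
  move=> [[u1 u2] /= [+ _ E]]; rewrite msuppX inE => /eqP u1E.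
  apply: nos; exists i => //; have /mnmP/(_ i) := E.
  rewrite u1E !mnmDE !mnm1E eqxx.
  by case: eqP => [i0i|_]; [rewrite i0i is_ in i0s|rewrite add0n => ->].
have bL : P' i0 \mPo L = \sum_(i <- s) tnth L i * (b i \mPo L).
  rewrite bE (raddf_sum (comp_mpoly L)); apply: eq_bigr => i _.
  by rewrite /= rmorphM /= comp_mpolyXU -tnth_nth.
have -> : xi i0 * (P' i0 \mPo L) + \sum_(j <- s) xi j * (P' j \mPo L) =
    \sum_(j <- s) (xi i0 * tnth L j - xi j * tnth L i0) * (b j \mPo L) +
    \sum_(j <- s) xi j * ((P' j + 'X_i0 * b j) \mPo L).
  rewrite bL mulr_sumr -!big_split /=; apply: eq_bigr => j _.
  by rewrite rmorphD rmorphM /= comp_mpolyXU -tnth_nth; ring.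
apply: (idealD idJ).
  by apply: (ideal_sum idJ) => j _; apply: (idealMr idJ).
apply: IHs => //; rewrite -[RHS]sum0 bE mulr_sumr -big_split /=.
by apply: eq_bigr => j _; ring.
Qed.

End KoszulPolynomial.

Section LinearSpan.
Variables (k : closedFieldType) (r : nat).

Lemma lin_span (T : finType) (c : T -> 'cV[k]_r.+1) :
  (forall v : 'rV_r.+1, v != 0 -> exists t, v *m c t != 0) ->
  forall l, exists a : T -> k, lin l = \sum_t a t *: lin (c t).
Proof.
move=> c0 l; pose M : 'M[k]_(r.+1, #|T|) := \matrix_(i, j) c (enum_val j) i 0.
have freeM : row_free M.
  rewrite -kermx_eq0; apply/eqP/row_matrixP => i; rewrite row0; apply/eqP.
  apply: contraT => /c0[t]; rewrite -row_mul.
  suff -> : kermx M *m c t = 0 by rewrite row0 eqxx.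
  have -> : c t = col (enum_rank t) M.
    by apply/colP => j; rewrite !mxE enum_rankK.
  by rewrite mulmx_col mulmx_ker; apply/colP => j; rewrite !mxE.
have /row_freeP[N MN] := freeM.
exists (fun t => (N *m l) (enum_rank t) 0).
rewrite -lin_sum; congr lin; rewrite -{1}[l]mul1mx -MN -mulmxA.
apply/colP => i; rewrite mxE summxE (reindex (@enum_rank T)) /=.
  by apply: eq_bigr => t _; rewrite [in RHS]mxE [M _ _]mxE enum_rankK mulrC.
exact/onW_bij/enum_rank_bij.
Qed.

Lemma X_lin (i : 'I_r.+1) : 'X_i = lin (delta_mx i 0 : 'cV[k]_r.+1).
Proof.
rewrite /lin (bigD1 i) //= big1 => [|j ji].
  by rewrite mxE !eqxx scale1r addr0.
by rewrite mxE (negPf ji) scale0r.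
Qed.

Lemma zero_homog_ideal : homog_ideal [set (0 : {mpoly k[r.+1]})].
Proof.
split; last by move=> d _ ->; apply: pihomog0.
by split=> // a _ _ -> ->; rewrite mulr0 addr0.
Qed.

End LinearSpan.

(** * Generation of the coordinate ring in degree two *)

Section DegreeTwo.
Variables (k : closedFieldType) (r m : nat) (a : 'I_m.+1 -> nat).
Notation S := {mpoly k[r.+1]}.
Variables (A : 'M[k]_(\sum_(i < m.+1) (a i).+1, r.+1)).
Variables (B : 'M[k]_(r.+1, \sum_(i < m.+1) (a i).+1)).
Hypotheses (AB : A *m B = 1%:M) (BA : B *m A = 1%:M).

Local Notation X := (scroll_image A).

(** A common zero of one member of the pencil lies on the scroll, where some [c t] is non-zero. So
    these forms have no common zero in P^r and span all linear forms. *)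
Lemma pencil_span (T : finType) (c : T -> 'cV[k]_r.+1) (al be : k) :
  (al, be) != (0, 0) -> (forall v, X v -> exists t, v *m c t != 0) ->
  forall l, exists (p : column_index a -> k) (q : T -> k),
    lin l = \sum_u p u *: (al *: lin (xcol B u) + be *: lin (ycol B u)) +
            \sum_t q t *: lin (c t).
Proof.
move=> albe0 cX l.
pose cc (s : column_index a + T) := match s with
  | inl u => al *: xcol B u + be *: ycol B u | inr t => c t end.
have [|b bE] := @lin_span k r _ cc _ l.
  move=> v v0; have [Xv|nXv] := pselect (X v).
    by have [t ct] := cX v Xv; exists (inr t).
  apply: contrapT => noc; apply: nXv.
  apply: (scroll_of_columns BA v0 albe0) => u; apply: contrapT => /eqP nu.
  by apply: noc; exists (inl u); rewrite /cc mulmxDr -!scalemxAr.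
exists (b \o inl), (b \o inr); rewrite bE big_sumType /=; congr (_ + _).
apply: eq_bigr => u _; rewrite lin_linear -[be *: ycol B u]addr0 lin_linear.
by rewrite (linear_0 (@lin_linear _ _)) addr0.
Qed.

(** By [pencil_span] the hypotheses of [koszul_pencil] hold already in degree 1: the member [(1, 1)]
    expresses the variables, the general member gives the condition on the pencil. *)
Lemma scroll_degree2 (T : finType) (c : T -> 'cV[k]_r.+1) :
  (forall v, X v -> exists t, v *m c t != 0) ->
  contains_degree (adjoin (vanishing_ideal X) (fun t => lin (c t))) 2.
Proof.
move=> cX; pose x u := lin (xcol B u); pose y u := lin (ycol B u).
pose l t := lin (c t).
have hI := vanishing_ideal_homog X.
have hz := @zero_homog_ideal k r.
have x1 u : x u \is 1.-homog by apply: lin_homog.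
have y1 u : y u \is 1.-homog by apply: lin_homog.
have l1 t : l t \is 1.-homog by apply: lin_homog.
have /choice[C CP] (i : 'I_r.+1) : exists C : (column_index a -> k) * (T -> k),
    'X_i = \sum_v C.1 v *: (x v + y v) + \sum_t C.2 t *: l t.
  have [|p [q E]] := @pencil_span T c 1 1 _ cX (delta_mx i 0).
    by rewrite xpair_eqE oner_eq0.
  exists (p, q); rewrite X_lin E /=; congr (_ + _); apply: eq_bigr => u _.
  by rewrite !scale1r.
suff K2 : contains_degree (adjoin (adjoin [set 0] l) (minor x y)) 2.
  move=> f /K2; apply: ideal_sub_adjoin; first exact: ideal_adjoin hI.1 _ _.
    apply: ideal_sub_adjoin; first exact: ideal_adjoin hI.1 _ _.
      by move=> _ ->; apply: ideal0 (ideal_adjoin hI.1 _).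
    by move=> t; apply: (adjoin_mem hI.1).
  move=> [u w]; apply: sub_adjoin; rewrite /minor /x /y /=.
  exact: scroll_minor AB _ _.
apply: (@koszul_pencil k r [set 0] _ _ x y l hz x1 y1 l1 0 'I_r.+1
  (fun i => 'X_i) (fun i => (C i).1) (fun i => (C i).2)) => //.
- move=> f /linP[c' ->]; exists (fun i => (c' i 0)%:MP).
  rewrite /lin -sumrB big1 // => i _.
  by rewrite mulrC mul_mpolyC subrr.
- move=> b _ b0 J xi idJ J0 xiJ.
  have := @koszul_mpoly k r r.+1 [tuple 'X_i | i < r.+1] b J xi b0 idJ.
  under eq_bigr do rewrite comp_mpoly_id.
  by apply=> i j; rewrite !tnth_mktuple.
move=> al be albe0.
have idK2 := (homog_adjoin_minors hz x1 y1 l1).1.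
have idK3 := ideal_adjoin idK2 (fun v => al *: x v + be *: y v).
apply: (contains_degreeS idK3) => f /linP[c' ->].
have [p [q ->]] := pencil_span albe0 cX c'.
apply: (idealD idK3); apply: (ideal_sum idK3) => u _; apply: (idealZ idK3).
  by apply: (adjoin_mem idK2 (fun v => al *: x v + be *: y v)).
apply/sub_adjoin/sub_adjoin; exact: (adjoin_mem hz.1 l).
Qed.

End DegreeTwo.

(** * Linear systems of parameters on a scroll *)

Lemma meval_scale (k : fieldType) n d (f : {mpoly k[n]}) (b : k) v :
  f \is d.-homog -> f.@[fun i => b * v i] = b ^+ d * f.@[v].
Proof.
move=> /dhomogP fd; rewrite !mevalE mulr_sumr big_seq [RHS]big_seq.
apply: eq_bigr => u /fd <-; rewrite mulrCA; congr (_ * _).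
under eq_bigr do rewrite exprMn; rewrite big_split /=; congr (_ * _).
by rewrite prodrXr mdegE.
Qed.

Section LinearParameters.
Variables (k : closedFieldType) (r m : nat) (a : 'I_m.+1 -> nat).
Notation S := {mpoly k[r.+1]}.
Variables (A : 'M[k]_(\sum_(i < m.+1) (a i).+1, r.+1)).
Variables (B : 'M[k]_(r.+1, \sum_(i < m.+1) (a i).+1)).
Hypotheses (AB : A *m B = 1%:M) (BA : B *m A = 1%:M).
Hypothesis sum_a : (\sum_i a i + m.+1 = r.+1)%N.
Hypothesis a_neq0 : exists i, a i != 0%N.

Local Notation X := (scroll_image A).
Local Notation D := (\sum_i a i)%N.
Local Notation N := (scroll_hilbert m D).
Local Notation I := (vanishing_ideal X).

Let hI : homog_ideal I := vanishing_ideal_homog X.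
Let D_gt0 : (0 < D)%N.
Proof. by have [i ai] := a_neq0; rewrite (bigD1 i) //= addn_gt0 lt0n ai. Qed.

Definition forms q (G : 'M[k]_(r.+1, q)) : q.-tuple S := [tuple lin (col j G) | j < q].

Definition no_zero q (G : 'M[k]_(r.+1, q)) : Prop := forall v, X v -> v *m G != 0.

Lemma forms_eval q (G : 'M_(r.+1, q)) f (v : 'rV[k]_r.+1) :
  (f \mPo forms G).@[v 0] = f.@[(v *m G) 0].
Proof.
rewrite comp_mpoly_meval; apply: meval_eq => j.
by rewrite tnth_mktuple lin_eval mulmx_col mxE.
Qed.

Lemma forms_homog q (G : 'M_(r.+1, q)) d f : f \is d.-homog ->
  f \mPo forms G \is d.-homog.
Proof.
move: d f; apply: homog_ind => [|d i f fd|d]; first by rewrite comp_mpoly1 dhomog1.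
  rewrite rmorphM /= comp_mpolyXU -tnth_nth tnth_mktuple.
  by apply: (@dhomogM _ _ _ 1) => //; apply: lin_homog.
split=> [|c u v ud vd]; first by rewrite comp_mpoly0 rpred0.
by rewrite comp_mpolyD comp_mpolyZ rpredD ?rpredZ.
Qed.

(** [N] is a polynomial of degree [m + 1] in [e], the binomial one of degree at least [m + 2]. For
    [e = D (m + 2)] the ratio of C(e + m + 2, m + 2) to C(e + m + 1, m + 1) is exactly [D + 1]. *)
Lemma hilbert_growth q : (m.+2 <= q)%N ->
  exists2 e, (0 < e)%N & (N e < 'C(e + q, e))%N.
Proof.
move=> ltmq; exists (D * m.+2)%N; first by rewrite muln_gt0 D_gt0.
set e := (D * m.+2)%N.
apply: (@leq_trans 'C(e + m.+2, e)); last first.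
  by rewrite -[X in 'C(X, e)]/(e + m.+2)%N; apply: leq_bin2l; rewrite leq_add2l.
have e0 : (0 < e)%N by rewrite muln_gt0 D_gt0.
have binE j : 'C(e + j, e) = 'C(e + j, j).
  by rewrite -[LHS]bin_sub ?leq_addr // addKn.
rewrite binE /scroll_hilbert binE.
have E1 : (m.+2 * 'C(e + m.+2, m.+2) = (e + m.+2) * 'C(e + m.+1, m.+1))%N.
  by rewrite addnS mul_bin_diag.
have E2 : ('C(e + m.+1, m.+1) = 'C(e + m, m.+1) + 'C(e + m, m))%N.
  by rewrite addnS binS.
have pos : (0 < 'C(e + m, m))%N by rewrite bin_gt0 leq_addl.
have -> : ('C(e + m.+2, m.+2) = D.+1 * 'C(e + m.+1, m.+1))%N.
  apply/eqP; rewrite -(eqn_pmul2l (ltn0Sn m.+1)) E1 mulnA; apply/eqP.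
  by congr (_ * _)%N; rewrite mulnS mulnC addnC.
rewrite E2 mulSn mulnDr; move: pos D_gt0.
move: ('C(_, m.+1)) ('C(_, m)) => x y y0 D0.
have := leq_pmulr D y0; clear sum_a; lia.
Qed.

(* If F is a relation between the forms on X and F p != 0, then the forms
   vanishing at p still have no common zero on X. *)
Lemma no_zero_reduce q (G : 'M[k]_(r.+1, q.+1)) : (m.+2 <= q)%N -> no_zero G ->
  exists q' (C : 'M_(q.+1, q')), (q' < q.+1)%N /\ no_zero (G *m C).
Proof.
move=> leq_q G0; have [e e0 ltNe] := hilbert_growth leq_q.
pose z (j : 'I_(size (mons q.+1 e))) : {mpoly k[q.+1]} :=
  'X_[nth 0%MM (mons q.+1 e) j].
have zd j : z j \is e.-homog by rewrite dhomogX -mem_mons mem_nth.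
have [c cI [j0 cj0]] : exists2 c : 'I_(size (mons q.+1 e)) -> k,
    I (\sum_j c j *: (z j \mPo forms G)) & exists j, c j != 0.
  apply: contrapT => noc.
  have : (#|'I_(size (mons q.+1 e))| <= N e)%N.
    apply: (@scroll_codim k r m a A e _ (fun j => z j \mPo forms G)) => [j|c cI j].
      exact: forms_homog (zd j).
    by apply: contrapT => /eqP cj; apply: noc; exists c => //; exists j.
  by rewrite card_ord size_mons leqNgt ltNe.
pose F := \sum_j c j *: z j.
have Fd : F \is e.-homog by apply: sum_homog.
have F0 : F != 0.
  apply: contra_neq cj0 => F0; have := congr1 (mcoeff (nth 0%MM (mons q.+1 e) j0)) F0.
  rewrite mcoeff0 raddf_sum (bigD1 j0) //= mcoeffZ mcoeffX eqxx mulr1 big1 ?addr0 //.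
  move=> j jj0; rewrite mcoeffZ mcoeffX nth_uniq ?uniq_mons //.
  by rewrite (inj_eq val_inj) (negPf jj0) mulr0.
have FX v : X v -> F.@[(v *m G) 0] = 0.
  rewrite -forms_eval; apply: (vanishing_idealP X (forms_homog G Fd)).1.
  by rewrite /F raddf_sum; under eq_bigr do rewrite /= comp_mpolyZ.
have [p0 Fp0] := mpoly_nonroot F0; pose p := \row_j p0 j.
have Fp : F.@[p 0] != 0 by rewrite (@meval_eq _ _ _ p0) // => i; rewrite mxE.
have p_neq0 : p != 0.
  apply: contraNneq Fp => p00; have -> : F.@[p 0] = F.@[fun i => 0 * p 0 i].
    by apply: meval_eq => i; rewrite p00 mxE mul0r.
  by rewrite (meval_scale _ _ Fd) expr0n eqn0Ngt e0 mul0r.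
(* The columns of this matrix span the linear forms vanishing at [p], so a common zero has
   [v *m G = b *: p]; then [F] forces [b = 0]. *)
exists (\rank (cokermx p)), (col_base (cokermx p)); split.
  by rewrite mxrank_coker rank_rV p_neq0 subn1.
move=> v Xv; apply/eqP; rewrite mulmxA => vC.
have : (v *m G <= p)%MS.
  by rewrite submxE -(mulmx_base (cokermx p)) mulmxA vC mul0mx.
case/sub_rVP => b vGE; have := FX v Xv.
have -> : F.@[(v *m G) 0] = F.@[fun i => b * p 0 i].
  by apply: meval_eq => i; rewrite vGE mxE.
rewrite (meval_scale _ _ Fd) => /eqP; rewrite mulf_eq0 (negPf Fp) orbF expf_eq0 e0 /=.
by move=> /eqP b0; have := G0 v Xv; rewrite vGE b0 scale0r eqxx.
Qed.

Lemma no_zero_parameters q (G : 'M[k]_(r.+1, q)) : no_zero G ->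
  exists q' (C : 'M_(q, q')),
    [/\ (q' <= m.+2)%N, \rank (G *m C) = q' & no_zero (G *m C)].
Proof.
elim/ltn_ind: q G => q IHq G G0.
have [leq_q|] := leqP q m.+2; last first.
  case: q => [//|q] in IHq G G0 *; rewrite ltnS => /no_zero_reduce/(_ G0).
  move=> [q1 [C1 [ltq1 G1]]]; have [q2 [C2 [leq2 rk2 G2]]] := IHq _ ltq1 _ G1.
  by exists q2, (C1 *m C2); rewrite mulmxA.
have [M MG] := row_freeP (row_base_free G).
exists (\rank G), M.
have -> : G *m M = col_base G.
  by have := congr1 (mulmx^~ M) (mulmx_base G); rewrite /= -mulmxA MG mulmx1.
split=> [||v Xv]; first exact: leq_trans (rank_leq_col _) leq_q.
  by apply/eqP; rewrite -/(row_full _) col_base_full.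
apply: contraNneq (G0 v Xv) => vG; apply/eqP.
by rewrite -(mulmx_base G) mulmxA vG mul0mx.
Qed.

(** * Koszul exactness for linear parameters, by counting normal forms *)

Section Koszul.
Variables (q : nat) (G : 'M[k]_(r.+1, q.+1)).
Hypotheses (G0 : no_zero G) (rkG : \rank G = q.+1) (leq_q : (q <= m.+1)%N).

Let L := forms G.

Lemma complement_forms : exists E : 'M[k]_(r.+1, r - q),
  forall c : 'cV_r.+1, exists (al : 'cV_q.+1) (be : 'cV_(r - q)), c = G *m al + E *m be.
Proof.
have rkC : \rank (G^T)^C%MS = (r - q)%N by rewrite mxrank_compl mxrank_tr rkG subSS.
rewrite -rkC; exists (row_base (G^T)^C%MS)^T => c.
have : (c^T <= G^T + row_base (G^T)^C)%MS.
  rewrite (adds_eqmx (eqmx_refl _) (eq_row_base _)).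
  exact/submx_full/addsmx_compl_full.
case/sub_addsmxP => [[u1 u2] /= cE]; exists u1^T, u2^T.
by apply: trmx_inj; rewrite linearD /= !trmx_mul !trmxK.
Qed.

Let L_gen d : contains_degree (adjoin I (fun j => lin (col j G))) d.+2.
Proof.
elim: d => [|d IHd]; last first.
  exact: (contains_degreeS (ideal_adjoin hI.1 _) IHd).
apply: (scroll_degree2 AB BA) => v /G0/eqP nG; apply: contrapT => noj; apply: nG.
apply/rowP => j; rewrite [RHS]mxE; apply: contrapT => /eqP vj; apply: noj; exists j.
by apply: contraNneq vj; rewrite mulmx_col => /colP/(_ 0); rewrite !mxE => ->.
Qed.

Variable E : 'M[k]_(r.+1, r - q).
Hypothesis EP : forall c : 'cV_r.+1,
  exists (al : 'cV_q.+1) (be : 'cV_(r - q)), c = G *m al + E *m be.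

Local Notation R := {mpoly k[q.+1]}.

(* Modulo I every form is a normal form, and by [parameters_count] there are as
   many normal monomials of degree 3 as the Hilbert function of X prescribes; so
   S / I has no relation in degree 3 over the polynomial ring in L. *)
Definition normal_form (P : R) (Q : 'I_(r - q) -> R) : S :=
  P \mPo L + \sum_j lin (col j E) * (Q j \mPo L).

Lemma normal_form_mul (PQ : 'I_q.+1 -> R * ('I_(r - q) -> R)) :
  normal_form (\sum_i 'X_i * (PQ i).1) (fun j => \sum_i 'X_i * (PQ i).2 j) =
  \sum_i lin (col i G) * normal_form (PQ i).1 (PQ i).2.
Proof.
under [RHS]eq_bigr do rewrite mulrDr mulr_sumr.
rewrite big_split exchange_big /=; congr (_ + _).
    rewrite raddf_sum; apply: eq_bigr => i _.
    by rewrite /= rmorphM /= comp_mpolyXU -tnth_nth tnth_mktuple.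
apply: eq_bigr => j _; rewrite raddf_sum mulr_sumr; apply: eq_bigr => i _.
  by rewrite /= rmorphM /= comp_mpolyXU -tnth_nth tnth_mktuple mulrCA.
Qed.

(** In degree 1 this is the choice of [E]. From degree 2 on every form is a combination of the
    parameters modulo [I], so no product of two forms from [E] occurs. *)
Lemma normal_form_exists d f : f \is d.+1.-homog -> exists P Q,
  [/\ P \is d.+1.-homog, forall j, Q j \is d.-homog & I (f - normal_form P Q)].
Proof.
have lin_mul p (M : 'M[k]_(r.+1, p)) (be : 'cV_p) :
    lin (M *m be) = \sum_j be j 0 *: lin (col j M).
  rewrite -lin_sum; congr lin; apply/colP => i; rewrite !mxE summxE.
  by apply: eq_bigr => j _; rewrite !mxE mulrC.
elim: d f => [|d IHd] f.
  move=> /linP[c ->]; have [al [be ->]] := EP c.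
  exists (\sum_j al j 0 *: 'X_j), (fun j => (be j 0)%:MP); split.
  - by apply: sum_homog => j; rewrite dhomogX /= mdeg1.
  - by move=> j; rewrite -[_%:MP]mulr1 mul_mpolyC rpredZ ?dhomog1.
  suff -> : lin (G *m al + E *m be) =
      normal_form (\sum_j al j 0 *: 'X_j) (fun j => (be j 0)%:MP).
    by rewrite subrr; apply: ideal0 hI.1.
  rewrite (linear_D (@lin_linear _ _)) !lin_mul; congr (_ + _).
    rewrite raddf_sum; apply: eq_bigr => j _.
    by rewrite /= comp_mpolyZ comp_mpolyXU -tnth_nth tnth_mktuple.
  by apply: eq_bigr => j _; rewrite comp_mpolyC mulrC mul_mpolyC.
move=> fd; have [b bd Ib] := @adjoin_dhomog _ _ _ hI _ _ 1 d.+1 f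
  (fun j => lin_homog (col j G)) fd (L_gen fd).
have /choice[PQ PQP] j : exists PQ : R * ('I_(r - q) -> R),
    [/\ PQ.1 \is d.+1.-homog, forall j, PQ.2 j \is d.-homog
    & I (b j - normal_form PQ.1 PQ.2)].
  by have [P [Q PQ]] := IHd _ (bd j); exists (P, Q).
exists (\sum_i 'X_i * (PQ i).1), (fun j => \sum_i 'X_i * (PQ i).2 j); split.
- apply: rpred_sum => i _; apply: (@dhomogM _ _ _ 1 _ d.+1).
    by rewrite dhomogX /= mdeg1.
  by case: (PQP i).
- move=> j; apply: rpred_sum => i _; apply: (@dhomogM _ _ _ 1 _ d).
    by rewrite dhomogX /= mdeg1.
  by case: (PQP i).
rewrite normal_form_mul.
apply: (ideal_trans hI.1 Ib); rewrite -sumrB; apply: (ideal_sum hI.1) => i _.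
by rewrite -mulrBr; apply: (idealMl hI.1); case: (PQP i).
Qed.

(** Indexes the normal monomials of degree [d.+1], not [d]. *)
Let T d : finType :=
  ('I_(size (mons q.+1 d.+1)) + 'I_(r - q) * 'I_(size (mons q.+1 d)))%type.

Let mon d (j : 'I_(size (mons q.+1 d))) : R := 'X_[nth 0%MM (mons q.+1 d) j].

Let good d (t : T d) : S := match t with
  | inl j => mon j \mPo L | inr (i, j) => lin (col i E) * (mon j \mPo L) end.

Let card_T d : #|T d| = ('C(d.+1 + q, d.+1) + (r - q) * 'C(d + q, d))%N.
Proof. by rewrite card_sum card_prod !card_ord !size_mons. Qed.

Let mon_homog d (j : 'I_(size (mons q.+1 d))) : mon j \is d.-homog.
Proof. by rewrite dhomogX -mem_mons mem_nth. Qed.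

Let good_homog d (t : T d) : good t \is d.+1.-homog.
Proof.
case: t => [j|[i j]] /=; first exact/forms_homog/mon_homog.
by apply: (@dhomogM _ _ _ 1 _ d); [exact: lin_homog|exact/forms_homog/mon_homog].
Qed.

Let mon_expand d (P : R) : P \is d.-homog ->
  P = \sum_(j < size (mons q.+1 d)) P@_(nth 0%MM (mons q.+1 d) j) *: mon j.
Proof.
move=> Pd; apply/mpolyP => u; rewrite (raddf_sum (mcoeff u)) /=.
under eq_bigr do rewrite mcoeffZ mcoeffX.
have [ud|ud] := boolP (u \in mons q.+1 d).
  have ltj : (index u (mons q.+1 d) < size (mons q.+1 d))%N by rewrite index_mem.
  rewrite (bigD1 (Ordinal ltj)) //= nth_index // eqxx mulr1 big1 ?addr0 // => j nj.
  case: eqP => [uE|_]; last by rewrite mulr0.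
  case/eqP: nj; apply/val_inj; rewrite /= -uE index_uniq ?uniq_mons //.
rewrite big1 => [|j _]; last first.
  by case: eqP => [uE|_]; [rewrite -uE mem_nth in ud|rewrite mulr0].
by apply: (dhomog_nemf_coeff Pd); rewrite -mem_mons.
Qed.

Let normal_form_good d P Q : P \is d.+1.-homog -> (forall j, Q j \is d.-homog) ->
  normal_form P Q = \sum_(t : T d) match t with
    | inl j => P@_(nth 0%MM (mons q.+1 d.+1) j)
    | inr (i, j) => (Q i)@_(nth 0%MM (mons q.+1 d) j) end *: good t.
Proof.
move=> Pd Qd; rewrite big_sumType /=; congr (_ + _).
  rewrite {1}(mon_expand Pd) raddf_sum; apply: eq_bigr => j _.
  by rewrite /= comp_mpolyZ.
transitivity (\sum_i \sum_(j < size (mons q.+1 d))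
    (Q i)@_(nth 0%MM (mons q.+1 d) j) *: (lin (col i E) * (mon j \mPo L))).
  apply: eq_bigr => i _; rewrite {1}(mon_expand (Qd i)) raddf_sum mulr_sumr.
  by apply: eq_bigr => j _; rewrite /= comp_mpolyZ -scalerAr.
by rewrite pair_big; apply: eq_bigr => -[i j] _.
Qed.

Let good_span d f : f \is d.+1.-homog -> exists c : T d -> k,
  I (f - \sum_t c t *: good t).
Proof.
move=> /normal_form_exists[P [Q [Pd Qd If]]].
by rewrite (normal_form_good Pd Qd) in If; eexists; exact: If.
Qed.

(** With fewer than [m + 2] parameters there would be too few normal monomials to span degree 2. *)
Lemma parameters_count : q = m.+1.
Proof.
apply/eqP; rewrite eqn_leq leq_q /= leqNgt; apply/negP => ltqm.
have : (N 2 <= #|predT : pred (T 1)|)%N.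
  apply: (@scroll_span k r m a A B AB 2 _ (@good 1)) => [t|f fd]; first exact: good_homog.
  by have [c Ic] := good_span fd; exists c.
rewrite card_T /scroll_hilbert binSn bin1.
have Dr : D = (r - m)%N by lia.
have bin2E x : ('C(2 + x, 2) * 2 = (x + 2) * (x + 1))%N.
  by have := mul_bin_diag (2 + x) 1; rewrite bin1 /=; lia.
have b1 := bin2E m; have b2 := bin2E q; rewrite Dr leqNgt => /negP; apply.
set x := 'C(2 + m, 2) in b1 *; set y := 'C(2 + q, 2) in b2 *.
by nia.
Qed.

Let normal_form_independent P Q : P \is 3.-homog ->
  (forall j, Q j \is 2.-homog) -> I (normal_form P Q) -> P = 0 /\ forall j, Q j = 0.
Proof.
move=> Pd Qd; rewrite (normal_form_good Pd Qd) => c0.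
have card3 : #|T 2| = N 3.
  have qm := parameters_count; have Dr : D = (r - m)%N by lia.
  rewrite card_T /scroll_hilbert Dr qm.
  have -> : 'C(3 + m, m.+1) = 'C(3 + m, 2).
    by rewrite -[RHS]bin_sub ?leq_addr //; congr 'C(_, _); lia.
  have -> : 'C(3 + m.+1, 3) = ('C(3 + m, 3) + 'C(3 + m, 2))%N by rewrite addnS binS.
  have -> : (2 + m.+1 = 3 + m)%N by lia.
  have -> : (r - m = (r - m.+1).+1)%N by lia.
  by rewrite mulSn addnA.
have := scroll_span_independent AB card3 (@good_homog 2) (@good_span 2) c0.
move=> {}c0; split=> [|j].
  rewrite (mon_expand Pd) big1 // => i _.
  by have := c0 (inl i) => /= ->; rewrite scale0r.
rewrite (mon_expand (Qd j)) big1 // => i _.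
by have := c0 (inr (j, i)) => /= ->; rewrite scale0r.
Qed.

(** With the coefficients in normal form the relation is a normal form of degree 3, hence zero
    coefficient by coefficient. Each component is then a relation between variables, to which
    [koszul_mpoly] applies. *)
Lemma parameters_koszul : koszul_exact I (fun j => lin (col j G)) 2.
Proof.
move=> c cd Ic J xi idJ IJ xiJ.
have /choice[PQ PQP] j : exists PQ : R * ('I_(r - q) -> R),
    [/\ PQ.1 \is 2.-homog, forall i, PQ.2 i \is 1.-homog
    & I (c j - normal_form PQ.1 PQ.2)].
  by have [P [Q PQ]] := normal_form_exists (cd j); exists (P, Q).
have X1 (i : 'I_q.+1) : ('X_i : R) \is 1.-homog by rewrite dhomogX /= mdeg1.
have [|||P0 Q0] := @normal_form_independent
    (\sum_i 'X_i * (PQ i).1) (fun j => \sum_i 'X_i * (PQ i).2 j).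
- by apply: rpred_sum => i _; apply: (dhomogM (X1 i)); case: (PQP i).
- by move=> j; apply: rpred_sum => i _; apply: (dhomogM (X1 i)); case: (PQP i).
- rewrite normal_form_mul -[X in I X](subKr (\sum_i lin (col i G) * c i)).
  apply: (idealB hI.1) => //; rewrite -sumrB; apply: (ideal_sum hI.1) => i _.
  by rewrite -mulrBr; apply: (idealMl hI.1); case: (PQP i).
have xiL i j : J (xi i * tnth L j - xi j * tnth L i).
  by rewrite !tnth_mktuple; apply: xiJ.
have -> : \sum_i xi i * c i =
    \sum_i xi i * (c i - normal_form (PQ i).1 (PQ i).2) +
    (\sum_i xi i * ((PQ i).1 \mPo L) +
     \sum_j lin (col j E) * \sum_i xi i * ((PQ i).2 j \mPo L)).
  under [X in _ = _ + (_ + X)]eq_bigr do rewrite mulr_sumr.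
  rewrite exchange_big -!big_split; apply: eq_bigr => i _ /=.
  rewrite /normal_form; under [X in _ = _ + (_ + X)]eq_bigr do rewrite mulrCA.
  by rewrite -mulr_sumr; ring.
apply: (idealD idJ).
  by apply: (ideal_sum idJ) => i _; apply/(idealMl idJ)/IJ; case: (PQP i).
apply: (idealD idJ); first exact: koszul_mpoly P0 idJ xiL.
apply: (ideal_sum idJ) => j _; apply: (idealMl idJ).
exact: koszul_mpoly (Q0 j) idJ xiL.
Qed.

End Koszul.
End LinearParameters.

(** * Sections of the intersection of two scrolls *)

Section TwoScrolls.
Variables (k : closedFieldType) (r m n : nat).
Variables (a : 'I_m.+1 -> nat) (b : 'I_n.+1 -> nat).
Notation S := {mpoly k[r.+1]}.
Variables (A : 'M[k]_(\sum_(i < m.+1) (a i).+1, r.+1)).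
Variables (A' : 'M[k]_(r.+1, \sum_(i < m.+1) (a i).+1)).
Hypotheses (AA' : A *m A' = 1%:M) (A'A : A' *m A = 1%:M).
Hypothesis sum_a : (\sum_i a i + m.+1 = r.+1)%N.
Hypothesis a_neq0 : exists i, a i != 0%N.
Variables (B : 'M[k]_(\sum_(i < n.+1) (b i).+1, r.+1)).
Variables (B' : 'M[k]_(r.+1, \sum_(i < n.+1) (b i).+1)).
Hypotheses (BB' : B *m B' = 1%:M) (B'B : B' *m B = 1%:M).

Local Notation X := (scroll_image A).
Local Notation Y := (scroll_image B).
Local Notation IX := (vanishing_ideal X).
Local Notation IY := (vanishing_ideal Y).
Local Notation V := (column_index b).

Variable h : 'cV[k]_r.+1.
Hypothesis h_neq0 : forall v, X v -> Y v -> v *m h != 0.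

Let x (u : V) : S := lin (xcol B' u).
Let y (u : V) : S := lin (ycol B' u).
Let l (_ : 'I_1) : S := lin h.

Let cc (al be : k) (s : V + 'I_1) : 'cV[k]_r.+1 := match s with
  | inl u => al *: xcol B' u + be *: ycol B' u | inr _ => h end.

(** A zero on [X] of a member of the pencil of columns of [Y] lies on [Y], and there [h] does not
    vanish. *)
Let cc_no_zero al be v : (al, be) != (0, 0) -> X v -> exists s, v *m cc al be s != 0.
Proof.
move=> albe0 Xv; apply: contrapT => nos.
have ncc s : v *m cc al be s = 0 by apply: contrapT => /eqP ns; apply: nos; exists s.
suff /(h_neq0 Xv) : Y v by rewrite (ncc (inr ord0)) eqxx.
apply: (scroll_of_columns B'B (scroll_neq0 AA' Xv) albe0) => u.
by have := ncc (inl u); rewrite /cc mulmxDr -!scalemxAr.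
Qed.

Lemma scroll_section_degree3 :
  contains_degree (adjoin (adjoin IX (fun _ : 'I_1 => lin h))
    (minor (fun u => lin (xcol B' u)) (fun u => lin (ycol B' u)))) 3.
Proof.
rewrite -/x -/y -/l.
have hIX := vanishing_ideal_homog X.
have x1 u : x u \is 1.-homog by apply: lin_homog.
have y1 u : y u \is 1.-homog by apply: lin_homog.
have l1 t : l t \is 1.-homog by apply: lin_homog.
have k11 : ((1 : k), (1 : k)) != (0, 0) by rewrite xpair_eqE oner_eq0.
pose G0 : 'M[k]_(r.+1, #|{: V + 'I_1}|) := \matrix_(i, j) cc 1 1 (enum_val j) i 0.
have ccE s : cc 1 1 s = col (enum_rank s) G0.
  by apply/colP => i; rewrite !mxE enum_rankK.
have G0nz : no_zero A G0.
  move=> v Xv; have [s] := cc_no_zero k11 Xv.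
  by apply: contra_neq; rewrite ccE mulmx_col => ->; apply/colP => i; rewrite !mxE.
(* Koszul exactness is available for independent parameters, so these are chosen among the
   combinations of the [x u + y u] and [h]. *)
have [q [C [leq_q rkG Gnz]]] := no_zero_parameters a_neq0 G0nz.
case: q => [|q] in C leq_q rkG Gnz *.
  (* Only a point of [X] is wanted: with no parameters at all it would be a common zero. *)
  have [v Xv _] := linear_form_zero A a_neq0 h.
  by case/eqP: (Gnz v Xv); apply/rowP => -[].
have [E EP] := complement_forms rkG.
have kos := parameters_koszul AA' A'A sum_a a_neq0 Gnz rkG leq_q EP.
have CE j : lin (col j (G0 *m C)) =
    \sum_(u : V) C (enum_rank (inl u)) j *: (x u + y u) +
    \sum_(t < 1) C (enum_rank (inr t)) j *: l t.
  transitivity (\sum_(s : V + 'I_1) C (enum_rank s) j *: lin (cc 1 1 s)).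
    rewrite -lin_sum; congr lin; apply/colP => i; rewrite [LHS]mxE mxE summxE.
    rewrite (reindex (@enum_rank (V + 'I_1)%type)) /=; last exact/onW_bij/enum_rank_bij.
    by apply: eq_bigr => s _; rewrite [RHS]mxE ccE [col _ _ _ _]mxE mulrC.
  rewrite big_sumType /=; congr (_ + _); apply: eq_bigr => u _.
  by rewrite !scale1r (linear_D (@lin_linear _ _)).
apply: (koszul_pencil hIX x1 y1 l1 CE _ kos).
  apply: (scroll_degree2 AA' A'A) => v Xv; apply: contrapT => noj.
  have := Gnz v Xv; case/eqP; apply/rowP => j; rewrite [RHS]mxE.
  apply: contrapT => /eqP vj; apply: noj; exists j; apply: contraNneq vj.
  by rewrite mulmx_col => /colP/(_ 0); rewrite !mxE => ->.
move=> al be albe0.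
have hK2 := homog_adjoin_minors hIX x1 y1 l1.
have idK3 := ideal_adjoin hK2.1 (fun v => al *: x v + be *: y v).
apply: (contains_degreeS idK3) => f.
move/(scroll_degree2 AA' A'A (fun v => @cc_no_zero al be v albe0)).
apply: ideal_sub_adjoin => //.
  by move=> g Ig; do 3 apply: sub_adjoin.
move=> [u|t] /=.
  have -> : lin (al *: xcol B' u + be *: ycol B' u) = al *: x u + be *: y u.
    by rewrite (linear_D (@lin_linear _ _)) !(linear_Z (@lin_linear _ _)).
  exact: (adjoin_mem hK2.1 (fun v => al *: x v + be *: y v)).
by apply/sub_adjoin/sub_adjoin; apply: (adjoin_mem hIX.1 l).
Qed.

End TwoScrolls.

(** * Minors restricted to a scroll of the same dimension *)

Section IndependentMinors.
Variables (k : closedFieldType) (r m n : nat).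
Variables (a : 'I_m.+1 -> nat) (b : 'I_n.+1 -> nat).
Notation S := {mpoly k[r.+1]}.
Variables (A : 'M[k]_(\sum_(i < m.+1) (a i).+1, r.+1)).
Variables (A' : 'M[k]_(r.+1, \sum_(i < m.+1) (a i).+1)).
Hypotheses (AA' : A *m A' = 1%:M).
Variables (B : 'M[k]_(\sum_(i < n.+1) (b i).+1, r.+1)).
Variables (B' : 'M[k]_(r.+1, \sum_(i < n.+1) (b i).+1)).
Hypotheses (BB' : B *m B' = 1%:M) (B'B : B' *m B = 1%:M).

Local Notation X := (scroll_image A).
Local Notation Y := (scroll_image B).
Local Notation IX := (vanishing_ideal X).
Local Notation IY := (vanishing_ideal Y).
Local Notation V := (column_index b).
Local Notation q := #|{: V}|.

Hypothesis ndX : nondegenerate_in_Pr X.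

Let xl (p : 'rV[k]_q) : S := lin (\sum_j p 0 j *: xcol B' (enum_val j)).
Let yl (p : 'rV[k]_q) : S := lin (\sum_j p 0 j *: ycol B' (enum_val j)).
Let x (u : V) : S := lin (xcol B' u).
Let y (u : V) : S := lin (ycol B' u).

Let xlE p : xl p = \sum_j p 0 j *: x (enum_val j). Proof. exact: lin_sum. Qed.
Let ylE p : yl p = \sum_j p 0 j *: y (enum_val j). Proof. exact: lin_sum. Qed.

Let xl_homog p : xl p \is 1.-homog. Proof. exact: lin_homog. Qed.
Let yl_homog p : yl p \is 1.-homog. Proof. exact: lin_homog. Qed.
Let x_homog u : x u \is 1.-homog. Proof. exact: lin_homog. Qed.
Let y_homog u : y u \is 1.-homog. Proof. exact: lin_homog. Qed.

Let homog11 (f g f' g' : S) : f \is 1.-homog -> g \is 1.-homog ->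
  f' \is 1.-homog -> g' \is 1.-homog -> f * g - f' * g' \is 2.-homog.
Proof.
by move=> *; apply: rpredB; apply: (@dhomogM _ _ _ 1 _ 1).
Qed.

Let thetaM f g : theta A (f * g) = theta A f * theta A g.
Proof. exact: rmorphM. Qed.

Let thetaB f g : theta A (f - g) = theta A f - theta A g.
Proof. exact: raddfB. Qed.

Let xl_linear : linear xl.
Proof.
move=> c p p'; rewrite !xlE scaler_sumr -big_split; apply: eq_bigr => j _ /=.
by rewrite !mxE scalerDl scalerA.
Qed.

Let yl_linear : linear yl.
Proof.
move=> c p p'; rewrite !ylE scaler_sumr -big_split; apply: eq_bigr => j _ /=.
by rewrite !mxE scalerDl scalerA.
Qed.

Let minor_IY p p' : IY (xl p * yl p' - xl p' * yl p).
Proof.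
have hIY := vanishing_ideal_homog Y.
have -> : xl p * yl p' - xl p' * yl p = \sum_i \sum_j (p 0 i * p' 0 j) *:
    (x (enum_val i) * y (enum_val j) - x (enum_val j) * y (enum_val i)).
  rewrite !xlE !ylE [_ * \sum_j p 0 j *: _]mulrC.
  rewrite !mulr_suml -sumrB; apply: eq_bigr => i _.
  rewrite !mulr_sumr -sumrB; apply: eq_bigr => j _.
  by rewrite -!mul_mpolyC mpolyCM; ring.
apply: (ideal_sum hIY.1) => i _; apply: (ideal_sum hIY.1) => j _.
exact/(idealZ hIY.1)/(scroll_minor BB').
Qed.

(** Nondegeneracy of [X] enters here: a linear form vanishing on [X] is zero, and the [xcol] are
    linearly independent. *)
Let xl_theta0 p : theta A (xl p) = 0 -> p = 0.
Proof.
move/(theta_vanish A (xl_homog p))/(vanishing_idealP X (xl_homog p)) => xX.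
have c0 : \sum_j p 0 j *: xcol B' (enum_val j) = 0.
  apply: contrapT => /eqP/ndX[v Xv]; have := xX v Xv.
  rewrite /xl lin_eval => E; case/eqP; apply/matrixP => i j.
  by rewrite !ord1 E mxE.
have c1 : \sum_u p 0 (enum_rank u) *: xcol B' u = 0.
  rewrite -[RHS]c0 [RHS](reindex (@enum_rank V)) /=; last exact/onW_bij/enum_rank_bij.
  by apply: eq_bigr => u _; rewrite enum_rankK.
apply/rowP => j; rewrite mxE -[j]enum_valK.
exact: (xcol_free BB' c1).
Qed.

Let xl_delta u : xl (delta_mx 0 (enum_rank u)) = x u.
Proof.
rewrite xlE (bigD1 (enum_rank u)) //= mxE !eqxx scale1r enum_rankK.
by rewrite big1 ?addr0 // => j /negPf nj; rewrite mxE nj andbF scale0r.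
Qed.

Let yl_delta u : yl (delta_mx 0 (enum_rank u)) = y u.
Proof.
rewrite ylE (bigD1 (enum_rank u)) //= mxE !eqxx scale1r enum_rankK.
by rewrite big1 ?addr0 // => j /negPf nj; rewrite mxE nj andbF scale0r.
Qed.

Section Base.
Variable v0 : V.

Let phi p := xl p * y v0 - yl p * x v0.

Let phi_homog p : phi p \is 2.-homog. Proof. exact: homog11. Qed.

Let phi_linear : linear phi.
Proof.
by move=> c p p'; rewrite /phi xl_linear yl_linear -!mul_mpolyC; ring.
Qed.

Let mons2 := scroll_mon a 2.

Let Phi : 'M[k]_(q, size mons2) := \matrix_(i, j)
  (theta A (phi (delta_mx 0 i)))@_(nth 0%MM mons2 j).

Let PhiP (p : 'rV[k]_q) : p *m Phi = 0 <-> theta A (phi p) = 0.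
Proof.
have E j : (p *m Phi) 0 j = (theta A (phi p))@_(nth 0%MM mons2 j).
  rewrite [in RHS](row_sum_delta p) (linear_sumZ phi_linear) theta_sum.
  rewrite (raddf_sum (mcoeff _)) mxE; apply: eq_bigr => i _.
  by rewrite /= mcoeffZ mxE.
split=> [p0|p0]; last by apply/rowP => j; rewrite E p0 mcoeff0 mxE.
apply/mpolyP => mu; rewrite mcoeff0; have [mus|] := boolP (mu \in mons2).
  have ltj : (index mu mons2 < size mons2)%N by rewrite index_mem.
  by have := E (Ordinal ltj); rewrite p0 mxE nth_index // => <-.
apply: contraNeq; rewrite -mcoeff_msupp.
exact: (theta_support (phi_homog p)).
Qed.

Let x0_neq0 : theta A (x v0) != 0.
Proof.
rewrite -xl_delta; apply/eqP => /xl_theta0/rowP/(_ (enum_rank v0))/eqP.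
by rewrite !mxE !eqxx oner_eq0.
Qed.

Let KPhi := kermx Phi.

(* With U the kernel of phi, x v0 times the space of minors contains the product
   of xl U and the image of phi, whose dimensions add up to q. *)
Let kernel_product p p' : (p <= KPhi)%MS ->
  theta A (x v0) * theta A (xl p * yl p' - xl p' * yl p) =
  - (theta A (xl p) * theta A (phi p')).
Proof.
move=> /sub_kermxP/PhiP phi0.
rewrite -!thetaM.
have -> : x v0 * (xl p * yl p' - xl p' * yl p) =
   xl p' * phi p - xl p * phi p' by rewrite /phi; ring.
by rewrite thetaB !thetaM phi0 mulr0 sub0r.
Qed.

(** If the minors with column [v0] vanish on [X], so do all others by [kernel_product], as [x v0]
    does not vanish identically. A column [w] with non-zero first entry at a point then gives the
    member [(y w, - x w)] of the pencil that vanishes there. *)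
Lemma minors_all_vanish : (Phi = 0) -> X `<=` Y.
Proof.
move=> Phi0 v Xv.
have minX u w : IX (x u * y w - x w * y u).
  have phi0 p : theta A (phi p) = 0 by apply/PhiP; rewrite Phi0 mulmx0.
  apply/(theta_vanish A (homog11 (x_homog u) (y_homog w) (x_homog w) (y_homog u))).
  apply: (mulfI x0_neq0); rewrite mulr0 -!xl_delta -!yl_delta xl_delta.
  rewrite kernel_product ?phi0 ?mulr0 ?oppr0 //.
  by apply/sub_kermxP; rewrite Phi0 mulmx0.
have minv u w : (x u).@[v 0] * (y w).@[v 0] - (x w).@[v 0] * (y u).@[v 0] = 0.
  have := (vanishing_idealP X
    (homog11 (x_homog u) (y_homog w) (x_homog w) (y_homog u))).1 (minX u w) v Xv.
  by rewrite mevalB !mevalM.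
have ev (c : 'cV_r.+1) : v *m c = ((lin c).@[v 0])%:M.
  by apply/matrixP => i j; rewrite !ord1 lin_eval [RHS]mxE.
have [allz|/existsNP[w nw]] := pselect (forall w, (x w).@[v 0] = 0).
  apply: (scroll_of_columns B'B (scroll_neq0 AA' Xv) (al := 1) (be := 0)).
    by rewrite xpair_eqE oner_eq0.
  move=> u; rewrite scale0r addr0 scale1r ev -/(x u) allz.
  by apply/matrixP => i j; rewrite !mxE mul0rn.
apply: (scroll_of_columns B'B (scroll_neq0 AA' Xv)
  (al := (y w).@[v 0]) (be := - (x w).@[v 0])).
  by rewrite xpair_eqE negb_and oppr_eq0 orbC; move/eqP: nw => ->.
move=> u; rewrite !ev -/(x u) -/(y u); apply/matrixP => i j; rewrite !mxE.
have := minv u w; rewrite !ord1 eqxx !mulr1n => E.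
by rewrite -[RHS]E; ring.
Qed.

Lemma independent_minors : Phi != 0 -> exists w : 'I_q.-1 -> S,
  [/\ forall i, w i \is 2.-homog, forall i, IY (w i) & independent_mod IX w].
Proof.
move=> Phi0.
pose P := row_base KPhi; pose P' := row_base (KPhi^C)%MS.
have indA : independent (fun i => theta A (xl (row i P))).
  move=> c c0; have := row_free_inj (row_base_free KPhi).
  pose u := \row_i c i.
  have uP : u *m P = 0.
    apply: xl_theta0; rewrite mulmx_sum_row (linear_sumZ xl_linear) theta_sum.
    by rewrite -[RHS]c0; apply: eq_bigr => i _; rewrite mxE.
  move/(_ _ u 0); rewrite -/P uP mul0mx => /(_ erefl)/rowP u0 i.
  by have := u0 i; rewrite !mxE.
have indB : independent (fun i => theta A (phi (row i P'))).
  move=> c c0; have := row_free_inj (row_base_free (KPhi^C)%MS).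
  pose u := \row_i c i.
  have uK : (u *m P' <= KPhi)%MS.
    apply/sub_kermxP/PhiP; rewrite mulmx_sum_row (linear_sumZ phi_linear) theta_sum.
    by rewrite -[RHS]c0; apply: eq_bigr => i _; rewrite mxE.
  have uC : (u *m P' <= KPhi^C)%MS.
    by rewrite (submx_trans (submxMl _ _)) // eq_row_base.
  have uP : u *m P' = 0.
    by apply/eqP; rewrite -submx0 -(capmx_compl KPhi) sub_capmx uK uC.
  move/(_ _ u 0); rewrite -/P' uP mul0mx => /(_ erefl)/rowP u0 i.
  by have := u0 i; rewrite !mxE.
have rkK : (\rank KPhi + \rank (KPhi^C)%MS = q)%N.
  by rewrite mxrank_compl subnKC // rank_leq_row.
(* The minor of column [v0] with itself is zero. *)
have K_gt0 : (0 < \rank KPhi)%N.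
  rewrite lt0n mxrank_eq0; apply/eqP => K0.
  have : ((delta_mx 0 (enum_rank v0) : 'rV[k]_q) <= KPhi)%MS.
    apply/sub_kermxP/PhiP.
    by rewrite /phi xl_delta yl_delta mulrC subrr /theta comp_mpoly0.
  rewrite K0 submx0 => /eqP/rowP/(_ (enum_rank v0))/eqP.
  by rewrite !mxE !eqxx oner_eq0.
have C_gt0 : (0 < \rank (KPhi^C)%MS)%N.
  rewrite lt0n mxrank_compl subn_eq0 -ltnNge ltn_neqAle rank_leq_row andbT.
  apply: contra Phi0 => /eqP/esym rk; rewrite -mxrank_eq0.
  by move: rk; rewrite mxrank_ker => /eqP; have := rank_leq_row Phi; lia.
have PK i : (row i P <= KPhi)%MS by rewrite (submx_trans (row_sub _ _)) // eq_row_base.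
move: P P' indA indB PK => P P' indA indB PK.
move: P P' PK indA indB; move: (\rank KPhi) (\rank (KPhi^C)%MS) rkK K_gt0 C_gt0.
case=> // al [] // be rkK _ _ P P' PK indA indB.
have [C [C0 Clt]] := echelon indA; have [C' [C'0 C'lt]] := echelon indB.
(* The two spaces have dimensions [al + 1] and [be + 1] with sum [q], and the staircase has
   [al + be + 1] products; this is the origin of [D - 1]. *)
have qE : q.-1 = (al + be).+1 by rewrite -rkK addSn /= addnS.
rewrite qE.
pose p i := \sum_j C i j *: row j P; pose p' i := \sum_j C' i j *: row j P'.
have pE i : theta A (xl (p i)) = \sum_j C i j *: theta A (xl (row j P)).
  by rewrite /p (linear_sumZ xl_linear) theta_sum.
have p'E i : theta A (phi (p' i)) = \sum_j C' i j *: theta A (phi (row j P')).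
  by rewrite /p' (linear_sumZ phi_linear) theta_sum.
have pK i : (p i <= KPhi)%MS.
  by apply: summx_sub => j _; apply: scalemx_sub.
pose AA i := theta A (xl (p i)); pose BB i := theta A (phi (p' i)).
have stair : independent (fun s : 'I_(al + be).+1 =>
    AA (inord (s - be)) * BB (inord (minn s be))).
  by apply: staircase_independent => [i|i|i j|i j]; rewrite /AA /BB ?pE ?p'E //;
    [exact: Clt|exact: C'lt].
exists (fun s : 'I_(al + be).+1 =>
   let i := inord (s - be) in let j := inord (minn s be) in
   xl (p i) * yl (p' j) - xl (p' j) * yl (p i)); split=> [s|s|c c0] /=.
- exact: homog11.
- exact: minor_IY.
have hom : \sum_s c s *: (xl (p (inord (s - be))) * yl (p' (inord (minn s be))) -
    xl (p' (inord (minn s be))) * yl (p (inord (s - be)))) \is 2.-homog.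
  by apply: sum_homog => s; apply: homog11.
move/(theta_vanish A hom): c0; rewrite theta_sum => c0.
apply: stair; apply: (mulfI (x := -1)); first by rewrite oppr_eq0 oner_eq0.
(* Multiplied by [theta A (x v0)], a relation between the minors becomes, up to sign, one between
   the staircase products. *)
have c0' := congr1 ( *%R (theta A (x v0))) c0; rewrite mulr0 in c0'.
rewrite mulr0 -[RHS]c0' !mulr_sumr; apply: eq_bigr => s _.
by rewrite -!scalerAr kernel_product // mulN1r.
Qed.

End Base.

Lemma minors_independent_or_sub : (0 < \sum_i b i)%N -> X `<=` Y \/
  exists w : 'I_(\sum_i b i).-1 -> S,
  [/\ forall i, w i \is 2.-homog, forall i, IY (w i) & independent_mod IX w].
Proof.
rewrite -card_column_index => /card_gt0P[v0 _].
have [Phi0|Phi0] := eqVneq (\matrix_(i < q, j < size (scroll_mon a 2))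
  (theta A (xl (delta_mx 0 i) * y v0 - yl (delta_mx 0 i) * x v0))@_(nth 0%MM (scroll_mon a 2) j)) 0.
  by left; apply: (@minors_all_vanish v0).
by right; apply: (@independent_minors v0).
Qed.

End IndependentMinors.

(** * The bound *)

Section Intersection.
Variables (k : closedFieldType) (r : nat).
Notation S := {mpoly k[r.+1]}.
Variables (X Y : set 'rV[k]_r.+1).

Lemma homog_intersection_ideal : homog_ideal (intersection_ideal X Y).
Proof.
have hX := vanishing_ideal_homog X; have hY := vanishing_ideal_homog Y.
split; first split.
- by exists 0; [exact: ideal0 hX.1|exists 0; [exact: ideal0 hY.1|rewrite addr0]].
- move=> c _ _ [f Xf [g Yg <-]] [f' Xf' [g' Yg' <-]].
  exists (c * f + f'); first exact: hX.1.2.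
  by exists (c * g + g'); [exact: hY.1.2|rewrite mulrDr addrACA].
move=> d _ [f Xf [g Yg <-]]; exists (pihomog mdeg d f); first exact: hX.2.
by exists (pihomog mdeg d g); [exact: hY.2|rewrite pihomogD].
Qed.

Lemma sub_intersection_l : vanishing_ideal X `<=` intersection_ideal X Y.
Proof.
move=> f Xf; exists f => //; exists 0; last by rewrite addr0.
exact: ideal0 (vanishing_ideal_homog Y).1.
Qed.

Lemma sub_intersection_r : vanishing_ideal Y `<=` intersection_ideal X Y.
Proof.
move=> g Yg; exists 0; last by exists g => //; rewrite add0r.
exact: ideal0 (vanishing_ideal_homog X).1.
Qed.

Lemma vanishing_ideal_eval (Z : set 'rV[k]_r.+1) f v :
  vanishing_ideal Z f -> Z v -> f.@[v 0] = 0.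
Proof.
move=> Zf Zv; rewrite (pihomog_partitionE (leqnn (msize f))).
by rewrite (raddf_sum (meval (v 0))) big1 // => d _; apply: Zf.
Qed.

(** A power of each ['X_i] lies in the intersection ideal plus [(h)]; evaluated at a common point
    with [h = 0] it gives [v 0 i = 0]. *)
Lemma section_misses_intersection (h : 'cV[k]_r.+1) v :
  finite_section (intersection_ideal X Y) (lin h) -> X v -> Y v -> v != 0 ->
  v *m h != 0.
Proof.
move=> [d Id] Xv Yv; apply: contra_neq => vh0; apply/rowP => i; rewrite mxE.
have /Id/adjoin1P[b [f Xf [g Yg E]]] : ('X_i ^+ d : S) \is d.-homog.
  by rewrite -[d in d.-homog]mul1n; apply: dhomogMn; rewrite dhomogX /= mdeg1.
have := congr1 (meval (v 0)) E.
rewrite mevalD (vanishing_ideal_eval Xf Xv) (vanishing_ideal_eval Yg Yv) addr0.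
rewrite mevalB mevalM lin_eval vh0 mxE mul0r subr0 rmorphXn /= mevalXU.
by move/esym/eqP; rewrite expf_eq0 => /andP[_ /eqP].
Qed.

End Intersection.

Lemma scroll_inverse (k : fieldType) p q (A : 'M[k]_(p, q)) :
  row_free A -> row_full A -> exists B, A *m B = 1%:M /\ B *m A = 1%:M.
Proof.
move=> /row_freeP[B AB] /row_fullP[C CA]; exists B; split=> //.
by rewrite -[B]mul1mx -CA -[C *m A *m B]mulmxA AB mulmx1 CA.
Qed.

Lemma codim_le_sub (k : fieldType) n (K K' : set {mpoly k[n]}) d N :
  K `<=` K' -> codim_le K d N -> codim_le K' d N.
Proof. by move=> KK' cK T z zd indz; apply: (cK T z zd) => c /KK'/indz. Qed.

(** A family independent modulo [K'], joined with [w], is independent modulo [K]. *)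
Lemma codim_le_independent (k : fieldType) n (K K' : set {mpoly k[n]}) d N c
    (w : 'I_c -> {mpoly k[n]}) :
  ideal K' -> K `<=` K' -> (forall i, w i \is d.-homog) -> (forall i, K' (w i)) ->
  independent_mod K w -> codim_le K d N -> codim_le K' d (N - c).
Proof.
move=> idK' KK' wd K'w indw cK T z zd indz.
pose zw s := match s with inl t => z t | inr i => w i end.
have : (#|{: T + 'I_c}| <= N)%N; last by rewrite card_sum card_ord; lia.
apply: (cK _ zw) => [[t|i]|e] //=.
rewrite big_sumType /= => Ke.
have et t : e (inl t) = 0.
  apply: (indz (e \o inl)) => /=.
  rewrite -[X in K' X](addrK (\sum_i e (inr i) *: w i)).
  apply: (idealB idK'); first exact: KK'.
  by apply: (ideal_sum idK') => i _; apply: (idealZ idK').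
have ei i : e (inr i) = 0.
  apply: (indw (e \o inr)) => /=; move: Ke.
  by rewrite big1 ?add0r // => t _; rewrite et scale0r.
by case.
Qed.

Lemma scroll_hilbert2 m D : (2 * scroll_hilbert m D 2 =
  (m + 2) * (m + 1) + 2 * (D * (m + 2)))%N.
Proof.
rewrite /scroll_hilbert binSn mulnDr; congr (_ + _)%N; last by lia.
by have := mul_bin_diag (2 + m) 1; rewrite bin1 /=; lia.
Qed.

Theorem proposition4p7 (k : closedFieldType) (r m n : nat)
    (X Gamma : set 'rV[k]_r.+1)
    (hX : rational_normal_scroll m X)
    (hGamma : rational_normal_scroll n Gamma)
    (ndX : nondegenerate_in_Pr X) (ndGamma : nondegenerate_in_Pr Gamma)
    (le_mn : (m <= n)%N)
    (dim0 : zero_dimensional (intersection_ideal X Gamma)) :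
  exists2 l : nat, has_length (intersection_ideal X Gamma) l
    & l%:Z <= n%:Z * r%:Z + m%:Z - ('C(n, 2))%:Z + 1.
Proof.
have hI := homog_intersection_ideal X Gamma.
have [_ /linP[h ->] sec] := zero_dimensional_section hI dim0.
case: hX => m0 [a [a0 sum_a [A [freeA fullA XE]]]].
case: hGamma => n0 [b [b0 sum_b [B [freeB fullB GE]]]].
case: m => [//|m] in m0 a a0 sum_a A freeA fullA XE le_mn *.
case: n => [//|n] in n0 b b0 sum_b B freeB fullB GE le_mn *.
have [A' [AA' A'A]] := scroll_inverse freeA fullA.
have [B' [BB' B'B]] := scroll_inverse freeB fullB.
rewrite addn1 in sum_a sum_b; subst X Gamma.
have h_neq0 v : scroll_image A v -> scroll_image B v -> v *m h != 0.
  by move=> Xv Yv; exact: (section_misses_intersection sec Xv Yv (scroll_neq0 AA' Xv)).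
set I := intersection_ideal _ _ in hI sec *.
have subX : vanishing_ideal (scroll_image A) `<=` I by apply: sub_intersection_l.
have subY : vanishing_ideal (scroll_image B) `<=` I by apply: sub_intersection_r.
have S3 : contains_degree (adjoin1 I (lin h)) 3.
  move=> f /(scroll_section_degree3 AA' A'A sum_a a0 B'B h_neq0).
  have idIh := ideal_adjoin hI.1 (fun _ : 'I_1 => lin h).
  apply: ideal_sub_adjoin => // [|[u w]].
    apply: ideal_sub_adjoin => // [g Ig|i].
      by apply/sub_adjoin/subX.
    exact: (adjoin_mem hI.1).
  by apply/sub_adjoin/subY/(scroll_minor BB').
have b_gt0 : (0 < \sum_i b i)%N.
  by have [i bi] := b0; rewrite (bigD1 i) //= addn_gt0 lt0n bi.
have ltnr : (n < r)%N by rewrite -ltnS -sum_b -[X in (X < _)%N]add0n ltn_add2r.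
have hilb2 := scroll_hilbert2 m (\sum_i a i).
have binE := mul_bin_diag n.+1 1; rewrite bin1 /= in binE.
set H := scroll_hilbert m (\sum_i a i) 2 in hilb2.
have codimX : codim_le (vanishing_ideal (scroll_image A)) 2 H by apply: scroll_codim.
suff [N codimI leN] : exists2 N : nat, codim_le I 2 N &
    (N + 'C(n.+1, 2) <= n.+1 * r + m.+1 + 1)%N.
  have [l lenl leqlN] := length_exists hI (lin_homog h) S3 codimI.
  by exists l => //; lia.
(* From here [m] and [n] are one less than the dimensions. For dimensions differing by 1 the
   inequality is an equality; larger [n] only helps because [n < r]. *)
have [ltmn|lenm] := ltnP m n.
  exists H; first exact: codim_le_sub subX codimX.
  have [u nE] : exists u, n = (m + 1 + u)%N by exists (n - m.+1)%N; lia.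
  have [v rE] : exists v, r = (m + 2 + u + v)%N by exists (r - n.+1)%N; lia.
  have DE : (\sum_i a i = u + v + 2)%N.
    by apply/eqP; rewrite -(eqn_add2r m.+1) sum_a; lia.
  by rewrite DE in hilb2; subst n r; nia.
have {lenm le_mn} mn : n = m by lia.
case: (minors_independent_or_sub AA' BB' B'B ndX b_gt0) => [XY|[w [w2 wY indw]]].
  (* If [X] were contained in Gamma, a zero of [h] on [X] would lie on both scrolls. *)
  have [v Xv vh] := linear_form_zero A a0 h.
  by have := h_neq0 v Xv (XY v Xv); rewrite vh eqxx.
(* With [D - 1] independent minors removed, the inequality required of [N] is an equality. *)
exists (H - (\sum_i b i).-1)%N.
  by apply: codim_le_independent hI.1 subX w2 _ indw codimX => i; apply/subY/wY.
have aE : (\sum_i a i = r - m)%N.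
  by apply/eqP; rewrite -(eqn_add2r m.+1) sum_a; lia.
have bE : (\sum_i b i = r - m)%N.
  by apply/eqP; rewrite -(eqn_add2r n.+1) sum_b; lia.
rewrite aE in hilb2; rewrite bE; subst n.
have [v rE] : exists v, r = (m + 1 + v)%N by exists (r - m.+1)%N; lia.
have rmE : (r - m = v.+1)%N by lia.
by rewrite rmE /= in hilb2 *; rewrite rE; nia.
Qed.
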